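(* Let $n\ge 2$ be an integer. (a) $(\mathcal{P}_n, g)$ and $(SL\mathcal{P}_n, g)$ are complete, simply connected, homogeneous Riemannian manifolds with non-positive sectional curvature; moreover $(SL\mathcal{P}_n, g)$ is an Einstein manifold and $(\mathcal{P}_n, g)$ is isometric to the Riemannian product manifold $SL\mathcal{P}_n \times \mathbb{R}$. (b) The Ricci curvature of $(\mathcal{P}_n, g)$ at any point $Q$ is negative semi-definite, and, for a tangent vector $X$ at $Q$, $Ric_Q(X,X) = 0$ if and only if $X = \lambda Q$ for some $\lambda \in \mathbb{R}$; the scalar curvature of $(\mathcal{P}_n,g)$ is $-\frac{(n-1)n(n+2)}{8}$. (c) $(\mathcal{P}_n, g)$ and $(SL\mathcal{P}_n, g)$ are symmetric Riemannian manifolds and, for every point $Q$, the corresponding symmetry $\varphi_Q$ has $Q$ as its unique fixed point. (d) $(SL\mathcal{P}_2, g)$ is isometric to the hyperbolic plane $\mathcal{H}_2$ (endowed with the Riemannian metric having curvature $-\frac{1}{2}$); hence $\mathcal{P}_2$ is isometric to the Riemannian product $\mathcal{H}_2 \times \mathbb{R}$.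
   Context: $\mathcal{P}_n$ is the manifold of positive definite real symmetric $n\times n$ matrices (open in the space $Sym_n$ of real symmetric matrices, so with tangent space $Sym_n$ at each point); $SL\mathcal{P}_n$ is the submanifold of those with determinant $1$. The trace metric is $g_A(V,W)=\mathrm{tr}(A^{-1}VA^{-1}W)$ for tangent vectors $V,W$ at $A$, on $\mathcal{P}_n$ and by restriction on $SL\mathcal{P}_n$. $\mathbb{R}$ carries the Euclidean metric. Homogeneous means that the isometry group acts transitively. For a symmetric matrix $Q$, $\varphi_Q(X)=QX^{-1}Q$. The symmetry at a point $Q$ is an isometry fixing $Q$ with differential $-\mathrm{Id}$ at $Q$; a manifold is symmetric if such an isometry exists at every point. The symmetry corresponding to $Q$, both for $\mathcal{P}_n$ (with $Q\in\mathcal{P}_n$) and for $SL\mathcal{P}_n$ (with $Q\in SL\mathcal{P}_n$), is (the restriction of) $\varphi_Q$. The usual sign convention for Ricci curvature is used (positive on round spheres). *)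

(* Defs.v *)
From HB Require Import structures.
From mathcomp Require Import all_boot all_order all_algebra.
From mathcomp Require Import all_classical all_reals all_analysis.

Set Implicit Arguments.
Unset Strict Implicit.
Unset Printing Implicit Defensive.

Import Order.TTheory GRing.Theory Num.Theory.
Import numFieldNormedType.Exports.

Local Open Scope classical_set_scope.
Local Open Scope ring_scope.

(* Manifolds are embedded submanifolds [pts] of a finite-dimensional normed
   space [E]; differentiable notions on them are expressed through their smooth
   local parametrizations (inverses of charts), and curvature through the
   classical coordinate formulas, which are required in every parametrization.
   The default values of ['D_v f] and [invmx] are never relevant: functions are
   smooth wherever they are derived and metric matrices are invertible. *)

Section Smooth.
Variables (R : realType) (V W : normedModType R).

(* class C^k on the open set U, for V finite-dimensional *)
Fixpoint Ck (k : nat) (U : set V) (f : V -> W) : Prop :=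
  if k is k'.+1 then
    (forall x, U x -> differentiable f x) /\ forall v, Ck k' U ('D_v f)
  else forall x, U x -> {for x, continuous f}.

Definition smooth_on (U : set V) (f : V -> W) : Prop := forall k, Ck k U f.

End Smooth.

Section SimplyConnected.
Variables (R : realType) (E : normedModType R).
Implicit Types (A : set E).

Definition path_in A (c : R -> E) : Prop :=
  {within `[0, 1], continuous c} /\ forall t, t \in `[0, 1] -> A (c t).

Definition path_connected A : Prop :=
  A !=set0 /\ forall p q, A p -> A q ->
    exists c, [/\ path_in A c, c 0 = p & c 1 = q].

Definition unit_square : set (R * R) :=
  [set z | z.1 \in `[0, 1] /\ z.2 \in `[0, 1]].

Definition null_homotopic A (c : R -> E) : Prop :=
  exists H : R * R -> E,
    [/\ {within unit_square, continuous H},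
        forall z, unit_square z -> A (H z),
        forall t, t \in `[0, 1] -> H (t, 0) = c t,
        forall t, t \in `[0, 1] -> H (t, 1) = c 0
      & forall s, s \in `[0, 1] -> H (0, s) = c 0 /\ H (1, s) = c 0].

Definition simply_connected A : Prop :=
  path_connected A /\
  forall c, path_in A c -> c 0 = c 1 -> null_homotopic A c.

End SimplyConnected.

Record riem (R : realType) (E : normedModType R) := Riem {
  pts : set E ;
  mdim : nat ;
  (* met p v w is meaningful for p in pts and v, w tangent at p *)
  met : E -> E -> E -> R }.

Section CoordinateCurvature.
Variables (R : realType) (d : nat) (G : 'rV[R]_d -> 'M[R]_d).
Implicit Types (u x y z w : 'rV[R]_d) (i j k l m : 'I_d).

Definition basis_vec i : 'rV[R]_d := delta_mx 0 i.

Definition pder (f : 'rV[R]_d -> R) i u : R := 'D_(basis_vec i) f u.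

(* Gamma^k_ij *)
Definition christoffel k i j u : R :=
  2^-1 * \sum_l invmx (G u) k l *
    (pder (fun v => G v j l) i u + pder (fun v => G v i l) j u
     - pder (fun v => G v i j) l u).

(* R(d_i, d_j) d_k = \sum_l riem_coef l i j k d_l, with the convention
   R(X,Y)Z = nabla_X nabla_Y Z - nabla_Y nabla_X Z - nabla_[X,Y] Z *)
Definition riem_coef l i j k u : R :=
  pder (christoffel l j k) i u - pder (christoffel l i k) j u
  + \sum_m (christoffel l i m u * christoffel m j k u
            - christoffel l j m u * christoffel m i k u).

Definition inner u x y : R := \sum_i \sum_j G u i j * x 0 i * y 0 j.

(* G(R(x,y)z, w) *)
Definition riem4 u x y z w : R :=
  \sum_i \sum_j \sum_k \sum_l \sum_m
    riem_coef l i j k u * x 0 i * y 0 j * z 0 k * G u l m * w 0 m.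

Definition sectional_coord u x y : R :=
  riem4 u x y y x / (inner u x x * inner u y y - inner u x y ^+ 2).

(* Ric(y,z) is the trace of x |-> R(x,y)z *)
Definition ricci_coef j k u : R := \sum_i riem_coef i i j k u.

Definition ricci_coord u y z : R :=
  \sum_j \sum_k ricci_coef j k u * y 0 j * z 0 k.

Definition scalar_coord u : R :=
  \sum_j \sum_k invmx (G u) j k * ricci_coef j k u.

End CoordinateCurvature.

Section Manifold.
Variables (R : realType) (E : normedModType R) (S : riem E).
Implicit Types (phi : 'rV[R]_(mdim S) -> E) (U : set 'rV[R]_(mdim S)).

(* The last clause says that phi : U -> pts S is open for the induced topology;
   with injectivity and continuity, phi is a homeomorphism from U onto a
   relatively open subset of pts S. *)
Definition local_param U phi : Prop :=
  [/\ open U,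
      smooth_on U phi,
      {in U &, injective phi},
      forall u x, U u -> 'D_x phi u = 0 -> x = 0
    & forall U', open U' -> U' `<=` U ->
        exists2 W : set E, open W & phi @` U' = pts S `&` W].

Definition param_metric phi (u : 'rV[R]_(mdim S)) : 'M[R]_(mdim S) :=
  \matrix_(i, j) met S (phi u) ('D_(basis_vec R i) phi u)
                               ('D_(basis_vec R j) phi u).

Definition tangent (p v : E) : Prop :=
  exists U phi u x, [/\ local_param U phi, U u, phi u = p & 'D_x phi u = v].

Definition riemannian_manifold : Prop :=
  [/\ forall p, pts S p -> exists U phi u, [/\ local_param U phi, U u & phi u = p],
      forall p v w, tangent p v -> tangent p w -> met S p v w = met S p w v,
      forall p v v' w a, tangent p v -> tangent p v' -> tangent p w ->
        met S p (a *: v + v') w = a * met S p v w + met S p v' w,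
      forall p v, tangent p v -> v != 0 -> 0 < met S p v v
    & forall U phi i j, local_param U phi ->
        smooth_on U (fun u => param_metric phi u i j)].

Definition has_sectional (p v w : E) (K : R) : Prop :=
  forall U phi u x y, local_param U phi -> U u -> phi u = p ->
    'D_x phi u = v -> 'D_y phi u = w ->
    sectional_coord (param_metric phi) u x y = K.

Definition has_ricci (p v w : E) (r : R) : Prop :=
  forall U phi u x y, local_param U phi -> U u -> phi u = p ->
    'D_x phi u = v -> 'D_y phi u = w ->
    ricci_coord (param_metric phi) u x y = r.

Definition has_scalar (p : E) (s : R) : Prop :=
  forall U phi u, local_param U phi -> U u -> phi u = p ->
    scalar_coord (param_metric phi) u = s.

Definition independent2 (v w : E) : Prop :=
  forall a b : R, a *: v + b *: w = 0 -> a = 0 /\ b = 0.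

Definition nonpositive_curvature : Prop :=
  forall p v w, pts S p -> tangent p v -> tangent p w -> independent2 v w ->
    exists2 K, has_sectional p v w K & K <= 0.

Definition constant_curvature (K : R) : Prop :=
  forall p v w, pts S p -> tangent p v -> tangent p w -> independent2 v w ->
    has_sectional p v w K.

Definition einstein : Prop :=
  exists c : R, forall p v w, pts S p -> tangent p v -> tangent p w ->
    has_ricci p v w (c * met S p v w).

(* The geodesic equation does not depend on the parametrization around t0. *)
Definition geodesic (c : R -> E) : Prop :=
  forall t0 : R, exists U phi (x : R -> 'rV[R]_(mdim S)) (e : R),
    [/\ local_param U phi, 0 < e, smooth_on (ball t0 e) x
      & forall t, ball t0 e t ->
          [/\ U (x t), phi (x t) = c t
            & forall k, derive1n 2 x t 0 k
                + \sum_i \sum_j christoffel (param_metric phi) k i j (x t)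
                    * derive1 x t 0 i * derive1 x t 0 j = 0]].

(* geodesic completeness *)
Definition complete_manifold : Prop :=
  forall p v, pts S p -> tangent p v ->
    exists c, [/\ geodesic c, c 0 = p & derive1 c 0 = v].

End Manifold.

Section Isometry.
Variables (R : realType) (E E' : normedModType R) (S : riem E) (S' : riem E').

Definition smooth_map (F : E -> E') : Prop :=
  (forall p, pts S p -> pts S' (F p)) /\
  forall U phi, local_param (S := S) U phi -> smooth_on U (F \o phi).

Definition preserves_metric (F : E -> E') : Prop :=
  forall U phi u x y, local_param (S := S) U phi -> U u ->
    met S' (F (phi u)) ('D_x (F \o phi) u) ('D_y (F \o phi) u)
    = met S (phi u) ('D_x phi u) ('D_y phi u).

End Isometry.

Definition isometry (R : realType) (E E' : normedModType R)
    (S : riem E) (S' : riem E') (F : E -> E') : Prop :=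
  [/\ smooth_map S S' F, preserves_metric S S' F
    & exists F' : E' -> E, [/\ smooth_map S' S F',
        forall p, pts S p -> F' (F p) = p
      & forall q, pts S' q -> F (F' q) = q]].

Definition isometric (R : realType) (E E' : normedModType R)
    (S : riem E) (S' : riem E') : Prop :=
  exists F, isometry S S' F.

Section Homogeneous.
Variables (R : realType) (E : normedModType R) (S : riem E).

Definition homogeneous : Prop :=
  forall p q, pts S p -> pts S q -> exists2 F, isometry S S F & F p = q.

Definition symmetry_at (q : E) (F : E -> E) : Prop :=
  [/\ isometry S S F, F q = q
    & forall U phi u x, local_param (S := S) U phi -> U u -> phi u = q ->
        'D_x (F \o phi) u = - 'D_x phi u].

Definition symmetric_manifold : Prop :=
  forall q, pts S q -> exists F, symmetry_at q F.

End Homogeneous.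

Definition riem_prod (R : realType) (E E' : normedModType R)
    (S : riem E) (S' : riem E') : riem (E * E')%type :=
  Riem [set z | pts S z.1 /\ pts S' z.2] (mdim S + mdim S')
    (fun p v w => met S p.1 v.1 w.1 + met S' p.2 v.2 w.2).

Definition euclidean_line (R : realType) : riem R :=
  @Riem R R setT 1 (fun _ v w : R => v * w).

(* upper half-plane, with the metric of curvature -k *)
Definition hyperbolic_plane (R : realType) (k : R) : riem (R * R)%type :=
  @Riem R (R * R)%type [set z : R * R | 0 < z.2] 2
    (fun z v w : R * R => (v.1 * w.1 + v.2 * w.2) / (k * z.2 ^+ 2)).

Section PositiveDefinite.
Variables (R : realType) (n : nat).

Definition posdef (A : 'M[R]_n) : Prop :=
  A^T = A /\ forall x : 'rV[R]_n, x != 0 -> 0 < (x *m A *m x^T) 0 0.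

Definition trace_metric (A V W : 'M[R]_n) : R :=
  \tr (invmx A *m V *m invmx A *m W).

Definition PD : riem 'M[R]_n :=
  Riem [set A | posdef A] (n * n.+1)./2 trace_metric.

Definition SLPD : riem 'M[R]_n :=
  Riem [set A | posdef A /\ \det A = 1] (n * n.+1)./2.-1 trace_metric.

Definition phi_sym (Q X : 'M[R]_n) : 'M[R]_n := Q *m invmx X *m Q.

End PositiveDefinite.

Arguments PD : clear implicits.
Arguments SLPD : clear implicits.

(* Main.v *)
From HB Require Import structures.
Require Import Defs.
From mathcomp Require Import all_boot all_order all_algebra.
From mathcomp Require Import all_classical all_reals all_analysis.
From mathcomp Require Import ring lra.
From mathcomp Require Import complex.
Import Order.TTheory GRing.Theory Num.Theory.
Import numFieldNormedType.Exports.
Local Open Scope classical_set_scope.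
Local Open Scope ring_scope.
Set Implicit Arguments.
Unset Strict Implicit.
Unset Printing Implicit Defensive.

(** The trace metric g on positive definite matrices is handled through matrix
    algebra, uniformly for the cone and for its slice of determinant one.

    Curvature. Along a map phi into positive definite matrices, [cov] corrects
    the derivative of a field by the symbol - (V A^-1 W + W A^-1 V) / 2. It is
    free of torsion and compatible with g ([cov_torsion_free], [cov_metric]),
    and its curvature tensor is the explicit [trace_curvature]
    ([cov_curvature]). Both the cone and the slice are stable under [cov]
    ([param_totally_geodesic]): on the slice, tangent vectors are those
    orthogonal to the position A, and A is parallel. Hence, in any local
    parametrization of either of them, the Christoffel symbols are the
    coordinates of [cov] ([christoffel_cov]) and the coordinate curvature is
    that of the ambient tensor ([riem_coefE]), whatever the parametrization.

    Its sign. Writing A = M M^T and V = M a M^T turns g into the Frobenius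
    product and the curvature into - [[a, b], c] / 4. The numerator of the
    sectional curvature is then minus a quarter of the squared norm of [a, b]
    ([trace_curvature_num]). The Ricci curvature is a trace over the tangent
    space; computed over all matrices after a projection ([tangent_trace]), it
    is - (n g (W, Z) - g (A, W) g (A, Z)) / 4. On the slice the second term
    vanishes, which is the Einstein property. On the cone the equality case of
    Cauchy-Schwarz against the radial vector A gives the kernel, and one more
    contraction gives the scalar curvature.

    Global structure. If Q = M M^T and V = M diag(d) M^T ([posdef_simul_diag],
    from the spectral theorem), the geodesic with initial data (Q, V) is
    M diag(exp(t d)) M^T, defined for all t ([trace_complete]). Segments, scaled
    back to determinant one on the slice, contract loops. Congruences
    A |-> L A L^T are isometries and act transitively; X |-> Q X^-1 Q is an
    isometry which is minus the identity at Q.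

    Products and order two. Splitting vectors into radial and orthogonal parts
    shows that A |-> (det A ^ (- 1 / n) A, ln det A / sqrt n) is an isometry
    onto the product ([product_metric]). For n = 2 the matrices of determinant
    one are the quadratic polynomials with a given root in the upper half-plane
    ([half_plane_metric]), and for traceless symmetric a, b the squared norm of
    [a, b] is twice the Gram determinant, hence the curvature - 1 / 2. *)

(** * Calculus of smooth functions *)

Section LinearDerive.
Variables (R : realType) (V W W' : normedModType R).

Lemma diff_linear_comp (L : W -> W') (f : V -> W) x :
  linear L -> continuous L -> differentiable f x ->
  differentiable (fun y => L (f y)) x /\
  forall v, 'D_v (fun y => L (f y)) x = L ('D_v f x).
Proof.
move=> lL cL df.
pose LM := GRing.isLinear.Build _ _ _ _ _ lL.
pose LL : {linear W -> W'} := HB.pack L LM.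
have cLL : continuous LL by exact: cL.
have dL : differentiable LL (f x) by exact: linear_differentiable.
have dc : differentiable (LL \o f) x by exact: differentiable_comp.
split=> // v; rewrite (_ : (fun y => _) = LL \o f)// deriveE// diff_comp//=.
by rewrite (deriveE _ df) (diff_lin (f x) cLL).
Qed.

Lemma derive_linear_arg (f : V -> W) x : differentiable f x ->
  forall a v w, 'D_(a *: v + w) f x = a *: 'D_v f x + 'D_w f x.
Proof. by move=> df a v w; rewrite !deriveE// linearP. Qed.

Lemma derive_comb (f : V -> W) u : differentiable f u -> forall a b x y,
  'D_(a *: x + b *: y) f u = a *: 'D_x f u + b *: 'D_y f u.
Proof.
by move=> df a b x y; rewrite (derive_linear_arg df) !(deriveE _ df) linearZ.
Qed.

Lemma derive_comp (g : V -> W) (f : W -> W') x v :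
  differentiable g x -> differentiable f (g x) ->
  'D_v (fun y => f (g y)) x = 'D_('D_v g x) f (g x).
Proof.
move=> dg df; have dc : differentiable (f \o g) x by exact: differentiable_comp.
rewrite -[LHS]/('D_v (f \o g) x) (deriveE v dc) diff_comp//=.
by rewrite (deriveE _ df) (deriveE _ dg).
Qed.

Lemma differentiable_near0 (h : V -> W) x :
  (\near x, h x = 0) -> differentiable h x.
Proof.
move=> h0; have E : h \o shift x = cst (h x) + \0 +o_ 0 id.
  apply/eqaddoP => _/posnumP[e].
  have : \forall y \near (0 : V), h (y + x) = 0.
    by rewrite (near_shift x) /= sub0r; near=> z; rewrite /= subrK; near: z.
  apply: filterS => y /= Ey.
  rewrite -[X in `|X|]/(h (y + x) - (h x + 0)) Ey (nbhs_singleton h0).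
  by rewrite addr0 subrr normr0 mulr_ge0.
have c0 : continuous (\0 : {linear V -> W}) by move=> ?; exact: cst_continuous.
by apply/diff_locallyP; rewrite (diff_unique c0 E).
Unshelve. all: by end_near. Qed.

(** Differentiability is a local property: the difference of the two maps
    vanishes near [x], hence has differential zero there. *)
Lemma near_eq_differentiable (f g : V -> W) x :
  (\near x, f x = g x) -> differentiable f x -> differentiable g x.
Proof.
move=> fg df.
have -> : g = f + (g - f) by apply/funext => y; rewrite !fctE subrKC.
apply: differentiableD => //; apply: differentiable_near0.
by apply: filterS fg => y fgy; rewrite !fctE fgy subrr.
Qed.

End LinearDerive.

Lemma derive_real_comp (R : realType) (V : normedModType R) (F : R -> R)
    (f : V -> R) x d : differentiable f x -> is_derive (f x) 1 F d ->
  differentiable (fun y => F (f y)) x /\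
  forall v, 'D_v (fun y => F (f y)) x = 'D_v f x * d.
Proof.
move=> dfx dF; have dFx : differentiable F (f x).
  by apply/derivable1_diffP; case: dF.
have dc : differentiable (F \o f) x by exact: differentiable_comp.
split=> // v; rewrite -[LHS]/('D_v (F \o f) x) (deriveE v dc) diff_comp//=.
rewrite -(deriveE v dfx) -[X in 'd F _ X]mulr1.
rewrite -[X in 'd F _ X]/('D_v f x *: (1 : R)).
by rewrite linearZ /= -(deriveE (1 : R) dFx); case: dF => _ ->.
Qed.

Section CkCalculus.
Variables (R : realType) (V : normedModType R).
Variable U : set V.
Hypothesis oU : open U.

Lemma open_near_eq (W : Type) (f g : V -> W) x :
  (forall y, U y -> f y = g y) -> U x -> \near x, f x = g x.
Proof.
move=> fg Ux; near=> y; apply: fg; near: y; exact: open_nbhs_nbhs.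
Unshelve. all: by end_near. Qed.

Section Gen.
Variable W : normedModType R.
Implicit Types f g : V -> W.

Lemma open_eq_derive f g x v :
  (forall y, U y -> f y = g y) -> U x -> 'D_v f x = 'D_v g x.
Proof. by move=> fg Ux; apply: near_eq_derive; exact: open_near_eq. Qed.

(** Derivatives of compound functions are computed at the points of [U] only;
    this invariance is what lets those formulas be substituted in [Ck]. *)
Lemma Ck_ext k f g : (forall y, U y -> f y = g y) -> Ck k U f -> Ck k U g.
Proof.
elim: k f g => [|k IH] f g fg /=.
  move=> cf x Ux; rewrite /prop_for /continuous_at -(fg _ Ux).
  apply: cvg_trans (cf _ Ux); apply: near_eq_cvg.
  exact: open_near_eq.
move=> [df Dk]; split=> [x Ux|v].
  by apply: near_eq_differentiable (df _ Ux); exact: open_near_eq.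
by apply: IH (Dk v) => y Uy; exact: open_eq_derive.
Qed.

Lemma CkW k f : Ck k.+1 U f -> Ck k U f.
Proof.
elim: k f => [|k IH] f /= [df Dk].
  by move=> x Ux; apply: differentiable_continuous; exact: df.
by split=> // v; apply: IH.
Qed.

Lemma smooth_ext f g : (forall y, U y -> f y = g y) ->
  smooth_on U f -> smooth_on U g.
Proof. by move=> fg sf k; exact: Ck_ext (sf k). Qed.

Lemma smooth_diff f x : smooth_on U f -> U x -> differentiable f x.
Proof. by move=> /(_ 1%N) [df _]; exact: df. Qed.

Lemma smooth_continuous f x : smooth_on U f -> U x -> {for x, continuous f}.
Proof. by move=> /(_ 0%N); apply. Qed.

Lemma smooth_derive f v : smooth_on U f -> smooth_on U ('D_v f).
Proof. by move=> sf k; case: (sf k.+1) => _; apply. Qed.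

Lemma CkD k f g : Ck k U f -> Ck k U g -> Ck k U (fun x => f x + g x).
Proof.
elim: k f g => [|k IH] f g /=.
  by move=> cf cg x Ux; apply: continuousD; [exact: cf|exact: cg].
move=> [df Df] [dg Dg]; split=> [x Ux|v].
  by apply: differentiableD; [exact: df|exact: dg].
apply: Ck_ext (IH _ _ (Df v) (Dg v)) => y Uy /=.
by rewrite deriveD//; apply: diff_derivable; [exact: df|exact: dg].
Qed.

Lemma Ck_cst k (c : W) : Ck k U (fun=> c).
Proof.
elim: k c => [|k IH] c /=; first by move=> x Ux; exact: cst_continuous.
split=> [x Ux|v]; first exact: differentiable_cst.
by apply: Ck_ext (IH 0) => y Uy; rewrite derive_cst.
Qed.

Lemma smooth_cst (c : W) : smooth_on U (fun=> c).
Proof. by move=> k; exact: Ck_cst. Qed.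

Lemma smoothD f g : smooth_on U f -> smooth_on U g ->
  smooth_on U (fun x => f x + g x).
Proof. by move=> sf sg k; exact: CkD. Qed.

Lemma smooth_sum (I : Type) (r : seq I) (P : pred I) (f : I -> V -> W) :
  (forall i, P i -> smooth_on U (f i)) ->
  smooth_on U (fun x => \sum_(i <- r | P i) f i x).
Proof.
move=> sf; elim: r => [|i r IH].
  by apply: smooth_ext (smooth_cst 0) => y _; rewrite big_nil.
case Pi: (P i); last by apply: smooth_ext IH => y _; rewrite big_cons Pi.
by apply: smooth_ext (smoothD (sf i Pi) IH) => y _; rewrite big_cons Pi.
Qed.

Lemma smooth_lin (L : V -> W) : linear L -> continuous L -> smooth_on U L.
Proof.
move=> lL cL.
have dL x : differentiable (id : V -> V) x by exact: ex_diff.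
case=> [|k] /=; first by move=> x _; exact: cL.
split=> [x _|v]; first by have [] := diff_linear_comp lL cL (dL x).
apply: Ck_ext (Ck_cst k (L v)) => y _.
by have [_ ->] := diff_linear_comp lL cL (dL y); rewrite derive_id.
Qed.

End Gen.

Lemma smooth_id : smooth_on U (id : V -> V).
Proof. by apply: smooth_lin => // ?; exact: cvg_id. Qed.

Lemma smooth_lin_comp (W W' : normedModType R) (L : W -> W') (f : V -> W) :
  linear L -> continuous L -> smooth_on U f -> smooth_on U (fun x => L (f x)).
Proof.
move=> lL cL sf k; move: (sf k); elim: k f {sf} => [|k IH] f /=.
  move=> cf x Ux; apply: (@continuous_comp _ _ _ f L); first exact: cf.
  exact: cL.
move=> [df Df]; split=> [x Ux|v].
  by have [] := diff_linear_comp lL cL (df _ Ux).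
apply: Ck_ext (IH _ (Df v)) => y Uy /=.
by have [_ ->] := diff_linear_comp lL cL (df _ Uy).
Qed.

Section RealValued.
Implicit Types f g : V -> R.

Lemma CkM k f g : Ck k U f -> Ck k U g -> Ck k U (fun x => f x * g x).
Proof.
elim: k f g => [|k IH] f g.
  by move=> cf cg x Ux; apply: continuousM; [exact: cf|exact: cg].
move=> cf cg; have cf' := CkW cf; have cg' := CkW cg.
move: cf cg => /= [df Df] [dg Dg]; split=> [x Ux|v].
  by apply: differentiableM; [exact: df|exact: dg].
apply: Ck_ext (CkD (IH _ _ cf' (Dg v)) (IH _ _ cg' (Df v))) => y Uy /=.
by rewrite deriveM//; apply: diff_derivable; [exact: df|exact: dg].
Qed.

Lemma smoothM f g : smooth_on U f -> smooth_on U g ->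
  smooth_on U (fun x => f x * g x).
Proof. by move=> sf sg k; exact: CkM. Qed.

Lemma smoothN f : smooth_on U f -> smooth_on U (fun x => - f x).
Proof.
move=> sf; apply: (@smooth_ext _ (fun x => -1 * f x)) => [y _|].
  by rewrite mulN1r.
by apply: smoothM => //; exact: smooth_cst.
Qed.

Lemma smoothB f g : smooth_on U f -> smooth_on U g ->
  smooth_on U (fun x => f x - g x).
Proof. by move=> sf sg; apply: smoothD => //; exact: smoothN. Qed.

Lemma smoothX f n : smooth_on U f -> smooth_on U (fun x => f x ^+ n).
Proof.
move=> sf; elim: n => [|n IH]; first exact: smooth_cst.
apply: (@smooth_ext _ (fun x => f x * f x ^+ n)) => [y _|].
  by rewrite exprS.
exact: smoothM.
Qed.

Lemma smooth_prod (I : Type) (r : seq I) (P : pred I) (f : I -> V -> R) :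
  (forall i, P i -> smooth_on U (f i)) ->
  smooth_on U (fun x => \prod_(i <- r | P i) f i x).
Proof.
move=> sf; elim: r => [|i r IH].
  apply: (@smooth_ext _ (fun=> 1 : R)) => [y _|]; first by rewrite big_nil.
  exact: smooth_cst.
case Pi: (P i); last by apply: smooth_ext IH => y _; rewrite big_cons Pi.
apply: (@smooth_ext _ (fun x => f i x * \prod_(j <- r | P j) f j x)) => [y _|].
  by rewrite big_cons Pi.
by apply: smoothM => //; exact: sf.
Qed.

(** A function [F] of one real variable composes smoothly with [f] as soon as
    its derivative is, up to composition, a polynomial in [F] itself and in
    functions already known to be smooth; [expR] and the inverse are of that
    kind, which is why the induction on the class of differentiability closes. *)
Lemma smooth_real_comp (F : R -> R) (G : R -> R -> R) f :
  (forall x, U x -> is_derive (f x) 1 F (G (f x) (F (f x)))) ->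
  (forall k h, Ck k U h -> Ck k U f -> Ck k U (fun x => G (f x) (h x))) ->
  smooth_on U f -> smooth_on U (fun x => F (f x)).
Proof.
move=> dF GC sf.
have C x (Ux : U x) := derive_real_comp (smooth_diff sf Ux) (dF x Ux).
elim=> [|k IH].
  by move=> x Ux; apply: differentiable_continuous; case: (C x Ux).
split=> [x Ux|v]; first by case: (C x Ux).
apply: Ck_ext (CkM (smooth_derive v sf k) (GC _ _ IH (sf k))) => y Uy.
by case: (C y Uy) => _ ->.
Qed.

Lemma smooth_expR f : smooth_on U f -> smooth_on U (fun x => expR (f x)).
Proof.
by apply: (@smooth_real_comp expR (fun _ y => y)) => // x _; exact: is_derive_expR.
Qed.

Lemma smoothV f : (forall x, U x -> f x != 0) -> smooth_on U f ->
  smooth_on U (fun x => (f x)^-1).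
Proof.
move=> f0; apply: (@smooth_real_comp GRing.inv (fun _ y => -1 * (y * y))).
  move=> x Ux; have := @is_deriveV R id (f x) 1 1 (f0 x Ux) (is_derive_id _ _).
  by rewrite /GRing.scale /= mulr1 -exprVn expr2 mulN1r.
by move=> k h hC _; do !apply: CkM => //; exact: Ck_cst.
Qed.

Lemma smooth_ln f : (forall x, U x -> 0 < f x) -> smooth_on U f ->
  smooth_on U (fun x => ln (f x)).
Proof.
move=> f0 sf.
apply: (@smooth_real_comp (@ln R) (fun x _ => x^-1)) => //.
  by move=> x Ux; apply: is_derive1_ln; exact: f0.
move=> k h _ _; apply: smoothV => // x Ux; exact: lt0r_neq0 (f0 _ Ux).
Qed.

End RealValued.

Section MatrixValued.
Variables (m n p : nat).

Lemma linear_entry i j : linear (fun A : 'M[R]_(m, n) => A i j : R).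
Proof. by move=> a A B; rewrite !mxE. Qed.

Lemma linear_scale_delta (W : normedModType R) (D : W) : linear (fun r : R => r *: D).
Proof. by move=> a x y; rewrite scalerDl scalerA. Qed.

Lemma smooth_entry (f : V -> 'M[R]_(m, n)) i j :
  smooth_on U f -> smooth_on U (fun x => f x i j).
Proof.
by apply: (smooth_lin_comp (linear_entry i j)) => //; exact: coord_continuous.
Qed.

(** Since f is the sum of its entries times elementary matrices, smoothness of
    matrix-valued maps is entrywise and reduces to real-valued functions. *)
Lemma smooth_mx (f : V -> 'M[R]_(m, n)) :
  (forall i j, smooth_on U (fun x => f x i j)) -> smooth_on U f.
Proof.
move=> sf; apply: (@smooth_ext _
  (fun x => \sum_i \sum_j f x i j *: delta_mx i j)).
  by move=> y _; rewrite -matrix_sum_delta.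
apply: smooth_sum => i _; apply: smooth_sum => j _.
apply: (smooth_lin_comp (@linear_scale_delta _ (delta_mx i j))) => //.
exact: scalel_continuous.
Qed.

Lemma differentiable_mx (f : V -> 'M[R]_(m, n)) x :
  (forall i j, differentiable (fun x => f x i j) x) -> differentiable f x.
Proof.
move=> df; have -> : f = fun x => \sum_i \sum_j f x i j *: delta_mx i j.
  by apply/funext => y; rewrite -matrix_sum_delta.
have sumE k (g : 'I_k -> V -> 'M[R]_(m, n)) :
    (fun x => \sum_i g i x) = \sum_i g i.
  by apply/funext => y; rewrite fct_sumE.
rewrite sumE; apply: differentiable_sum => i; rewrite sumE.
apply: differentiable_sum => j.
by have [] := diff_linear_comp (linear_scale_delta (delta_mx i j))
  (@scalel_continuous _ _ _) (df i j).
Qed.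

Lemma derive_entry (f : V -> 'M[R]_(m, n)) x v i j : differentiable f x ->
  'D_v f x i j = 'D_v (fun y => f y i j) x.
Proof.
move=> df.
by have [_ ->] := diff_linear_comp (linear_entry i j) (@coord_continuous _ _ _ _ _) df.
Qed.

Lemma differentiable_entry (f : V -> 'M[R]_(m, n)) x i j : differentiable f x ->
  differentiable (fun y => f y i j) x.
Proof.
by move=> df; have [] := diff_linear_comp (linear_entry i j) (@coord_continuous _ _ _ _ _) df.
Qed.

End MatrixValued.

End CkCalculus.

Lemma open_cst_derive (R : realType) (V W : normedModType R) (O : set V)
    (f : V -> W) c x v : open O -> (forall y, O y -> f y = c) -> O x ->
  'D_v f x = 0.
Proof.
move=> oO fc Ox; refine (etrans (open_eq_derive oO v (g := cst c) fc Ox) _).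
exact: derive_cst.
Qed.

Lemma smooth_subset (R : realType) (V W : normedModType R) (U U' : set V)
    (f : V -> W) : U' `<=` U -> smooth_on U f -> smooth_on U' f.
Proof.
move=> sUU' sf k; move: (sf k); elim: k (f) => [|k IH] g /=.
  by move=> cg x /sUU'; exact: cg.
by move=> [dg Dg]; split=> [x /sUU'|v]; [exact: dg|exact: IH].
Qed.


Section SmoothPair.
Variables (R : realType) (V W W' : normedModType R).

Lemma linear_inl : linear (fun x : W => (x, 0) : W * W').
Proof. by move=> a x y; congr (_, _); rewrite /= scaler0 addr0. Qed.

Lemma linear_inr : linear (fun y : W' => (0, y) : W * W').
Proof. by move=> a x y; congr (_, _); rewrite /= scaler0 addr0. Qed.

Lemma continuous_inl : continuous (fun x : W => (x, 0) : W * W').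
Proof. by move=> x; apply: cvg_pair => //; exact: cvg_cst. Qed.

Lemma continuous_inr : continuous (fun y : W' => (0, y) : W * W').
Proof. by move=> x; apply: cvg_pair => //; exact: cvg_cst. Qed.

Lemma linear_fst : linear (fst : W * W' -> W). Proof. by []. Qed.
Lemma linear_snd : linear (snd : W * W' -> W'). Proof. by []. Qed.

Lemma continuous_fst : continuous (fst : W * W' -> W).
Proof. by move=> x; exact: cvg_fst. Qed.
Lemma continuous_snd : continuous (snd : W * W' -> W').
Proof. by move=> x; exact: cvg_snd. Qed.

Lemma smooth_pair (U : set V) (f : V -> W) (g : V -> W') : open U ->
  smooth_on U f -> smooth_on U g -> smooth_on U (fun x => (f x, g x)).
Proof.
move=> oU sf sg; apply: (@smooth_ext _ _ _ oU _
  (fun x => ((f x, 0) : W * W') + ((0, g x) : W * W'))).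
  by move=> y _; congr (_, _); rewrite /= ?addr0 ?add0r.
apply: (smoothD oU); [apply: (smooth_lin_comp oU linear_inl)|
  apply: (smooth_lin_comp oU linear_inr)] => //.
- exact: continuous_inl.
- exact: continuous_inr.
Qed.

Lemma derive_pair (f : V -> W) (g : V -> W') x v :
  differentiable f x -> differentiable g x ->
  'D_v (fun y => (f y, g y)) x = ('D_v f x, 'D_v g x).
Proof.
move=> df dg; have dp : differentiable (fun y => (f y, g y)) x.
  exact: differentiable_pair.
have [_ /(_ v) E1] := diff_linear_comp linear_fst continuous_fst dp.
have [_ /(_ v) E2] := diff_linear_comp linear_snd continuous_snd dp.
by rewrite [LHS]surjective_pairing -E1 -E2.
Qed.

End SmoothPair.

Lemma continuous_pairl (R : realType) (W W' : normedModType R) (a : W) :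
  continuous (fun y : W' => (a, y) : W * W').
Proof. by move=> x; apply: cvg_pair => //; exact: cvg_cst. Qed.

Lemma cvg_pair_nbhs (R : realType) (W W' : normedModType R) (T : Type)
    (F : set_system T) (f : T -> W) (g : T -> W') (a : W) (b : W') : Filter F ->
  f @ F --> a -> g @ F --> b -> (fun z => (f z, g z)) @ F --> ((a, b) : W * W').
Proof. by move=> FF fa gb; apply: cvg_pair. Qed.

Section MatrixCalculus.
Variables (R : realType) (V : normedModType R).

Section Smooth.
Variable U : set V.
Hypothesis oU : open U.

Lemma smooth_mulmx m n p (f : V -> 'M[R]_(m, n)) (g : V -> 'M[R]_(n, p)) :
  smooth_on U f -> smooth_on U g -> smooth_on U (fun x => f x *m g x).
Proof.
move=> sf sg; apply: smooth_mx => // i j.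
apply: (@smooth_ext _ _ _ oU _ (fun x => \sum_k f x i k * g x k j)) => [y _|].
  by rewrite mxE.
by apply: smooth_sum => // k _; apply: smoothM => //; exact: smooth_entry.
Qed.

Lemma smooth_scale m n (k : V -> R) (f : V -> 'M[R]_(m, n)) :
  smooth_on U k -> smooth_on U f -> smooth_on U (fun x => k x *: f x).
Proof.
move=> sk sf; apply: smooth_mx => // i j.
apply: (@smooth_ext _ _ _ oU _ (fun x => k x * f x i j)) => [y _|].
  by rewrite mxE.
by apply: smoothM => //; exact: smooth_entry.
Qed.

Lemma smooth_mxtrace n (f : V -> 'M[R]_n) :
  smooth_on U f -> smooth_on U (fun x => \tr (f x)).
Proof. by move=> sf; apply: smooth_sum => // i _; exact: smooth_entry. Qed.

Lemma smooth_det n (f : V -> 'M[R]_n) :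
  smooth_on U f -> smooth_on U (fun x => \det (f x)).
Proof.
move=> sf; apply: smooth_sum => // s _; apply: smoothM => //.
  exact: smooth_cst.
by apply: smooth_prod => // i _; exact: smooth_entry.
Qed.

(** By Cramer's rule the entries of the inverse are rational in those of [f]. *)
Lemma smooth_invmx n (f : V -> 'M[R]_n) :
  (forall x, U x -> f x \in unitmx) ->
  smooth_on U f -> smooth_on U (fun x => invmx (f x)).
Proof.
move=> fu sf; apply: smooth_mx => // i j.
apply: (@smooth_ext _ _ _ oU _ (fun x => (\det (f x))^-1 *
    ((-1) ^+ (j + i) * \det (row' j (col' i (f x)))))) => [y Uy|].
  by rewrite /invmx fu// !mxE.
apply: smoothM => //.
  apply: smoothV => // [x Ux|]; last exact: smooth_det.
  by have := fu x Ux; rewrite unitmxE unitfE.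
apply: smoothM => //; first exact: smooth_cst.
apply: smooth_det; apply: smooth_mx => // k l.
apply: (@smooth_ext _ _ _ oU _ (fun x => f x (lift j k) (lift i l))) => [y _|].
  by rewrite !mxE.
exact: smooth_entry.
Qed.

End Smooth.

Lemma differentiable_sum_fun (I : Type) (r : seq I) (W : normedModType R)
    (f : I -> V -> W) x : (forall i, differentiable (f i) x) ->
  differentiable (fun y => \sum_(i <- r) f i y) x.
Proof.
move=> df; elim: r => [|i r IH].
  rewrite (_ : (fun _ => _) = cst 0); first exact: differentiable_cst.
  by apply/funext => y; rewrite big_nil.
rewrite (_ : (fun _ => _) = f i + fun y => \sum_(i <- r) f i y).
  exact: differentiableD.
by apply/funext => y; rewrite big_cons.
Qed.

Lemma derive_sum_fun (I : Type) (r : seq I) (W : normedModType R)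
    (f : I -> V -> W) x v : (forall i, differentiable (f i) x) ->
  'D_v (fun y => \sum_(i <- r) f i y) x = \sum_(i <- r) 'D_v (f i) x.
Proof.
move=> df; elim: r => [|i r IH].
  rewrite big_nil (_ : (fun _ => _) = cst 0) ?derive_cst//.
  by apply/funext => y; rewrite big_nil.
rewrite big_cons -IH.
rewrite (_ : (fun _ => _) = f i + fun y => \sum_(i <- r) f i y).
  by rewrite deriveD//; apply: diff_derivable => //; exact: differentiable_sum_fun.
by apply/funext => y; rewrite big_cons.
Qed.

Lemma derive_mul (f g : V -> R) x v : differentiable f x -> differentiable g x ->
  'D_v (fun y => f y * g y) x = 'D_v f x * g x + f x * 'D_v g x.
Proof.
move=> df dg; rewrite [LHS]deriveM; try exact: diff_derivable.
by rewrite addrC /GRing.scale /= mulrC.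
Qed.

Lemma differentiable_mulmx m n p (f : V -> 'M[R]_(m, n))
    (g : V -> 'M[R]_(n, p)) x :
  differentiable f x -> differentiable g x ->
  differentiable (fun x => f x *m g x) x.
Proof.
move=> df dg; apply: differentiable_mx => i j.
rewrite (_ : (fun _ => _) = fun x => \sum_k f x i k * g x k j); last first.
  by apply/funext => y; rewrite mxE.
apply: differentiable_sum_fun => k.
by apply: differentiableM; exact: differentiable_entry.
Qed.

Lemma derive_mulmx m n p (f : V -> 'M[R]_(m, n)) (g : V -> 'M[R]_(n, p)) x v :
  differentiable f x -> differentiable g x ->
  'D_v (fun x => f x *m g x) x = 'D_v f x *m g x + f x *m 'D_v g x.
Proof.
move=> df dg; apply/matrixP => i j.
rewrite derive_entry; last exact: differentiable_mulmx.
rewrite (_ : (fun _ => _) = fun x => \sum_k f x i k * g x k j); last first.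
  by apply/funext => y; rewrite mxE.
have D k : differentiable (fun x => f x i k * g x k j) x.
  by apply: differentiableM; exact: differentiable_entry.
rewrite (derive_sum_fun _ _ D) !mxE -big_split /=; apply: eq_bigr => k _.
rewrite derive_mul; try exact: differentiable_entry.
by rewrite (derive_entry _ _ _ df) (derive_entry _ _ _ dg).
Qed.

Lemma differentiable_cstmul m n p (A : 'M[R]_(m, n)) (f : V -> 'M[R]_(n, p)) x :
  differentiable f x -> differentiable (fun x => A *m f x) x.
Proof. by move=> df; apply: differentiable_mulmx => //; exact: differentiable_cst. Qed.

Lemma derive_cstmul m n p (A : 'M[R]_(m, n)) (f : V -> 'M[R]_(n, p)) x v :
  differentiable f x -> 'D_v (fun x => A *m f x) x = A *m 'D_v f x.
Proof.
move=> df; rewrite (derive_mulmx v (differentiable_cst _ _) df).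
by rewrite derive_cst mul0mx add0r.
Qed.

Lemma derive_mulcst m n p (A : 'M[R]_(n, p)) (f : V -> 'M[R]_(m, n)) x v :
  differentiable f x -> 'D_v (fun x => f x *m A) x = 'D_v f x *m A.
Proof.
move=> df; rewrite (derive_mulmx v df (differentiable_cst _ _)).
by rewrite derive_cst mulmx0 addr0.
Qed.

Lemma derive_scalemx m n (c : V -> R) (Z : V -> 'M[R]_(m, n)) u x :
  differentiable c u -> differentiable Z u ->
  differentiable (fun v => c v *: Z v) u /\
  'D_x (fun v => c v *: Z v) u = 'D_x c u *: Z u + c u *: 'D_x Z u.
Proof.
move=> dc dZ.
have eE i j : (fun v => (c v *: Z v) i j) = (fun v => c v * Z v i j).
  by apply/funext => v; rewrite mxE.
have dcZ : differentiable (fun v => c v *: Z v) u.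
  apply: differentiable_mx => i j; rewrite eE.
  by apply: differentiableM => //; exact: differentiable_entry.
split=> //; apply/matrixP => i j; rewrite (derive_entry x i j dcZ) eE.
rewrite (derive_mul x dc (differentiable_entry i j dZ)).
by rewrite !mxE (derive_entry x i j dZ).
Qed.

Lemma derive_trmx m n (f : V -> 'M[R]_(m, n)) x v : differentiable f x ->
  'D_v (fun x => (f x)^T) x = ('D_v f x)^T.
Proof.
move=> df; have dt : differentiable (fun x => (f x)^T) x.
  apply: differentiable_mx => k l.
  rewrite (_ : (fun _ => _) = fun x => f x l k).
    exact: differentiable_entry.
  by apply/funext => y; rewrite [LHS]mxE.
apply/matrixP => i j; rewrite [RHS]mxE (derive_entry _ _ _ df).
have -> : (fun y => f y j i) = fun y => (f y)^T i j.
  by apply/funext => y; rewrite [RHS]mxE.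
exact: derive_entry.
Qed.

Lemma derive_mxtrace n (f : V -> 'M[R]_n) x v : differentiable f x ->
  'D_v (fun x => \tr (f x)) x = \tr ('D_v f x).
Proof.
move=> df; rewrite [LHS]derive_sum_fun; last first.
  by move=> i; exact: differentiable_entry.
by apply: eq_bigr => i _; rewrite -derive_entry.
Qed.

(** Differentiate the product of [f] with its inverse, which is constant on [U]. *)
Lemma derive_invmx (U : set V) n (f : V -> 'M[R]_n) x v : open U ->
  (forall x, U x -> f x \in unitmx) -> smooth_on U f -> U x ->
  'D_v (fun x => invmx (f x)) x = - (invmx (f x) *m 'D_v f x *m invmx (f x)).
Proof.
move=> oU fu sf Ux.
have df := smooth_diff sf Ux.
have di := smooth_diff (smooth_invmx oU fu sf) Ux.
have : 'D_v (fun x => f x *m invmx (f x)) x = 0.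
  rewrite (@open_eq_derive _ _ _ oU _ _ (cst 1%:M)) ?derive_cst//.
  by move=> y Uy; rewrite mulmxV ?fu.
rewrite (derive_mulmx _ df di) => /eqP; rewrite addrC addr_eq0 => /eqP E.
rewrite -[LHS](mulKmx (fu x Ux)) E mulmxN mulmxA.
by [].
Qed.

End MatrixCalculus.

Section Jacobi.
Variables (R : realType).

Lemma det_add_delta n (A : 'M[R]_n) i j h :
  \det (A + h *: delta_mx i j) = \det A + h * cofactor A i j.
Proof.
have cE k : cofactor (A + h *: delta_mx i j) i k = cofactor A i k.
  congr (_ * \det _); apply/matrixP => a b; rewrite !mxE.
  by rewrite eq_sym (negbTE (neq_lift _ _)) mulr0 addr0.
rewrite (expand_det_row _ i) (expand_det_row A i).
rewrite (bigD1 j)//= [in RHS](bigD1 j)//= cE !mxE !eqxx mulr1 mulrDl.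
rewrite -!addrA; congr (_ + _); rewrite addrC; congr (_ + _).
apply: eq_bigr => k kj; rewrite cE !mxE eqxx (negbTE kj).
by rewrite mulr0 addr0.
Qed.

Lemma derive_det_delta n (A : 'M[R]_n) i j :
  'D_(delta_mx i j) (fun A : 'M[R]_n => \det A) A = cofactor A i j.
Proof.
rewrite /derive; apply: (lim_near_cst (@Rhausdorff R)) => /=.
near=> h; rewrite [h *: _ + A]addrC det_add_delta [_ - _]addrC addKr.
rewrite /GRing.scale /= mulKf//.
by near: h; exact: nbhs_dnbhs_neq.
Unshelve. all: by end_near. Qed.

Lemma differentiable_det n (A : 'M[R]_n) :
  differentiable (fun A : 'M[R]_n => \det A) A.
Proof.
apply: (@smooth_diff _ _ setT) => //.
by apply: smooth_det; [exact: openT|exact: smooth_id openT].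
Qed.

(** Jacobi's formula: the determinant is affine in each entry, with slope the
    corresponding cofactor. *)
Lemma derive_det (V : normedModType R) n (f : V -> 'M[R]_n) x v :
  differentiable f x ->
  differentiable (fun x => \det (f x)) x /\
  'D_v (fun x => \det (f x)) x = \tr (\adj (f x) *m 'D_v f x).
Proof.
move=> df; set D := fun A : 'M[R]_n => \det A.
have dD := differentiable_det (f x).
have dc : differentiable (D \o f) x by exact: differentiable_comp.
split=> //; rewrite -[LHS]/('D_v (D \o f) x) (deriveE v dc) diff_comp//=.
rewrite -(deriveE v df) {1}['D_v f x]matrix_sum_delta linear_sum.
rewrite mxtrace_mulC; apply: eq_bigr => i _.
rewrite linear_sum mxE; apply: eq_bigr => j _.
by rewrite linearZ /= -(deriveE _ dD) derive_det_delta [\adj _ _ _]mxE.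
Qed.

End Jacobi.

(* Keeps unification from unfolding derivatives into limits. *)
Local Opaque derive.

(** * Symmetry of second derivatives *)

Section Schwarz.
Variables (R : realType) (V : normedModType R).

Lemma differentiable_affine (a v : V) (t : R) :
  differentiable (fun t : R => a + t *: v) t.
Proof.
apply: differentiableD; first exact: differentiable_cst.
by have [] := diff_linear_comp (linear_scale_delta v)
  (@scalel_continuous _ _ _) (ex_diff (is_diff_def := is_diff_id t)).
Qed.

Lemma derive_affine (a v : V) (t : R) :
  'D_1 (fun t : R => a + t *: v) t = v.
Proof.
have [dl El] := diff_linear_comp (linear_scale_delta v)
  (@scalel_continuous _ _ _) (ex_diff (is_diff_def := is_diff_id t)).
rewrite [LHS]deriveD; [|exact: derivable_cst|exact: diff_derivable].
by rewrite derive_cst add0r El derive_id scale1r.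
Qed.

Lemma line_MVT (F : V -> R) (x v : V) (s : R) : 0 < s ->
  (forall t, 0 <= t <= s -> differentiable F (x + t *: v)) ->
  exists2 t, 0 <= t <= s & F (x + s *: v) - F x = s * 'D_v F (x + t *: v).
Proof.
move=> s0 dF.
have dh t : 0 <= t <= s -> differentiable (fun t : R => F (x + t *: v)) t.
  move=> ts; apply: (@differentiable_comp _ _ _ _ (fun t : R => x + t *: v) F).
    exact: differentiable_affine.
  exact: dF.
have hE t : t \in `]0, s[ ->
    is_derive t 1 (fun t : R => F (x + t *: v)) ('D_v F (x + t *: v)).
  rewrite in_itv /= => /andP[t0 ts]; have ts' : 0 <= t <= s by rewrite !ltW.
  split; first by apply: diff_derivable; exact: dh.
  rewrite (@derive_comp _ _ _ _ (fun t : R => x + t *: v) F) ?derive_affine//.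
  exact: dF.
have ch : {within `[0, s], continuous (fun t : R => F (x + t *: v))}.
  apply: continuous_in_subspaceT => t; rewrite inE /= in_itv /= => ts.
  by apply: differentiable_continuous; exact: dh.
have [t ts] := MVT s0 hE ch; rewrite scale0r addr0 subr0 mulrC => E.
by exists t => //; move: ts; rewrite in_itv /= => /andP[? ?]; rewrite !ltW.
Qed.

(** The second difference of [f] over the parallelogram with sides [s v] and
    [s w] is [s ^ 2] times a value of [G] inside it. *)
Definition second_difference_at (U : set V) (f G : V -> R) (u v w : V) :=
  forall s : R, 0 < s ->
  (forall a b, 0 <= a <= s -> 0 <= b <= s -> U (u + a *: v + b *: w)) ->
  exists a b, [/\ 0 <= a <= s, 0 <= b <= s &
    f (u + s *: v + s *: w) - f (u + s *: v) - (f (u + s *: w) - f u)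
      = s * (s * G (u + a *: v + b *: w))].

(** Two applications of the mean value theorem, along [v] to the difference of
    [f] in direction [w], then along [w] to ['D_v f]. The left-hand side is
    symmetric in [v] and [w], which is the whole point. *)
Lemma second_difference (U : set V) (f : V -> R) (u v w : V) : open U ->
  smooth_on U f -> second_difference_at U f ('D_w ('D_v f)) u v w.
Proof.
move=> oU sf s s0 inU.
have ss : 0 <= s <= s by rewrite lexx ltW.
have s00 : 0 <= (0 : R) <= s by rewrite lexx ltW.
pose F y := f (y + s *: w) - f y.
have dsh (y z : V) : differentiable (fun y => y + z) y.
  apply: (@differentiableD _ _ _ id (cst z)); first exact: ex_diff.
  exact: differentiable_cst.
have dfsh y : U (y + s *: w) -> differentiable (fun y => f (y + s *: w)) y.
  move=> Uy; apply: (@differentiable_comp _ _ _ _ (fun y => y + s *: w) f) => //.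
  exact: smooth_diff sf Uy.
have Uv a : 0 <= a <= s -> U (u + a *: v).
  by move=> sa; rewrite -[X in U X]addr0 -(scale0r w); exact: inU.
have [a sa Ea] : exists2 a, 0 <= a <= s &
    F (u + s *: v) - F u = s * 'D_v F (u + a *: v).
  apply: (@line_MVT F) => // t st; apply: differentiableB; first exact/dfsh/inU.
  exact: smooth_diff sf (Uv _ st).
have [b sb Eb] : exists2 b, 0 <= b <= s &
    'D_v f (u + a *: v + s *: w) - 'D_v f (u + a *: v)
     = s * 'D_w ('D_v f) (u + a *: v + b *: w).
  apply: (@line_MVT ('D_v f) (u + a *: v)) => // t st.
  exact: smooth_diff (smooth_derive v sf) (inU _ _ sa st).
exists a, b; split=> //; rewrite -[LHS]/(F (u + s *: v) - F u) Ea.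
congr (_ * _); rewrite -Eb [LHS]deriveB; last first.
- by apply: diff_derivable; exact: smooth_diff sf (Uv _ sa).
- by apply: diff_derivable; exact/dfsh/inU.
congr (_ - _); rewrite (@derive_comp _ _ _ _ (fun y => y + s *: w) f) //.
  rewrite (_ : 'D_v _ _ = v)//.
  rewrite [LHS]deriveD; [|exact: derivable_id|exact: derivable_cst].
  by rewrite derive_id derive_cst addr0.
exact: smooth_diff sf (inU _ _ sa ss).
Qed.

(** Both derivatives are squeezed on the same second difference as the
    parallelogram shrinks to [u]. *)
Lemma second_difference_limit (U : set V) (f FA FB : V -> R) (u v w : V) :
  open U -> U u -> {for u, continuous FA} -> {for u, continuous FB} ->
  second_difference_at U f FA u v w -> second_difference_at U f FB u w v ->
  FA u = FB u.
Proof.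
move=> oU Uu cA cB D2 D2'; apply/eqP; rewrite -subr_eq0; apply/negPn/negP => ne.
set A := FA u in ne *; set B := FB u in ne *.
pose e := `|A - B| / 2; have e0 : 0 < e by rewrite divr_gt0// normr_gt0.
have nA : \forall y \near u, `|A - FA y| < e by move/cvgrPdist_lt : cA; apply.
have nB : \forall y \near u, `|B - FB y| < e by move/cvgrPdist_lt : cB; apply.
have : \forall y \near u, [/\ U y, `|A - FA y| < e & `|B - FB y| < e].
  near=> y; split; near: y => //; exact: open_nbhs_nbhs.
move=> /nbhs_ballP[r /= r0 br].
have nvw : 0 < `|v| + `|w| + 1 by rewrite ltr_wpDl// addr_ge0.
(* Small enough for the whole parallelogram to lie in the ball of radius [r]. *)
pose s := r / (`|v| + `|w| + 1) / 2.
have s0 : 0 < s by rewrite !divr_gt0.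
have inb a b : 0 <= a <= s -> 0 <= b <= s -> ball u r (u + a *: v + b *: w).
  move=> /andP[a0 sa] /andP[b0 sb]; rewrite -ball_normE /=.
  rewrite -addrA opprD addNKr normrN (le_lt_trans (ler_normD _ _))//.
  rewrite !normrZ !ger0_norm//.
  apply: (@le_lt_trans _ _ (s * (`|v| + `|w| + 1))).
    rewrite !mulrDr mulr1; apply: ler_wpDr; first exact: ltW.
    by apply: lerD; apply: ler_wpM2r.
  rewrite /s mulrAC divfK ?gt_eqF// ltr_pdivrMr// ltr_pMr//.
  by rewrite ltr1n.
have [a [b [sa sb E1]]] := D2 s s0
  (fun a b sa sb => let: And3 Uy _ _ := br _ (inb a b sa sb) in Uy).
have inU' y x : 0 <= y <= s -> 0 <= x <= s -> U (u + y *: w + x *: v).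
  by move=> sb' sa'; rewrite addrAC; case: (br _ (inb x y sa' sb')).
have [b' [a' [sb' sa' E2]]] := D2' s s0 inU'.
have : FA (u + a *: v + b *: w) = FB (u + b' *: w + a' *: v).
  apply: (mulfI (lt0r_neq0 s0)); apply: (mulfI (lt0r_neq0 s0)).
  by rewrite -E1 -E2 [u + s *: w + s *: v]addrAC; ring.
have [_ + _] := br _ (inb a b sa sb); have [_ _] := br _ (inb a' b' sa' sb').
rewrite [u + b' *: w + _]addrAC => l1 l2 E; rewrite E in l2.
have : `|A - B| < e + e.
  set C := FB _ in l1 l2.
  rewrite -(subrKA C) (le_lt_trans (ler_normD _ _))// ltrD//.
  by rewrite distrC.
by rewrite /e -splitr ltxx.
Unshelve. all: by end_near. Qed.

Lemma Schwarz_real (U : set V) (f : V -> R) (u v w : V) : open U ->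
  smooth_on U f -> U u -> 'D_w ('D_v f) u = 'D_v ('D_w f) u.
Proof.
move=> oU sf Uu.
apply: (@second_difference_limit U f ('D_w ('D_v f)) ('D_v ('D_w f)) u v w) => //.
- exact: smooth_continuous (smooth_derive w (smooth_derive v sf)) Uu.
- exact: smooth_continuous (smooth_derive v (smooth_derive w sf)) Uu.
- exact: second_difference oU sf.
- exact: second_difference oU sf.
Qed.

Lemma Schwarz_mx m n (U : set V) (f : V -> 'M[R]_(m, n)) (u v w : V) : open U ->
  smooth_on U f -> U u -> 'D_w ('D_v f) u = 'D_v ('D_w f) u.
Proof.
move=> oU sf Uu; apply/matrixP => i j.
have dD v' : differentiable ('D_v' f) u.
  exact: smooth_diff (smooth_derive v' sf) Uu.
have E v' y : U y -> 'D_v' f y i j = 'D_v' (fun y => f y i j) y.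
  by move=> Uy; exact: derive_entry (smooth_diff sf Uy).
refine (etrans (derive_entry w i j (dD v)) _).
refine (etrans _ (esym (derive_entry v i j (dD w)))).
refine (etrans (open_eq_derive oU w (E v) Uu) _).
refine (etrans _ (esym (open_eq_derive oU v (E w) Uu))).
apply: (@Schwarz_real U (fun y => f y i j)) => //; exact: smooth_entry.
Qed.

End Schwarz.

(** * The spectral theorem for real symmetric matrices *)

Section RealSpectral.
Variable R : realType.

(** Over the complex numbers the matrix is Hermitian, so some eigenvalue is a
    real root of the characteristic polynomial, which has real coefficients. *)
Lemma sym_eigenvector n (A : 'M[R]_n.+1) : A^T = A ->
  exists (l : R) (v : 'rV_n.+1), v != 0 /\ v *m A = l *: v.
Proof.
move=> As; pose f := real_complex R.
pose AC : 'M[R[i]]_n.+1 := map_mx f A.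
have ACh : AC \is hermsymmx.
  apply: realsym_hermsym.
    by apply/is_hermitianmxP; rewrite expr0 scale1r map_mx_id// /AC map_trmx As.
  by apply/mxOverP => i j; rewrite mxE complex_real.
have /orthomx_spectralP E := hermitian_normalmx ACh.
have /mxOverP/(_ 0 0) := hermitian_spectral_diag_real ACh.
set P := spectralmx AC in E; set sp := spectral_diag AC in E *.
have Pu : P \in unitmx by exact: spectral_unit.
move=> /complex_realP[l spl].
have : eigenvalue AC (f l).
  apply/eigenvalueP; exists (row 0 P); last first.
    apply: contraTneq Pu => P0; rewrite -row_free_unit -kermx_eq0.
    apply/rowV0Pn; exists (delta_mx 0 0); last first.
      by apply/eqP => /matrixP/(_ 0 0); rewrite !mxE !eqxx => /eqP; rewrite oner_eq0.
    by apply/sub_kermxP; rewrite -rowE.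
  rewrite {1}E -row_mul !mulmxA mulmxV// mul1mx mul_diag_mx.
  by apply/rowP => j; rewrite !mxE spl.
rewrite eigenvalue_root_char -map_char_poly.
rewrite fmorph_root -eigenvalue_root_char => /eigenvalueP[v vA v0].
by exists l, v.
Qed.

(** The Householder reflection exchanging [v] and the first basis vector. *)
Lemma orthogonal_to_delta n (v : 'rV[R]_n.+1) : (v *m v^T) 0 0 = 1 ->
  exists2 H : 'M[R]_n.+1, H *m H^T = 1%:M & v *m H^T = delta_mx 0 0.
Proof.
move=> v1; pose e : 'rV[R]_n.+1 := delta_mx 0 0.
have mx11 (a : 'M[R]_1) : a = (a 0 0)%:M by rewrite -mx11_scalar.
have vv : v *m v^T = 1%:M by rewrite [LHS]mx11 v1.
have ee : e *m e^T = 1%:M by rewrite trmx_delta mul_delta_mx; apply/matrixP => i j; rewrite !mxE !ord1.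
pose b := (v *m e^T) 0 0; have ve : v *m e^T = b%:M by rewrite [LHS]mx11.
have ev : e *m v^T = b%:M by rewrite -[LHS]trmxK trmx_mul trmxK ve tr_scalar_mx.
pose w := v - e.
have [/eqP|w0] := eqVneq w 0.
  rewrite subr_eq0 => /eqP ->; exists 1%:M; first by rewrite trmx1 mulmx1.
  by rewrite trmx1 mulmx1.
have ww : w *m w^T = (2 * (1 - b))%:M.
  rewrite linearB /= mulmxBl !mulmxBr vv ee ve ev -!raddfB /=.
  by congr (_%:M); ring.
have vw : v *m w^T = (1 - b)%:M by rewrite linearB /= mulmxBr vv ve -raddfB.
have b1 : 1 - b != 0.
  apply: contraNneq w0 => b1; apply/eqP/rowP => j; rewrite [RHS]mxE.
  have : (w *m w^T) 0 0 = 0 by rewrite ww b1 mulr0 mxE mul0rn.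
  have ge0 k : true -> 0 <= w 0 k * w^T k 0.
    by move=> _; rewrite [X in _ * X]mxE -expr2 sqr_ge0.
  rewrite mxE => /(psumr_eq0P ge0)/(_ j isT)/eqP.
  by rewrite [X in _ * X]mxE mulf_eq0 orbb => /eqP.
pose H := 1%:M - (1 - b)^-1 *: (w^T *m w).
have HT : H^T = H.
  by rewrite /H linearB /= trmx1 linearZ /= trmx_mul trmxK.
exists H; rewrite HT; last first.
  rewrite /H mulmxBr mulmx1 -scalemxAr mulmxA vw mul_scalar_mx scalerA mulVf//.
  by rewrite scale1r opprB subrKC.
rewrite /H mulmxBr mulmx1 mulmxBl mul1mx -scalemxAr -scalemxAl scalerA.
rewrite -mulmxA [w *m (_ *m _)]mulmxA ww mul_scalar_mx -scalemxAr scalerA.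
rewrite (_ : _ * _ = 2 * (1 - b)^-1); last by field.
by rewrite -scalerA scaler_nat mulr2n opprB addrK subrK.
Qed.

(** An orthogonal matrix taking a unit eigenvector to the first basis vector
    splits off a block of size one; the complementary block is again symmetric. *)
Theorem real_spectral n (A : 'M[R]_n) : A^T = A ->
  exists (P : 'M[R]_n) d, P *m P^T = 1%:M /\ A = P^T *m diag_mx d *m P.
Proof.
elim: n A => [|n IH] A As.
  by exists 1%:M, 0; split; apply/matrixP => -[].
have [l [v [v0 vA]]] := sym_eigenvector As.
have vv : 0 < (v *m v^T) 0 0.
  have [j vj] : exists j, v 0 j != 0 by apply/rV0Pn.
  rewrite mxE (bigD1 j)//= mxE -expr2 ltr_pwDl ?exprn_even_gt0//.
  by apply: sumr_ge0 => i _; rewrite mxE -expr2 sqr_ge0.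
pose c := (Num.sqrt ((v *m v^T) 0 0))^-1.
have [H HH vH] : exists2 H : 'M[R]_n.+1, H *m H^T = 1%:M & (c *: v) *m H^T = delta_mx 0 0.
  apply: orthogonal_to_delta.
  rewrite linearZ /= -scalemxAr -scalemxAl scalerA [LHS]mxE.
  by rewrite -expr2 exprVn sqr_sqrtr ?ltW// mulVf// gt_eqF.
have HH' : H^T *m H = 1%:M by apply: mulmx1C.
have eH : delta_mx 0 0 *m H = c *: v :> 'rV_n.+1 by rewrite -vH -mulmxA HH' mulmx1.
pose B := H *m A *m H^T.
have Bs : B^T = B by rewrite /B !trmx_mul trmxK As mulmxA.
have B0 : row 0 B = l *: delta_mx 0 0.
  rewrite rowE /B !mulmxA eH -scalemxAl vA -vH -!scalemxAl.
  by rewrite scalerA mulrC -scalerA.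
have AB : A = H^T *m B *m H.
  by rewrite /B !mulmxA HH' mul1mx -mulmxA HH' mulmx1.
pose B' : 'M[R]_n := @drsubmx R 1 n 1 n B.
have [P' [d [PP' EB']]] : exists (P : 'M[R]_n) d,
    P *m P^T = 1%:M /\ B' = P^T *m diag_mx d *m P.
  by apply: IH; rewrite /B' trmx_drsub Bs.
have B0j j : B 0 j = l *+ (j == 0).
  have /rowP/(_ j) := B0; rewrite [LHS]mxE => ->.
  by rewrite !mxE eqxx mulr_natr.
have lsh0 : lshift n 0 = 0 :> 'I_(1 + n) by apply/val_inj.
have BE : B = block_mx (l%:M : 'M[R]_1) 0 0 B'.
  have Br : @ursubmx R 1 n 1 n B = 0.
    apply/matrixP => i j; rewrite !ord1 [LHS]mxE [LHS]mxE [RHS]mxE.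
    by rewrite lsh0 B0j.
  have Bu : @ulsubmx R 1 n 1 n B = l%:M.
    apply/matrixP => i j; rewrite !ord1 [LHS]mxE [LHS]mxE [RHS]mxE.
    by rewrite lsh0 B0j.
  have Bl : @dlsubmx R 1 n 1 n B = 0.
    by rewrite -[LHS]trmxK trmx_dlsub Bs Br trmx0.
  by rewrite -[LHS](@submxK R 1 n 1 n) Bu Br Bl.
pose P : 'M[R]_(1 + n) := block_mx (1%:M : 'M[R]_1) 0 0 P'.
pose D : 'rV[R]_(1 + n) := row_mx (l%:M : 'M[R]_1) d.
have PP : P *m P^T = 1%:M.
  rewrite /P tr_block_mx mulmx_block.
  by rewrite !trmx0 trmx1 !mul0mx !mulmx0 mulmx1 !addr0 !add0r PP' -scalar_mx_block.
have PDP : P^T *m diag_mx D *m P = block_mx (l%:M : 'M[R]_1) 0 0 B'.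
  rewrite /P /D tr_block_mx !trmx0 trmx1 diag_mx_row !mulmx_block.
  rewrite !mul0mx !mulmx0 !mul1mx !mulmx1 !addr0 !add0r -EB'.
  rewrite (_ : diag_mx (l%:M : 'M[R]_1) = l%:M) ?mul0mx//.
  by apply/matrixP => i j; rewrite !ord1 !mxE.
exists (P *m H), D; split.
  by rewrite trmx_mul -mulmxA [H *m (_ *m _)]mulmxA HH mul1mx.
by rewrite trmx_mul AB BE -PDP -!mulmxA.
Qed.

End RealSpectral.

(** * Positive definite matrices and the trace metric *)

Section PosdefAlgebra.
Variables (R : realType) (n : nat).
Implicit Types (A B Q M V W : 'M[R]_n).

Lemma mxtrace_sqr_ge0 m p (a : 'M[R]_(m, p)) : 0 <= \tr (a *m a^T).
Proof.
apply: sumr_ge0 => i _; rewrite mxE; apply: sumr_ge0 => j _.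
by rewrite mxE -expr2 sqr_ge0.
Qed.

Lemma mxtrace_sqr_eq0 m p (a : 'M[R]_(m, p)) : \tr (a *m a^T) = 0 -> a = 0.
Proof.
have ge0 i j : 0 <= a i j * a^T j i by rewrite mxE -expr2 sqr_ge0.
have ge0' i : true -> 0 <= (a *m a^T) i i.
  by move=> _; rewrite mxE; apply: sumr_ge0 => j _; exact: ge0.
move=> E; apply/matrixP => i j; rewrite [RHS]mxE.
have := psumr_eq0P ge0' E (i := i) isT; rewrite mxE.
move=> /(psumr_eq0P (fun j _ => ge0 i j))/(_ j isT)/eqP.
by rewrite mxE mulf_eq0 orbb => /eqP.
Qed.

Lemma posdef_sym A : posdef A -> A^T = A. Proof. by case. Qed.

Lemma posdef_unit A : posdef A -> A \in unitmx.
Proof.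
move=> [_ pA]; rewrite -row_free_unit -kermx_eq0; apply/rowV0P => v.
move=> /sub_kermxP vA; apply/eqP/negPn/negP => /pA.
by rewrite vA mul0mx mxE ltxx.
Qed.

Lemma posdef_conj A M : M \in unitmx -> posdef A -> posdef (M *m A *m M^T).
Proof.
move=> Mu [As pA]; split; first by rewrite !trmx_mul trmxK As mulmxA.
move=> x x0; have := pA (x *m M); rewrite trmx_mul !mulmxA; apply.
by apply: contraNneq x0 => /(canRL (mulmxK Mu)) ->; rewrite mul0mx.
Qed.

Lemma posdef_diag (d : 'rV[R]_n) : (forall i, 0 < d 0 i) -> posdef (diag_mx d).
Proof.
move=> d0; split; first by rewrite tr_diag_mx.
move=> x /rV0Pn[j xj]; rewrite mxE.
rewrite (eq_bigr (fun i => d 0 i * x 0 i ^+ 2)) => [|i _]; last first.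
  by rewrite mul_mx_diag !mxE; ring.
rewrite (bigD1 j)//=; apply: ltr_pwDl.
  by rewrite mulr_gt0// exprn_even_gt0.
by apply: sumr_ge0 => i _; rewrite mulr_ge0 ?sqr_ge0// ltW.
Qed.

Lemma posdef1 : posdef (1%:M : 'M[R]_n).
Proof.
rewrite -diag_const_mx; apply: posdef_diag => i.
by rewrite mxE ltr01.
Qed.

Lemma posdef_scale c A : 0 < c -> posdef A -> posdef (c *: A).
Proof.
move=> c0 [As pA]; split; first by rewrite linearZ /= As.
by move=> x /pA xA; rewrite -scalemxAr -scalemxAl [ltRHS]mxE mulr_gt0.
Qed.

Lemma posdef_convex t A B : 0 <= t <= 1 -> posdef A -> posdef B ->
  posdef ((1 - t) *: A + t *: B).
Proof.
move=> /andP[t0 t1] [As pA] [Bs pB].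
split; first by rewrite linearD !linearZ /= As Bs.
move=> x x0; rewrite mulmxDr mulmxDl -!scalemxAr -!scalemxAl.
rewrite mxE [X in X + _]mxE [X in _ + X]mxE.
have [->|tN0] := eqVneq t 0; first by rewrite mul0r addr0 subr0 mul1r pA.
rewrite ltr_wpDl//; first by rewrite mulr_ge0 ?subr_ge0// ltW// pA.
by rewrite mulr_gt0 ?pB// lt_def tN0.
Qed.

Lemma posdef_entry_gt0 A i : posdef A -> 0 < A i i.
Proof.
move=> [_ /(_ (delta_mx 0 i))]; rewrite -rowE trmx_delta -colE !mxE; apply.
by apply/eqP => /rowP/(_ i); rewrite !mxE !eqxx => /eqP; rewrite oner_eq0.
Qed.

(** Scale the orthonormal eigenvectors by the square roots of the eigenvalues. *)
Lemma posdef_sqrt A : posdef A -> exists2 M, M \in unitmx & A = M *m M^T.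
Proof.
move=> pA; have [P [d [PP E]]] := real_spectral (posdef_sym pA).
have Pu : P \in unitmx by apply: (mulmx1_unit PP).1.
have d0 i : 0 < d 0 i.
  have := posdef_entry_gt0 i (posdef_conj Pu pA).
  rewrite E !mulmxA PP mul1mx -mulmxA PP mulmx1 mxE eqxx; exact.
pose r := \row_i Num.sqrt (d 0 i).
exists (P^T *m diag_mx r).
  rewrite unitmx_mul unitmx_tr Pu /= unitmxE det_diag unitfE.
  by rewrite prodf_seq_neq0; apply/allP => i _ /=; rewrite mxE gt_eqF// sqrtr_gt0.
rewrite trmx_mul trmxK tr_diag_mx E -!mulmxA; congr (_ *m _); rewrite !mulmxA.
congr (_ *m _); rewrite mulmx_diag; congr diag_mx; apply/rowP => i.
by rewrite !mxE -expr2 sqr_sqrtr// ltW.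
Qed.

(** Diagonalize [V] orthogonally in a frame which is orthonormal for [Q]. *)
Lemma posdef_simul_diag Q V : posdef Q -> V^T = V ->
  exists M d, [/\ M \in unitmx, Q = M *m M^T & V = M *m diag_mx d *m M^T].
Proof.
move=> pQ Vs; have [N Nu ->] := posdef_sqrt pQ.
have : (invmx N *m V *m (invmx N)^T)^T = invmx N *m V *m (invmx N)^T.
  by rewrite !trmx_mul trmxK Vs mulmxA.
move=> /real_spectral[P [d [PP E]]].
have PP' := mulmx1C PP.
exists (N *m P^T), d; split.
- by rewrite unitmx_mul Nu unitmx_tr; case: (mulmx1_unit PP).
- by rewrite trmx_mul trmxK mulmxA -[N *m _ *m _]mulmxA PP' mulmx1.
have -> : V = N *m (invmx N *m V *m (invmx N)^T) *m N^T.
  rewrite !mulmxA mulmxV// mul1mx -mulmxA -trmx_mul mulmxV//.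
  by rewrite trmx1 mulmx1.
by rewrite E trmx_mul trmxK !mulmxA.
Qed.

Lemma posdef_det_gt0 A : posdef A -> 0 < \det A.
Proof.
move=> /posdef_sqrt[M Mu ->]; rewrite det_mulmx det_tr -expr2.
by rewrite exprn_even_gt0//= -unitfE -unitmxE.
Qed.

Lemma posdef_inv A : posdef A -> posdef (invmx A).
Proof.
move=> pA; have Au := posdef_unit pA.
have : posdef (invmx A *m A *m (invmx A)^T).
  by apply: posdef_conj => //; rewrite unitmx_inv.
by rewrite mulVmx// mul1mx trmx_inv posdef_sym.
Qed.

Lemma invmx_mul M N : M \in unitmx -> N \in unitmx ->
  invmx (M *m N) = invmx N *m invmx M.
Proof.
move=> Mu Nu; have MNu : M *m N \in unitmx by rewrite unitmx_mul Mu.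
have E : (M *m N) *m (invmx N *m invmx M) = 1%:M.
  by rewrite mulmxA mulmxK// mulmxV.
by rewrite -[RHS](mulKmx MNu) E mulmx1.
Qed.

Lemma trace_metricC A V W : trace_metric A V W = trace_metric A W V.
Proof. by rewrite /trace_metric -mulmxA mxtrace_mulC mulmxA. Qed.

Lemma trace_metric_linear A a V V' W :
  trace_metric A (a *: V + V') W = a * trace_metric A V W + trace_metric A V' W.
Proof.
by rewrite /trace_metric mulmxDr !mulmxDl -scalemxAr -!scalemxAl linearD linearZ.
Qed.

Lemma trace_metric_conj A M V W : M \in unitmx -> A \in unitmx ->
  trace_metric (M *m A *m M^T) (M *m V *m M^T) (M *m W *m M^T)
  = trace_metric A V W.
Proof.
move=> Mu Au; have Mtu : M^T \in unitmx by rewrite unitmx_tr.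
rewrite /trace_metric invmx_mul// ?unitmx_mul ?Mu// invmx_mul//.
rewrite !mulmxA mxtrace_mulC !mulmxA mulmxV// mul1mx.
by rewrite mulmxKV// -[_ *m M^T *m _]mulmxA mulmxV// mulmx1 mulmxKV.
Qed.

Lemma trace_metric_sqr M V W : M \in unitmx ->
  trace_metric (M *m M^T) (M *m V *m M^T) (M *m W *m M^T) = \tr (V *m W).
Proof.
move=> Mu; have := trace_metric_conj V W Mu (unitmx1 R n); rewrite mulmx1 => ->.
by rewrite /trace_metric invmx1 mul1mx mulmx1.
Qed.

(** Every symmetric matrix is congruent, by a square root of [A], to a symmetric
    matrix; this turns the metric at [A] into the Frobenius inner product. *)
Lemma sym_congr_factor M V : M \in unitmx -> V^T = V ->
  exists2 a : 'M[R]_n, a^T = a & V = M *m a *m M^T.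
Proof.
move=> Mu Vs; exists (invmx M *m V *m (invmx M)^T).
  by rewrite !trmx_mul trmxK Vs mulmxA.
rewrite !mulmxA mulmxV// mul1mx -mulmxA -trmx_mul mulmxV//.
by rewrite trmx1 mulmx1.
Qed.

Lemma trace_metric_ge0 A V : posdef A -> V^T = V -> 0 <= trace_metric A V V.
Proof.
move=> /posdef_sqrt[M Mu ->] /(sym_congr_factor Mu)[a As ->].
by rewrite trace_metric_sqr// -{2}As mxtrace_sqr_ge0.
Qed.

Lemma trace_metric_eq0 A V : posdef A -> V^T = V ->
  trace_metric A V V = 0 -> V = 0.
Proof.
move=> /posdef_sqrt[M Mu ->] /(sym_congr_factor Mu)[a As ->].
by rewrite trace_metric_sqr// -{2}As => /mxtrace_sqr_eq0 ->; rewrite mulmx0 mul0mx.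
Qed.

Lemma trace_metric_gt0 A V : posdef A -> V^T = V -> V != 0 ->
  0 < trace_metric A V V.
Proof.
move=> pA Vs V0; rewrite lt_def trace_metric_ge0// andbT.
by apply: contraNneq V0 => /(trace_metric_eq0 pA Vs) ->.
Qed.

(** Each term x_i E_ij x_j is at most (x_i^2 + x_j^2) / (2 (n + 1)) in absolute
    value, so the perturbation costs at most the fraction n / (n + 1) of the
    squared norm of x. *)
Lemma posdef_near1 (E : 'M[R]_n) : E^T = E ->
  (forall i j, `|E i j| <= n.+1%:R^-1) -> posdef (1%:M + E).
Proof.
move=> Es Eb; split; first by rewrite linearD /= trmx1 Es.
move=> x /rV0Pn[k xk]; pose N := \sum_i x 0 i ^+ 2.
have N0 : 0 < N.
  rewrite /N (bigD1 k)//=; apply: ltr_pwDl; first by rewrite exprn_even_gt0.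
  by apply: sumr_ge0 => i _; exact: sqr_ge0.
have xx : (x *m x^T) 0 0 = N.
  by rewrite mxE; apply: eq_bigr => i _; rewrite mxE expr2.
have bound : - (n%:R * n.+1%:R^-1 * N) <= (x *m E *m x^T) 0 0.
  rewrite lerNl.
  have -> : n%:R * n.+1%:R^-1 * N =
      \sum_j \sum_i (n.+1%:R^-1 * ((x 0 i ^+ 2 + x 0 j ^+ 2) / 2)).
    under eq_bigr do rewrite -mulr_sumr -mulr_suml big_split /= sumr_const card_ord.
    rewrite -mulr_sumr -mulr_suml big_split /= sumr_const card_ord -/N.
    under [in RHS]eq_bigr do rewrite -mulr_natl.
    by rewrite -mulr_sumr -/N -mulr_natl; field; rewrite gt_eqF ?ltr0n.
  rewrite mxE -sumrN; apply: ler_sum => j _.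
  rewrite mxE [X in _ * X]mxE mulr_suml -sumrN; apply: ler_sum => i _.
  apply: le_trans (ler_norm _) _; rewrite normrN !normrM.
  rewrite (_ : _ * _ * _ = `|E i j| * (`|x 0 j| * `|x 0 i|)); last by ring.
  apply: (@le_trans _ _ (n.+1%:R^-1 * (`|x 0 j| * `|x 0 i|))).
    by apply: ler_wpM2r; rewrite ?mulr_ge0.
  rewrite ler_wpM2l// ler_pdivlMr ?ltr0n//.
  have := sqr_ge0 (`|x 0 j| - `|x 0 i|); rewrite sqrrB !real_normK ?num_real//.
  rewrite -mulr_natr; lra.
rewrite mulmxDr mulmx1 mulmxDl mxE xx.
apply: lt_le_trans (_ : N - n%:R * n.+1%:R^-1 * N <= _); last by rewrite lerD2l.
rewrite -{1}[N]mul1r -mulrBl mulr_gt0// subr_gt0.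
by rewrite ltr_pdivrMr ?ltr0n// mul1r ltr_nat.
Qed.

(** Positive definiteness is an open condition on symmetric matrices; a
    congruence reduces it to a neighborhood of the identity. *)
Lemma posdef_near (E : normedModType R) (f : E -> 'M[R]_n) (u : E) :
  smooth_on setT f -> (forall x, (f x)^T = f x) -> posdef (f u) ->
  \near u, posdef (f u).
Proof.
move=> sf fs /posdef_sqrt[M Mu fu].
pose g x := invmx M *m f x *m (invmx M)^T.
have gE x : f x = M *m g x *m M^T.
  rewrite /g !mulmxA mulmxV// mul1mx -mulmxA -trmx_mul mulmxV//.
  by rewrite trmx1 mulmx1.
have gu : g u = 1%:M.
  by rewrite /g fu mulmxA mulVmx// mul1mx -trmx_mul mulVmx// trmx1.
have sg : smooth_on setT g.
  have oT := @openT E.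
  do 2?[apply: (smooth_mulmx oT)] => //; exact: smooth_cst.
have cg i j : \forall x \near u, `|g u i j - g x i j| < n.+1%:R^-1.
  have : {for u, continuous (fun x => g x i j)}.
    by apply: (smooth_continuous (smooth_entry openT i j sg)).
  by move/cvgrPdist_lt; apply; rewrite invr_gt0 ltr0n.
near=> x; rewrite gE; apply: posdef_conj => //.
rewrite -[g x](subrKC 1%:M); apply: posdef_near1.
  by rewrite linearB /= trmx1 /g !trmx_mul trmxK fs mulmxA.
move=> i j; rewrite ltW// -gu [X in `|X|]mxE [X in `|_ + X|]mxE distrC.
move: i j; near: x; apply: filter_forall => i; apply: filter_forall => j.
exact: cg.
Unshelve. all: by end_near. Qed.

End PosdefAlgebra.

(** * The Levi-Civita connection of the trace metric *)

Section MatrixEntries.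
Variables (R : realType) (m n : nat).
Implicit Types A B : 'M[R]_(m, n).
Lemma addmxE A B i j : (A + B) i j = A i j + B i j. Proof. by rewrite mxE. Qed.
Lemma oppmxE A i j : (- A) i j = - A i j. Proof. by rewrite mxE. Qed.
Lemma scalemxE a A i j : (a *: A) i j = a * A i j. Proof. by rewrite mxE. Qed.
End MatrixEntries.

Section TrmxLinear.
Variables (R : realType) (m n : nat).
Implicit Types A B : 'M[R]_(m, n).
Lemma trmxD A B : (A + B)^T = A^T + B^T. Proof. exact: linearD. Qed.
Lemma trmxB A B : (A - B)^T = A^T - B^T. Proof. exact: linearB. Qed.
Lemma trmxZ a A : (a *: A)^T = a *: A^T. Proof. exact: linearZ. Qed.
End TrmxLinear.

Lemma mxtraceN (R : realType) n (A : 'M[R]_n) : \tr (- A) = - \tr A.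
Proof. exact: raddfN. Qed.

Lemma derive_mulmx3 (R : realType) (V : normedModType R) m n p q
    (f : V -> 'M[R]_(m, n)) (g : V -> 'M[R]_(n, p)) (h : V -> 'M[R]_(p, q)) x v :
  differentiable f x -> differentiable g x -> differentiable h x ->
  'D_v (fun y => f y *m g y *m h y) x =
    'D_v f x *m g x *m h x + f x *m 'D_v g x *m h x + f x *m g x *m 'D_v h x.
Proof.
move=> df dg dh; refine (etrans (derive_mulmx v (differentiable_mulmx df dg) dh) _).
by rewrite (derive_mulmx v df dg) mulmxDl.
Qed.

Lemma derive_sum_basis (R : realType) (W : normedModType R) d
    (f : 'rV[R]_d -> W) u x : differentiable f u ->
  'D_x f u = \sum_k x 0 k *: 'D_(basis_vec R k) f u.
Proof.
move=> df; rewrite (deriveE x df) {1}[x]row_sum_delta linear_sum.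
by apply: eq_bigr => k _; rewrite linearZ /= -(deriveE _ df).
Qed.

(** The algebra behind the curvature computation, for independent matrices: s is
    the inverse of the base point, tx and ty are tangent vectors, z is a field
    with derivatives zx, zy, zxy, and pxy is the mixed derivative of the base
    point. Everything that involves a derivative cancels. *)
Lemma cov_identity (R : realType) n (tx ty s z zx zy zxy pxy : 'M[R]_n) :
  let cy := zy - 2^-1 *: (ty *m s *m z + z *m s *m ty) in
  let cx := zx - 2^-1 *: (tx *m s *m z + z *m s *m tx) in
  (zxy - 2^-1 *: (pxy *m s *m z - ty *m s *m tx *m s *m z
     + ty *m s *m zx + zx *m s *m ty
     - z *m s *m tx *m s *m ty + z *m s *m pxy)
   - 2^-1 *: (tx *m s *m cy + cy *m s *m tx)) -
  (zxy - 2^-1 *: (pxy *m s *m z - tx *m s *m ty *m s *m z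
     + tx *m s *m zy + zy *m s *m tx
     - z *m s *m ty *m s *m tx + z *m s *m pxy)
   - 2^-1 *: (ty *m s *m cx + cx *m s *m ty))
  = - 4^-1 *: (tx *m s *m ty *m s *m z - ty *m s *m tx *m s *m z
             - z *m s *m tx *m s *m ty + z *m s *m ty *m s *m tx).
Proof.
move=> cy cx; apply/matrixP => i j; rewrite /cx /cy.
rewrite !(mulmxBr, mulmxBl, mulmxDl, mulmxDr) -!(scalemxAl, scalemxAr).
rewrite !(mulmxDl, mulmxDr) !mulmxA !(addmxE, oppmxE, scalemxE).
by field.
Qed.

Section TraceConnection.
Variables (R : realType) (n d : nat).
Variables (U : set 'rV[R]_d) (phi : 'rV[R]_d -> 'M[R]_n).
Hypothesis oU : open U.
Hypothesis sphi : smooth_on U phi.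
Hypothesis pphi : forall u, U u -> posdef (phi u).
Implicit Types (Z W : 'rV[R]_d -> 'M[R]_n) (x y z w u : 'rV[R]_d).

Local Notation S u := (invmx (phi u)).
Local Notation T x u := ('D_x phi u).
Local Notation g u := (trace_metric (phi u)).

(** The Levi-Civita connection of the trace metric on positive definite
    matrices, for fields along [phi]: its Christoffel symbol at [A] is the
    bilinear map sending (V, W) to - (V A^-1 W + W A^-1 V) / 2. *)
Definition cov x Z u : 'M[R]_n :=
  'D_x Z u - 2^-1 *: (T x u *m S u *m Z u + Z u *m S u *m T x u).

(** The curvature tensor of that connection. *)
Definition trace_curvature (A V W Z : 'M[R]_n) : 'M[R]_n :=
  let K := invmx A in
  - 4^-1 *: (V *m K *m W *m K *m Z - W *m K *m V *m K *m Z
             - Z *m K *m V *m K *m W + Z *m K *m W *m K *m V).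

Lemma smooth_inv_phi : smooth_on U (fun u => S u).
Proof. by apply: smooth_invmx => // u /pphi; exact: posdef_unit. Qed.

Lemma derive_S x u : U u -> 'D_x (fun u => S u) u = - (S u *m T x u *m S u).
Proof.
by move=> Uu; apply: (derive_invmx x oU _ sphi Uu) => v /pphi; exact: posdef_unit.
Qed.

(** Second derivatives commute and the correction term is symmetric. *)
Lemma cov_torsion_free x y u : U u -> cov x ('D_y phi) u = cov y ('D_x phi) u.
Proof.
move=> Uu; refine (congr2 (fun A B => A - 2^-1 *: B) _ (addrC _ _)).
exact: (Schwarz_mx y x oU sphi Uu).
Qed.

(** The inverse [S] of [phi] has derivative - S T S. It occurs twice in
    tr (S Z S W), and these two contributions are shared evenly between the
    corrections of [Z] and of [W]. *)
Lemma cov_metric x Z W u : smooth_on U Z -> smooth_on U W -> U u ->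
  'D_x (fun u => g u (Z u) (W u)) u = g u (cov x Z u) (W u) + g u (Z u) (cov x W u).
Proof.
move=> sZ sW Uu.
have dZ := smooth_diff sZ Uu; have dW := smooth_diff sW Uu.
have dS := smooth_diff smooth_inv_phi Uu.
have dSZ := differentiable_mulmx dS dZ; have dSZS := differentiable_mulmx dSZ dS.
refine (etrans (derive_mxtrace x (differentiable_mulmx dSZS dW)) _).
rewrite (derive_mulmx x dSZS dW) (derive_mulmx3 x dS dZ dS) (derive_S x Uu).
rewrite /trace_metric /cov; move: (S u) (Z u) (W u) (T x u) ('D_x Z u) ('D_x W u).
move=> s z w t z' w'.
rewrite !(mulmxBr, mulmxBl, mulmxDl, mulmxDr, mulNmx, mulmxN) -!(scalemxAl, scalemxAr).
rewrite !(mulmxDl, mulmxDr) !mulmxA !(mxtraceD, mxtraceN, mxtraceZ).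
have -> : \tr (s *m z *m s *m w *m s *m t) = \tr (s *m t *m s *m z *m s *m w).
  by rewrite -mulmxA mxtrace_mulC !mulmxA.
by field.
Qed.

(** The mixed second derivatives are parameters, so that the two orders of
    differentiation can be written with the same matrices. *)
Lemma derive_cov x y Z u zxy pxy : smooth_on U Z -> U u ->
  'D_x ('D_y Z) u = zxy -> 'D_x ('D_y phi) u = pxy ->
  'D_x (cov y Z) u = zxy - 2^-1 *:
    (pxy *m S u *m Z u - T y u *m S u *m T x u *m S u *m Z u
     + T y u *m S u *m 'D_x Z u + 'D_x Z u *m S u *m T y u
     - Z u *m S u *m T x u *m S u *m T y u + Z u *m S u *m pxy).
Proof.
move=> sZ Uu <- <-; have sS := smooth_inv_phi; have sy := smooth_derive y sphi.
have dZ := smooth_diff sZ Uu; have dS := smooth_diff sS Uu.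
have dy := smooth_diff sy Uu.
have dyZ := smooth_diff (smooth_derive y sZ) Uu.
have d1 := differentiable_mulmx (differentiable_mulmx dy dS) dZ.
have d2 := differentiable_mulmx (differentiable_mulmx dZ dS) dy.
have d12 := differentiableD d1 d2.
have E1 := deriveB (diff_derivable (v := x) dyZ) (diff_derivable (v := x) (differentiableZ 2^-1 d12)).
refine (etrans E1 _); congr (_ - _).
refine (etrans (deriveZ 2^-1 (diff_derivable (v := x) d12)) _); congr (_ *: _).
refine (etrans (deriveD (diff_derivable (v := x) d1) (diff_derivable (v := x) d2)) _).
rewrite (derive_mulmx3 x dy dS dZ) (derive_mulmx3 x dZ dS dy) (derive_S x Uu).
move: ('D_x ('D_y phi) u) ('D_x Z u) (T x u) (T y u) (S u) (Z u) => *.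
by rewrite !(mulNmx, mulmxN) !mulmxA !addrA.
Qed.

Lemma cov_curvature x y Z u : smooth_on U Z -> U u ->
  cov x (cov y Z) u - cov y (cov x Z) u
  = trace_curvature (phi u) (T x u) (T y u) (Z u).
Proof.
move=> sZ Uu.
have E1 := derive_cov sZ Uu (erefl ('D_x ('D_y Z) u)) (erefl ('D_x ('D_y phi) u)).
have E2 := derive_cov sZ Uu (Schwarz_mx x y oU sZ Uu) (Schwarz_mx x y oU sphi Uu).
pose F (A B tx ty s a b : 'M[R]_n) :=
  (A - 2^-1 *: (tx *m s *m a + a *m s *m tx)) -
  (B - 2^-1 *: (ty *m s *m b + b *m s *m ty)).
refine (etrans (congr2 (fun A B => F A B (T x u) (T y u) (S u)
  (cov y Z u) (cov x Z u)) E1 E2) _).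
exact: cov_identity.
Qed.

End TraceConnection.

(** * Coordinate curvature of totally geodesic surfaces *)

Section LinearFacts.
Variables (R : realType) (V W : lmodType R) (f : V -> W).
Hypothesis lf : linear f.

Lemma linD x y : f (x + y) = f x + f y.
Proof. by have := lf 1 x y; rewrite !scale1r. Qed.

Lemma lin0 : f 0 = 0.
Proof. by have := lf (-1) 0 0; rewrite scaleN1r oppr0 addr0 scaleN1r addNr. Qed.

Lemma linZ a x : f (a *: x) = a *: f x.
Proof. by have := lf a x 0; rewrite !addr0 lin0 addr0. Qed.

Lemma lin_sum (I : Type) (r : seq I) (a : I -> R) (X : I -> V) :
  f (\sum_(i <- r) a i *: X i) = \sum_(i <- r) a i *: f (X i).
Proof.
elim: r => [|i r IH]; first by rewrite !big_nil lin0.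
by rewrite !big_cons lf IH.
Qed.

End LinearFacts.

Section TraceMultilinear.
Variables (R : realType) (n : nat).
Implicit Types A V W Z : 'M[R]_n.

Lemma trace_metric_linl A W : linear (fun V => trace_metric A V W : R^o).
Proof. by move=> a V V'; exact: trace_metric_linear. Qed.

Lemma trace_metric_linr A V : linear (fun W => trace_metric A V W : R^o).
Proof.
by move=> a W W'; rewrite trace_metricC trace_metric_linear !(trace_metricC _ V).
Qed.

Ltac curvature_lin :=
  move=> a X X'; rewrite /trace_curvature; apply/matrixP => i j;
  rewrite !(mulmxDl, mulmxDr) -!(scalemxAl, scalemxAr) !(addmxE, oppmxE, scalemxE);
  ring.

Lemma trace_curvature_lin1 A W Z : linear (fun V => trace_curvature A V W Z).
Proof. curvature_lin. Qed.
Lemma trace_curvature_lin2 A V Z : linear (fun W => trace_curvature A V W Z).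
Proof. curvature_lin. Qed.
Lemma trace_curvature_lin3 A V W : linear (fun Z => trace_curvature A V W Z).
Proof. curvature_lin. Qed.

End TraceMultilinear.

Section Autoparallel.
Variables (R : realType) (n d : nat).
Variables (U : set 'rV[R]_d) (phi : 'rV[R]_d -> 'M[R]_n).
Hypothesis oU : open U.
Hypothesis sphi : smooth_on U phi.
Hypothesis pphi : forall u, U u -> posdef (phi u).
Hypothesis iphi : forall u x, U u -> 'D_x phi u = 0 -> x = 0.
(** The surface parametrized by [phi] is totally geodesic: covariant derivatives
    of coordinate fields stay tangent to it. *)
Hypothesis tgphi : forall u x y, U u ->
  exists z, cov phi x ('D_y phi) u = 'D_z phi u.
Implicit Types (x y z w u : 'rV[R]_d).

Local Notation e k := (basis_vec R k).
Local Notation T x u := ('D_x phi u).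
Local Notation g u := (trace_metric (phi u)).

Definition gram u : 'M[R]_d := \matrix_(i, j) g u (T (e i) u) (T (e j) u).

Lemma tangent_basis u x : U u -> T x u = \sum_k x 0 k *: T (e k) u.
Proof. by move=> Uu; apply: derive_sum_basis; exact: smooth_diff sphi Uu. Qed.

Lemma tangent_sym u x : U u -> (T x u)^T = T x u.
Proof.
move=> Uu; refine (etrans (esym (derive_trmx x (smooth_diff sphi Uu))) _).
by apply: (open_eq_derive oU) => // v /pphi/posdef_sym.
Qed.

Lemma tangent_inj u x y : U u -> T x u = T y u -> x = y.
Proof.
move=> Uu E; apply/eqP; rewrite -subr_eq0; apply/eqP; apply: (iphi Uu).
rewrite -scaleN1r addrC (derive_linear_arg (smooth_diff sphi Uu)) E scaleN1r.
by rewrite addNr.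
Qed.

Lemma innerE u x y : U u -> inner gram u x y = g u (T x u) (T y u).
Proof.
move=> Uu; rewrite (tangent_basis x Uu) (lin_sum (trace_metric_linl _ _)).
rewrite /inner; apply: eq_bigr => i _; rewrite (tangent_basis y Uu).
rewrite (lin_sum (trace_metric_linr _ _)) scaler_sumr.
by apply: eq_bigr => j _; rewrite mxE /GRing.scale /=; ring.
Qed.

Lemma gram_sym u i j : gram u i j = gram u j i.
Proof. by rewrite [LHS]mxE [RHS]mxE; exact: trace_metricC. Qed.

Lemma gram_row u x j : U u -> (x *m gram u) 0 j = g u (T x u) (T (e j) u).
Proof.
move=> Uu; rewrite (tangent_basis x Uu) (lin_sum (trace_metric_linl _ _)).
by rewrite mxE; apply: eq_bigr => i _; rewrite mxE.
Qed.

(** A vector in the kernel of the Gram matrix has a tangent image of norm zero. *)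
Lemma gram_unit u : U u -> gram u \in unitmx.
Proof.
move=> Uu; rewrite -row_free_unit -kermx_eq0; apply/rowV0P => x /sub_kermxP xG.
apply: (iphi Uu); apply: (trace_metric_eq0 (pphi Uu)); first exact: tangent_sym.
rewrite {2}(tangent_basis x Uu) (lin_sum (trace_metric_linr _ _)).
by apply: big1 => j _; rewrite -gram_row// xG mxE scaler0.
Qed.

Lemma smooth_gram i j : smooth_on U (fun u => gram u i j).
Proof.
have sS := smooth_inv_phi oU sphi pphi.
apply: (@smooth_ext _ _ _ oU _ (fun u => g u (T (e i) u) (T (e j) u))).
  by move=> u _; rewrite mxE.
apply: (smooth_mxtrace oU); do !apply: (smooth_mulmx oU) => //;
  exact: smooth_derive.
Qed.

(** Christoffel symbols of the first kind. *)
Definition christoffel1 i j l u :=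
  g u (cov phi (e i) ('D_(e j) phi) u) (T (e l) u).

Lemma christoffel1_sym i j l u : U u -> christoffel1 i j l u = christoffel1 j i l u.
Proof.
move=> Uu; exact: (congr1 (fun A => g u A (T (e l) u))
  (cov_torsion_free oU sphi (e i) (e j) Uu)).
Qed.

Lemma gram_pder i j l u : U u -> pder (fun v => gram v j l) i u =
  christoffel1 i j l u + christoffel1 i l j u.
Proof.
move=> Uu; rewrite /pder.
have -> : (fun v => gram v j l) = (fun v => g v (T (e j) v) (T (e l) v)).
  by apply/funext => v; rewrite mxE.
refine (etrans (cov_metric oU sphi pphi (e i) (smooth_derive (e j) sphi)
  (smooth_derive (e l) sphi) Uu) _).
exact: congr1 (trace_metricC _ _ _).
Qed.

(** Koszul's formula: compatibility with the metric gives six terms, and the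
    absence of torsion cancels four of them. *)
Lemma christoffelE k i j u : U u -> christoffel gram k i j u =
  \sum_l invmx (gram u) k l * christoffel1 i j l u.
Proof.
move=> Uu; rewrite /christoffel mulr_sumr; apply: eq_bigr => l _.
rewrite (gram_pder i j l Uu) (gram_pder j i l Uu) (gram_pder l i j Uu).
rewrite (christoffel1_sym j i l Uu) (christoffel1_sym l i j Uu).
rewrite (christoffel1_sym l j i Uu).
move: (christoffel1 i j l u) (christoffel1 i l j u) (christoffel1 j l i u).
by move: (invmx _ _ _) => *; field.
Qed.

(** In a totally geodesic surface the Christoffel symbols of the induced metric
    are the coordinates of the ambient covariant derivatives. *)
Lemma christoffel_cov i j u : U u ->
  \sum_k christoffel gram k i j u *: T (e k) u = cov phi (e i) ('D_(e j) phi) u.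
Proof.
move=> Uu; have [z zE] := tgphi (e i) (e j) Uu.
rewrite zE (tangent_basis z Uu); apply: eq_bigr => k _; congr (_ *: _).
rewrite christoffelE// /christoffel1 zE.
transitivity (((z *m gram u) *m invmx (gram u)) 0 k); last by rewrite mulmxK ?gram_unit.
rewrite [RHS]mxE; apply: eq_bigr => l _; rewrite gram_row// mulrC; congr (_ * _).
rewrite -[in LHS](trmxK (invmx _)) mxE trmx_inv; congr (invmx _ _ _).
by apply/matrixP => a b; rewrite [LHS]mxE gram_sym.
Qed.

Lemma smooth_christoffel k i j : smooth_on U (christoffel gram k i j).
Proof.
apply: (smoothM oU); first exact: smooth_cst.
apply: (smooth_sum oU) => l _; apply: (smoothM oU).
  apply: (smooth_entry oU); apply: (smooth_invmx oU); first exact: gram_unit.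
  by apply: (smooth_mx oU) => a b; exact: smooth_gram.
apply: (smoothB oU); first apply: (smoothD oU).
all: by apply: smooth_derive; exact: smooth_gram.
Qed.

(** The correction term in [cov] is linear over functions. *)
Lemma cov_Leibniz x (c : 'rV[R]_d -> R) (Z : 'rV[R]_d -> 'M[R]_n) u :
  differentiable c u -> differentiable Z u ->
  cov phi x (fun v => c v *: Z v) u = 'D_x c u *: Z u + c u *: cov phi x Z u.
Proof.
move=> dc dZ; rewrite /cov (derive_scalemx x dc dZ).2.
move: (T x u) (invmx _) (Z u) ('D_x Z u) ('D_x c u) (c u) => t s z z' c' b.
rewrite -!(scalemxAl, scalemxAr); apply/matrixP => i j.
by rewrite !(addmxE, oppmxE, scalemxE); ring.
Qed.

Lemma cov_sum x m (c : 'I_m -> 'rV[R]_d -> R) (Z : 'I_m -> 'rV[R]_d -> 'M[R]_n) u :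
  (forall k, differentiable (c k) u) -> (forall k, differentiable (Z k) u) ->
  cov phi x (fun v => \sum_k c k v *: Z k v) u =
  \sum_k ('D_x (c k) u *: Z k u + c k u *: cov phi x (Z k) u).
Proof.
move=> dc dZ.
have dcZ k : differentiable (fun v => c k v *: Z k v) u.
  by have [] := derive_scalemx x (dc k) (dZ k).
transitivity (\sum_k cov phi x (fun v => c k v *: Z k v) u); last first.
  by apply: eq_bigr => k _; exact: cov_Leibniz.
rewrite /cov (derive_sum_fun _ x dcZ) sumrB; congr (_ - _).
rewrite -scaler_sumr; congr (_ *: _); rewrite mulmx_sumr !mulmx_suml -big_split.
by [].
Qed.

(** The coordinate curvature coefficients are those of the ambient tensor:
    differentiate [christoffel_cov] once more and antisymmetrize. *)
Lemma riem_coefE i j k u : U u ->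
  \sum_l riem_coef gram l i j k u *: T (e l) u =
  trace_curvature (phi u) (T (e i) u) (T (e j) u) (T (e k) u).
Proof.
move=> Uu; rewrite -(cov_curvature oU sphi pphi (e i) (e j) (smooth_derive (e k) sphi) Uu).
have C i' j' : cov phi (e i') (cov phi (e j') ('D_(e k) phi)) u =
    \sum_l (pder (christoffel gram l j' k) i' u
            + \sum_m christoffel gram l i' m u * christoffel gram m j' k u) *: T (e l) u.
  transitivity (cov phi (e i')
      (fun v => \sum_l christoffel gram l j' k v *: T (e l) v) u).
    have E v : U v -> cov phi (e j') ('D_(e k) phi) v =
        \sum_l christoffel gram l j' k v *: T (e l) v.
      by move=> Uv; rewrite christoffel_cov.
    refine (congr2 (fun A B => A - 2^-1 *: (T (e i') u *m invmx (phi u) *m B +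
      B *m invmx (phi u) *m T (e i') u)) (open_eq_derive oU (e i') E Uu) (E u Uu)).
  rewrite cov_sum; first last.
  - by move=> l; exact: smooth_diff (smooth_derive (e l) sphi) Uu.
  - by move=> l; exact: smooth_diff (smooth_christoffel _ _ _) Uu.
  under [RHS]eq_bigr do rewrite scalerDl.
  rewrite !big_split /=; congr (_ + _).
  under eq_bigr do rewrite -christoffel_cov// scaler_sumr.
  rewrite exchange_big /=; apply: eq_bigr => l _; rewrite scaler_suml.
  by apply: eq_bigr => m _; rewrite scalerA mulrC.
rewrite !C -sumrB; apply: eq_bigr => l _; rewrite -scalerBl; congr (_ *: _).
by rewrite /riem_coef sumrB opprD addrACA.
Qed.

Lemma curvature_basis u x y z : U u ->
  \sum_l (\sum_i \sum_j \sum_k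
      riem_coef gram l i j k u * x 0 i * y 0 j * z 0 k) *: T (e l) u =
  trace_curvature (phi u) (T x u) (T y u) (T z u).
Proof.
move=> Uu; have E := riem_coefE _ _ _ Uu.
have Ex := tangent_basis x Uu; have Ey := tangent_basis y Uu.
have Ez := tangent_basis z Uu.
move: (trace_curvature _) (trace_curvature_lin1 (phi u))
  (trace_curvature_lin2 (phi u)) (trace_curvature_lin3 (phi u)) E => K K1 K2 K3 E.
rewrite Ex (lin_sum (K1 _ _)).
under eq_bigr do rewrite scaler_suml.
rewrite exchange_big /=; apply: eq_bigr => i _.
rewrite Ey (lin_sum (K2 _ _)) scaler_sumr.
under eq_bigr do rewrite scaler_suml.
rewrite exchange_big /=; apply: eq_bigr => j _.
rewrite Ez (lin_sum (K3 _ _)) !scaler_sumr.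
under eq_bigr do rewrite scaler_suml.
rewrite exchange_big /=; apply: eq_bigr => k _.
rewrite -E !scaler_sumr; apply: eq_bigr => l _.
by rewrite !scalerA; congr (_ *: _); ring.
Qed.

Lemma riem4E u x y z w : U u -> riem4 gram u x y z w =
  g u (trace_curvature (phi u) (T x u) (T y u) (T z u)) (T w u).
Proof.
move=> Uu; rewrite -curvature_basis// (lin_sum (trace_metric_linl _ _)).
transitivity (\sum_l \sum_i \sum_j \sum_k \sum_m
    riem_coef gram l i j k u * x 0 i * y 0 j * z 0 k * gram u l m * w 0 m).
  rewrite /riem4.
  under eq_bigr do under eq_bigr do rewrite exchange_big /=.
  under eq_bigr do rewrite exchange_big /=.
  by rewrite exchange_big.
apply: eq_bigr => l _; rewrite /GRing.scale /= mulr_suml; apply: eq_bigr => i _.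
rewrite mulr_suml; apply: eq_bigr => j _; rewrite mulr_suml; apply: eq_bigr => k _.
have -> : g u (T (e l) u) (T w u) = \sum_m gram u l m * w 0 m.
  rewrite (tangent_basis w Uu) (lin_sum (trace_metric_linr _ _)).
  by apply: eq_bigr => m _; rewrite mxE mulrC.
by rewrite mulr_sumr; apply: eq_bigr => m _; rewrite mulrA.
Qed.

End Autoparallel.

(** * Ricci and scalar curvature *)

Section OperatorTrace.
Variables (R : realType) (n : nat).
Implicit Types B C K Q V W Z : 'M[R]_n.

(** The traces of the operators X |-> B X C and, below, X |-> B X^T C. *)
Lemma sum_delta_mul B C :
  \sum_a \sum_b (B *m delta_mx a b *m C) a b = \tr B * \tr C.
Proof.
rewrite mulr_suml; apply: eq_bigr => a _; rewrite mulr_sumr; apply: eq_bigr => b _.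
rewrite mxE (bigD1 b)//= big1 ?addr0 => [|k kb]; last first.
  rewrite mxE (bigD1 a)//= big1 ?addr0 => [|l la].
    by rewrite mxE (negbTE kb) andbF mulr0 mul0r.
  by rewrite mxE (negbTE la) mulr0.
rewrite mxE (bigD1 a)//= big1 ?addr0 => [|l la].
  by rewrite mxE !eqxx mulr1.
by rewrite mxE (negbTE la) mulr0.
Qed.

Lemma sum_delta_trmx_mul B C :
  \sum_a \sum_b (B *m (delta_mx a b)^T *m C) a b = \tr (B *m C^T).
Proof.
rewrite /mxtrace; apply: eq_bigr => a _; rewrite [RHS]mxE; apply: eq_bigr => b _.
rewrite trmx_delta mxE (bigD1 a)//= big1 ?addr0 => [|k ka]; last first.
  rewrite mxE big1 ?mul0r// => l _.
  by rewrite mxE (negbTE ka) andbF mulr0.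
rewrite mxE (bigD1 b)//= big1 ?addr0 => [|l lb].
  by rewrite !mxE !eqxx mulr1.
by rewrite mxE (negbTE lb) mulr0.
Qed.

Lemma trace_curvature_self Q W Z : Q \in unitmx -> trace_curvature Q Q W Z = 0.
Proof.
move=> Qu; rewrite /trace_curvature /= mulmxV// mul1mx.
rewrite -[Z *m _ *m Q]mulmxA mulVmx// mulmx1.
rewrite -[W *m _ *m Q]mulmxA mulVmx// mulmx1.
rewrite -[Z *m _ *m W *m _ *m Q]mulmxA mulVmx// mulmx1.
by rewrite subrr sub0r addrC subrr scaler0.
Qed.

(** The Ricci tensor: with g the trace metric, tr (Q^-1 W) is g (Q, W), so this
    is - (n g (W, Z) - g (Q, W) g (Q, Z)) / 4. *)
Definition ricci_form Q W Z : R :=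
  - 4^-1 * (n%:R * trace_metric Q W Z - \tr (invmx Q *m W) * \tr (invmx Q *m Z)).

(** Only the part of the projection [P] along symmetrization matters, since
    [Q] itself is in the kernel of the curvature. *)
Lemma ricci_trace (P : 'M[R]_n -> 'M[R]_n) (c : 'M[R]_n -> R) Q W Z :
  posdef Q -> W^T = W -> Z^T = Z ->
  (forall A, P A = 2^-1 *: (A + A^T) - c A *: Q) ->
  \sum_a \sum_b (trace_curvature Q (P (delta_mx a b)) W Z) a b = ricci_form Q W Z.
Proof.
move=> pQ Ws Zs PE; have Qu := posdef_unit pQ.
have Ks : (invmx Q)^T = invmx Q by rewrite trmx_inv posdef_sym.
have L := trace_curvature_lin1 Q W Z.
have E A : trace_curvature Q (P A) W Z =
    2^-1 *: (trace_curvature Q A W Z + trace_curvature Q A^T W Z).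
  rewrite PE addrC -scaleNr L (trace_curvature_self _ _ Qu) scaler0 add0r.
  by rewrite (linZ L) (linD L).
under eq_bigr do under eq_bigr do rewrite E scalemxE addmxE.
rewrite /ricci_form /trace_metric /trace_curvature.
move: (invmx Q) Ks => K Ks.
pose m1 (A : 'M[R]_n) := A *m K *m W *m K *m Z; pose m2 (A : 'M[R]_n) := W *m K *m A *m K *m Z.
pose m3 (A : 'M[R]_n) := Z *m K *m A *m K *m W; pose m4 (A : 'M[R]_n) := Z *m K *m W *m K *m A.
have S1 (B C : 'M[R]_n) (f : 'M[R]_n -> 'M[R]_n) : (forall A, f A = B *m A *m C) ->
    \sum_a \sum_b (f (delta_mx a b)) a b + \sum_a \sum_b (f (delta_mx a b)^T) a b
    = \tr B * \tr C + \tr (B *m C^T).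
  move=> fE; rewrite -sum_delta_mul -sum_delta_trmx_mul.
  by congr (_ + _); apply: eq_bigr => a _; apply: eq_bigr => b _; rewrite fE.
have E1 := S1 1%:M (K *m W *m K *m Z) m1
  ltac:(by move=> A; rewrite /m1 mul1mx !mulmxA).
have E2 := S1 (W *m K) (K *m Z) m2 ltac:(by move=> A; rewrite /m2 !mulmxA).
have E3 := S1 (Z *m K) (K *m W) m3 ltac:(by move=> A; rewrite /m3 !mulmxA).
have E4 := S1 (Z *m K *m W *m K) 1%:M m4 ltac:(by move=> A; rewrite /m4 mulmx1).
transitivity (2^-1 * (- 4^-1 *
  ((\sum_a \sum_b (m1 (delta_mx a b)) a b + \sum_a \sum_b (m1 (delta_mx a b)^T) a b)
  - (\sum_a \sum_b (m2 (delta_mx a b)) a b + \sum_a \sum_b (m2 (delta_mx a b)^T) a b)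
  - (\sum_a \sum_b (m3 (delta_mx a b)) a b + \sum_a \sum_b (m3 (delta_mx a b)^T) a b)
  + (\sum_a \sum_b (m4 (delta_mx a b)) a b + \sum_a \sum_b (m4 (delta_mx a b)^T) a b)))).
  rewrite -!big_split -!sumrB -!big_split !mulr_sumr /=; apply: eq_bigr => a _.
  rewrite -!big_split -!sumrB -!big_split !mulr_sumr /=; apply: eq_bigr => b _.
  by rewrite /m1 /m2 /m3 /m4 !(scalemxE, addmxE, oppmxE); ring.
rewrite E1 E2 E3 E4.
rewrite !trmx_mul Ks Ws Zs trmx1 !mul1mx !mulmx1 !mxtrace1 !mulmxA.
have -> : \tr (Z *m K *m W *m K) = \tr (K *m W *m K *m Z).
  by rewrite -!mulmxA mxtrace_mulC !mulmxA.
have -> : \tr (W *m K *m Z *m K) = \tr (K *m W *m K *m Z).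
  by rewrite mxtrace_mulC !mulmxA mxtrace_mulC !mulmxA mxtrace_mulC !mulmxA mxtrace_mulC !mulmxA.
rewrite [\tr (W *m K)]mxtrace_mulC [\tr (Z *m K)]mxtrace_mulC.
by field.
Qed.

End OperatorTrace.

Section AutoparallelRicci.
Variables (R : realType) (n d : nat).
Variables (U : set 'rV[R]_d) (phi : 'rV[R]_d -> 'M[R]_n).
Hypothesis oU : open U.
Hypothesis sphi : smooth_on U phi.
Hypothesis pphi : forall u, U u -> posdef (phi u).
Hypothesis iphi : forall u x, U u -> 'D_x phi u = 0 -> x = 0.
Hypothesis tgphi : forall u x y, U u ->
  exists z, cov phi x ('D_y phi) u = 'D_z phi u.
Local Notation e k := (basis_vec R k).
Local Notation T x u := ('D_x phi u).

(** Traces over the tangent space are computed without choosing a basis of it: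
    if J parametrizes that space and K is a left inverse of J with J K = P, then
    the trace of K Psi J is that of Psi J K, an operator on all matrices. *)
Lemma tangent_trace u (P Psi : 'M[R]_n -> 'M[R]_n) (c : 'I_d -> 'I_d -> R) :
  U u -> linear P -> linear Psi ->
  (forall x, P (T x u) = T x u) -> (forall A, exists y, P A = T y u) ->
  (forall i, Psi (T (e i) u) = \sum_l c l i *: T (e l) u) ->
  \sum_i c i i = \sum_a \sum_b (Psi (P (delta_mx a b))) a b.
Proof.
move=> Uu lP lPsi PT Pim Psie; have [K KE] := choice Pim.
have Tlin := derive_linear_arg (smooth_diff sphi Uu).
have Tinj := tangent_inj sphi iphi Uu.
have lK : linear K by move=> a A B; apply: Tinj; rewrite -KE lP Tlin -!KE.
have KT x : K (T x u) = x by apply: Tinj; rewrite -KE PT.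
have entry a b : (Psi (P (delta_mx a b))) a b =
    \sum_i \sum_l c l i * (K (delta_mx a b) 0 i * T (e l) u a b).
  rewrite KE (tangent_basis _ _ Uu) // (lin_sum lPsi) summxE.
  apply: eq_bigr => i _; rewrite scalemxE Psie summxE mulr_sumr.
  by apply: eq_bigr => l _; rewrite scalemxE; ring.
transitivity (\sum_i \sum_l c l i *
    (\sum_a \sum_b K (delta_mx a b) 0 i * T (e l) u a b)); last first.
  under [RHS]eq_bigr do under eq_bigr do rewrite entry.
  under [RHS]eq_bigr do rewrite exchange_big /=.
  rewrite [RHS]exchange_big /=; apply: eq_bigr => i _.
  under [RHS]eq_bigr do rewrite exchange_big /=.
  rewrite [RHS]exchange_big /=; apply: eq_bigr => l _.
  by rewrite mulr_sumr; apply: eq_bigr => a _; rewrite mulr_sumr.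
have KTE i l : \sum_a \sum_b K (delta_mx a b) 0 i * T (e l) u a b = (i == l)%:R.
  transitivity (K (T (e l) u) 0 i); last by rewrite KT /basis_vec mxE eqxx.
  rewrite [in RHS](matrix_sum_delta (T (e l) u)).
  have -> : \sum_a \sum_b T (e l) u a b *: delta_mx a b =
     \sum_a 1 *: (\sum_b T (e l) u a b *: delta_mx a b).
    by apply: eq_bigr => a _; rewrite scale1r.
  rewrite (lin_sum lK) summxE; apply: eq_bigr => a _.
  rewrite scale1r (lin_sum lK) summxE; apply: eq_bigr => b _.
  by rewrite scalemxE mulrC.
apply: eq_bigr => i _; transitivity (\sum_l c l i * (i == l)%:R); last first.
  by apply: eq_bigr => l _; congr (_ * _); rewrite -KTE.
rewrite (bigD1 i)// big1 => [|l li]; first by rewrite eqxx mulr1 [RHS]addr0.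
by rewrite eq_sym (negbTE li) mulr0.
Qed.

Variables (u : 'rV[R]_d) (c : 'M[R]_n -> R).
Hypothesis Uu : U u.
Hypothesis lc : linear (c : _ -> R^o).
Let P A : 'M[R]_n := 2^-1 *: (A + A^T) - c A *: phi u.
Hypothesis PT : forall x, P (T x u) = T x u.
Hypothesis Pim : forall A, exists y, P A = T y u.

Lemma ricci_coefE j k :
  ricci_coef (gram phi) j k u = ricci_form (phi u) (T (e j) u) (T (e k) u).
Proof.
have lP : linear P.
  move=> a A B; have cE : c (a *: A + B) = a * c A + c B := lc a A B.
  rewrite /P cE [(_ + _)^T]linearP; apply/matrixP => i l.
  by rewrite !(addmxE, scalemxE, oppmxE); ring.
have Ts x := tangent_sym oU sphi pphi x Uu.
rewrite -(ricci_trace (P := P) (c := c) (pphi Uu) (Ts (e j)) (Ts (e k)) (fun=> erefl)).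
apply: (@tangent_trace u P
  (fun A => trace_curvature (phi u) A (T (e j) u) (T (e k) u))
  (fun l i => riem_coef (gram phi) l i j k u)) => //.
  exact: trace_curvature_lin1.
by move=> i; rewrite -(riem_coefE oU sphi pphi iphi tgphi).
Qed.

Lemma ricci_formE y z :
  ricci_coord (gram phi) u y z = ricci_form (phi u) (T y u) (T z u).
Proof.
have f1 Q Z : linear (fun W : 'M[R]_n => ricci_form Q W Z : R^o).
  move=> a W W'; rewrite /ricci_form trace_metric_linear mulmxDr -scalemxAr.
  by rewrite mxtraceD mxtraceZ /GRing.scale /=; ring.
have f2 Q W : linear (fun Z : 'M[R]_n => ricci_form Q W Z : R^o).
  move=> a Z Z'; rewrite /ricci_form (trace_metric_linr Q W) mulmxDr -scalemxAr.
  by rewrite mxtraceD mxtraceZ /GRing.scale /=; ring.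
rewrite (tangent_basis sphi y Uu) (lin_sum (f1 _ _)) /ricci_coord.
apply: eq_bigr => j _; rewrite (tangent_basis sphi z Uu) (lin_sum (f2 _ _)).
rewrite scaler_sumr; apply: eq_bigr => k _; rewrite ricci_coefE.
by rewrite /GRing.scale /=; ring.
Qed.

(** Contracting the metric with its inverse gives [d]. As tr (S V) = g (phi, V),
    contracting the square of this linear form gives its squared norm, that is
    g (phi, phi) = n, because [phi u] itself is tangent. *)
Lemma scalar_formE al : T al u = phi u ->
  scalar_coord (gram phi) u = - 4^-1 * (n%:R * d%:R - n%:R).
Proof.
move=> alE; have Gu := gram_unit oU sphi pphi iphi Uu.
pose t := al *m gram phi u.
have tE j : t 0 j = \tr (invmx (phi u) *m T (e j) u).
  rewrite (gram_row sphi al j Uu) alE /trace_metric mulVmx ?mul1mx//.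
  exact: posdef_unit (pphi Uu).
have tE' : (t *m al^T) 0 0 = n%:R.
  transitivity (trace_metric (phi u) (T al u) (T al u)); last first.
    have pu := posdef_unit (pphi Uu).
    by rewrite alE /trace_metric mulVmx// mul1mx mulVmx// mxtrace1.
  rewrite {2}(tangent_basis sphi al Uu) (lin_sum (trace_metric_linr _ _)) mxE.
  by apply: eq_bigr => j _; rewrite (gram_row sphi al j Uu) mxE mulrC.
transitivity (- 4^-1 * (n%:R * \tr (invmx (gram phi u) *m (gram phi u)^T)
    - (t *m invmx (gram phi u) *m t^T) 0 0)); last first.
  have Gs : (gram phi u)^T = gram phi u.
    by apply/matrixP => i j; rewrite [LHS]mxE gram_sym.
  by rewrite Gs mulVmx// mxtrace1 {1}/t mulmxK// /t trmx_mul Gs mulmxA tE'.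
have -> : (t *m invmx (gram phi u) *m t^T) 0 0 =
    \sum_j \sum_k invmx (gram phi u) j k * (t 0 j * t 0 k).
  rewrite mxE exchange_big /=; apply: eq_bigr => k _; rewrite mxE [t^T _ _]mxE.
  by rewrite mulr_suml; apply: eq_bigr => j _; rewrite mulrAC mulrC.
have -> : \tr (invmx (gram phi u) *m (gram phi u)^T) =
    \sum_j \sum_k invmx (gram phi u) j k * gram phi u j k.
  by apply: eq_bigr => j _; rewrite mxE; apply: eq_bigr => k _; rewrite [(_^T) _ _]mxE.
transitivity (\sum_j \sum_k invmx (gram phi u) j k *
    (- 4^-1 * (n%:R * gram phi u j k - t 0 j * t 0 k))).
  apply: eq_bigr => j _; apply: eq_bigr => k _; congr (_ * _).
  by rewrite ricci_coefE /ricci_form !tE [gram phi u j k]mxE.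
clear tE tE'; clearbody t.
move: (invmx (gram phi u)) (gram phi u) Gu => I G _.
rewrite mulr_sumr -sumrB mulr_sumr; apply: eq_bigr => j _.
rewrite mulr_sumr -sumrB mulr_sumr; apply: eq_bigr => k _.
by ring.
Qed.

End AutoparallelRicci.

(** * The cone of positive definite matrices and its slice of determinant one *)

Section TraceAlgebra.
Variables (R : realType) (n : nat).
Implicit Types (A Q V W a b c M : 'M[R]_n).

Lemma trace_curvature_sqr M a b c : M \in unitmx ->
  trace_curvature (M *m M^T) (M *m a *m M^T) (M *m b *m M^T) (M *m c *m M^T)
  = M *m (- 4^-1 *: (a *m b *m c - b *m a *m c - c *m a *m b + c *m b *m a)) *m M^T.
Proof.
move=> Mu; have Mtu : M^T \in unitmx by rewrite unitmx_tr.
rewrite /trace_curvature invmx_mul//.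
have K (x y : 'M[R]_n) : M *m x *m M^T *m (invmx M^T *m invmx M) *m (M *m y *m M^T) =
    M *m (x *m y) *m M^T.
  by rewrite !mulmxA mulmxK// mulmxKV.
by rewrite !K -!(mulmxDr, mulmxBr, mulmxDl, mulmxBl) scalemxAl scalemxAr.
Qed.

(** The curvature is a double commutator; cyclicity of the trace turns its
    pairing with [a] into the squared norm of a single one. *)
Lemma trace_curvature_num M a b : M \in unitmx -> a^T = a -> b^T = b ->
  let k := a *m b - b *m a in
  trace_metric (M *m M^T) (trace_curvature (M *m M^T) (M *m a *m M^T)
    (M *m b *m M^T) (M *m b *m M^T)) (M *m a *m M^T) = - 4^-1 * \tr (k *m k^T).
Proof.
move=> Mu As Bs k; rewrite trace_curvature_sqr// trace_metric_sqr//.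
rewrite -scalemxAl mxtraceZ; congr (_ * _).
rewrite (_ : k^T = b *m a - a *m b); last first.
  by rewrite /k trmxB !trmx_mul As Bs.
rewrite /k !(mulmxDl, mulmxDr, mulNmx, mulmxN) !mulmxA.
rewrite !(mxtraceD, mxtraceN).
rewrite (_ : \tr (b *m a *m b *m a) = \tr (a *m b *m a *m b)); last first.
  by rewrite -!mulmxA mxtrace_mulC !mulmxA.
rewrite (_ : \tr (b *m b *m a *m a) = \tr (b *m a *m a *m b)); last first.
  by rewrite -!mulmxA mxtrace_mulC !mulmxA.
rewrite (_ : \tr (a *m b *m b *m a) = \tr (b *m a *m a *m b)); last first.
  by rewrite -!mulmxA mxtrace_mulC -!mulmxA mxtrace_mulC !mulmxA.
by ring.
Qed.

Lemma sectional_num_le0 A V W : posdef A -> V^T = V -> W^T = W ->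
  trace_metric A (trace_curvature A V W W) V <= 0.
Proof.
move=> /posdef_sqrt[M Mu ->] /(sym_congr_factor Mu)[a As ->].
move=> /(sym_congr_factor Mu)[b Bs ->]; rewrite trace_curvature_num//.
by rewrite mulNr oppr_le0 mulr_ge0// mxtrace_sqr_ge0.
Qed.

(** The vector is [W W] times the component of [V] orthogonal to [W]; this yields
    the Cauchy-Schwarz inequality together with its equality case. *)
Lemma gram_defect A V W :
  trace_metric A (trace_metric A W W *: V - trace_metric A V W *: W)
    (trace_metric A W W *: V - trace_metric A V W *: W) =
  trace_metric A W W *
    (trace_metric A V V * trace_metric A W W - trace_metric A V W ^+ 2).
Proof.
set p := trace_metric A W W; set q := trace_metric A V W.
have E X : trace_metric A (p *: V - q *: W) X =
    p * trace_metric A V X - q * trace_metric A W X.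
  rewrite -scaleNr trace_metric_linear (linZ (trace_metric_linl A X)).
  by rewrite /GRing.scale /= mulNr.
rewrite E !(trace_metricC _ _ (p *: V - q *: W)) !E (trace_metricC _ W V).
by rewrite -/p -/q; ring.
Qed.

Lemma Cauchy_Schwarz_trace A V W : posdef A -> V^T = V -> W^T = W ->
  trace_metric A V W ^+ 2 <= trace_metric A V V * trace_metric A W W.
Proof.
move=> pA Vs Ws; have [->|W0] := eqVneq W 0.
  by rewrite /trace_metric !mulmx0 !mxtrace0 expr0n mulr0.
have ps : (trace_metric A W W *: V - trace_metric A V W *: W)^T =
    trace_metric A W W *: V - trace_metric A V W *: W.
  by rewrite trmxB !trmxZ Vs Ws.
have := trace_metric_ge0 pA ps; rewrite gram_defect.
by rewrite pmulr_rge0 ?subr_ge0// trace_metric_gt0.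
Qed.

Lemma Cauchy_Schwarz_trace_strict A V W : posdef A -> V^T = V -> W^T = W ->
  independent2 V W ->
  0 < trace_metric A V V * trace_metric A W W - trace_metric A V W ^+ 2.
Proof.
move=> pA Vs Ws indep; rewrite lt_def subr_ge0 Cauchy_Schwarz_trace// andbT.
apply/negP => /eqP D0; have := gram_defect A V W; rewrite D0 mulr0.
have ps : (trace_metric A W W *: V - trace_metric A V W *: W)^T =
    trace_metric A W W *: V - trace_metric A V W *: W.
  by rewrite trmxB !trmxZ Vs Ws.
move=> /(trace_metric_eq0 pA ps); rewrite -scaleNr => /indep[WW _].
have W0 := trace_metric_eq0 pA Ws WW.
have E : 0 *: V + 1 *: W = 0 by rewrite W0 scale0r scaler0 addr0.
by have [_ /eqP] := indep 0 1 E; rewrite oner_eq0.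
Qed.

End TraceAlgebra.

Lemma param_pts (R : realType) (E : normedModType R) (S : riem E) U phi u :
  local_param (S := S) U phi -> U u -> pts S (phi u).
Proof.
move=> [oU _ _ _ /(_ U oU (fun _ h => h))[W _ phiU]] Uu.
have : (phi @` U) (phi u) by exists u.
by rewrite phiU => -[].
Qed.

Section TraceManifold.
Variables (R : realType) (n : nat) (sl : bool) (S : riem 'M[R]_n).
Hypothesis hpts : forall A, pts S A <-> posdef A /\ (sl -> \det A = 1).
Hypothesis hmet : met S = @trace_metric R n.

(** The tangent space at [A] of the cone of positive definite matrices, and of
    its slice of determinant one when [sl] holds. *)
Definition trace_tangent (A V : 'M[R]_n) : Prop :=
  V^T = V /\ (sl -> \tr (invmx A *m V) = 0).

(** Linear coordinates faithful on every tangent space: the target has the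
    expected dimension, so they make tangency a matter of counting. *)
Variable psi : 'M[R]_n -> 'rV[R]_(mdim S).
Hypothesis lpsi : linear psi.
Hypothesis ipsi : forall A V, pts S A -> trace_tangent A V -> psi V = 0 -> V = 0.

Local Notation d := (mdim S).
Implicit Types (U : set 'rV[R]_d) (phi : 'rV[R]_d -> 'M[R]_n).

Lemma param_posdef U phi : local_param (S := S) U phi ->
  forall u, U u -> posdef (phi u).
Proof. by move=> lp u Uu; have /hpts[] := param_pts lp Uu. Qed.

(** Constraints satisfied by a map pass to its derivatives; for the determinant
    this is Jacobi's formula. *)
Lemma det_tangent (V : normedModType R) (O : set V) (f : V -> 'M[R]_n) u x :
  open O -> smooth_on O f -> O u -> (forall v, O v -> pts S (f v)) ->
  trace_tangent (f u) ('D_x f u).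
Proof.
move=> oO sf Ou fS; have df := smooth_diff sf Ou; split.
  refine (etrans (esym (derive_trmx x df)) _).
  by apply: (open_eq_derive oO) => // v /fS/hpts[/posdef_sym].
move=> slt; have [_ E] := derive_det x df.
have D0 : 'D_x (fun v => \det (f v)) u = 0.
  apply: (open_cst_derive (c := 1 : R) x oO) => // v Ov.
  by have /hpts[_ ->] := fS v Ov.
have /hpts[pf df1] := fS u Ou; move: E; rewrite D0 => E.
by rewrite /invmx posdef_unit// df1// invr1 scale1r -E.
Qed.

Lemma param_tangent U phi u x : local_param (S := S) U phi -> U u ->
  trace_tangent (phi u) ('D_x phi u).
Proof.
move=> lp Uu; have [oU sphi _ _ _] := lp.
by apply: (det_tangent x oU sphi Uu) => v; exact: param_pts.
Qed.

Lemma tangent_trace_tangent A V : tangent S A V -> pts S A /\ trace_tangent A V.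
Proof.
move=> [U [phi [u [x [lp Uu <- <-]]]]].
by split; [exact: param_pts lp Uu|exact: (param_tangent x lp Uu)].
Qed.

Lemma trace_tangent_linear A a V W : trace_tangent A V -> trace_tangent A W ->
  trace_tangent A (a *: V + W).
Proof.
move=> [Vs V0] [Ws W0]; split; first by rewrite trmxD trmxZ Vs Ws.
by move=> slt; rewrite mulmxDr -scalemxAr mxtraceD mxtraceZ V0// W0// mulr0 addr0.
Qed.

(** In the coordinates [psi] the differential of [phi] is an injective
    endomorphism of a space of finite dimension. *)
Lemma param_tangent_surj U phi u V : local_param (S := S) U phi -> U u ->
  trace_tangent (phi u) V -> exists x, 'D_x phi u = V.
Proof.
move=> lp Uu tV; have [oU sphi _ iphi _] := lp.
have df := smooth_diff sphi Uu; have Sp := param_pts lp Uu.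
pose M := \matrix_(i < d) psi ('D_(basis_vec R i) phi u).
have xM x : x *m M = psi ('D_x phi u).
  rewrite (derive_sum_basis x df) (lin_sum lpsi); apply/rowP => j.
  rewrite mxE summxE; apply: eq_bigr => i _; rewrite [M _ _]mxE.
  by rewrite [RHS]mxE.
have Mu : M \in unitmx.
  rewrite -row_free_unit -kermx_eq0; apply/rowV0P => x /sub_kermxP.
  rewrite xM => /(ipsi Sp (param_tangent x lp Uu)); exact: iphi.
exists (psi V *m invmx M); apply/eqP; rewrite -subr_eq0; apply/eqP.
apply: (ipsi Sp).
  rewrite addrC -scaleN1r; apply: trace_tangent_linear => //.
  exact: (param_tangent _ lp Uu).
by rewrite addrC -scaleN1r lpsi -xM mulmxKV// scaleN1r addNr.
Qed.

(** On the slice, tangency means g (phi, V) = 0. The position vector [phi] is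
    parallel, so differentiating g (phi, 'D_y phi) = 0 shows that covariant
    derivatives satisfy the same condition. *)
Lemma param_totally_geodesic U phi : local_param (S := S) U phi ->
  forall u x y, U u -> exists z, cov phi x ('D_y phi) u = 'D_z phi u.
Proof.
move=> lp u x y Uu; have [oU sphi _ _ _] := lp.
have pphi := param_posdef lp.
suff /(param_tangent_surj lp Uu)[z zE] : trace_tangent (phi u) (cov phi x ('D_y phi) u).
  by exists z.
have sy := smooth_derive y sphi.
have Ts z v : U v -> ('D_z phi v)^T = 'D_z phi v.
  by move=> Uv; case: (param_tangent z lp Uv).
have Ss : (invmx (phi u))^T = invmx (phi u).
  by rewrite trmx_inv (posdef_sym (pphi _ Uu)).
split.
  have E : ('D_x ('D_y phi) u)^T = 'D_x ('D_y phi) u.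
    refine (etrans (esym (derive_trmx x (smooth_diff sy Uu))) _).
    by apply: (open_eq_derive oU) => // v; exact: Ts.
  rewrite /cov; move: E (Ts x u Uu) (Ts y u Uu) Ss.
  move: ('D_x ('D_y phi) u) ('D_x phi u) ('D_y phi u) (invmx _) => D X Y K.
  move=> E Xs Ys Ks; rewrite trmxB trmxZ trmxD !trmx_mul E Xs Ys Ks !mulmxA.
  by rewrite [X in _ *: X]addrC.
move=> slt; have E := cov_metric oU sphi pphi x sphi sy Uu.
have pu := posdef_unit (pphi _ Uu).
have c0 : cov phi x phi u = 0.
  rewrite /cov mulmxV// mul1mx -mulmxA mulVmx// mulmx1.
  move: ('D_x phi u) => X; apply/matrixP => i j.
  by rewrite !(addmxE, oppmxE, scalemxE) mxE; field.
have D0 : 'D_x (fun v => trace_metric (phi v) (phi v) ('D_y phi v)) u = 0.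
  apply: (open_cst_derive (c := 0 : R) x oU) => // v Uv.
  have [_ T0] := param_tangent y lp Uv.
  by rewrite /trace_metric mulVmx ?mul1mx ?T0// posdef_unit//; exact: pphi.
move: E; rewrite D0 c0 /trace_metric mulmx0 !mul0mx mxtrace0 add0r.
by rewrite mulVmx// mul1mx => ->.
Qed.

Lemma param_gram phi : param_metric (S := S) phi = gram phi.
Proof.
apply/funext => u; apply/matrixP => i j.
by rewrite [LHS]mxE [RHS]mxE hmet.
Qed.

Lemma trace_riemannian :
  (forall p, pts S p -> exists U phi u, [/\ local_param (S := S) U phi, U u & phi u = p]) ->
  riemannian_manifold S.
Proof.
move=> charts; split=> //.
- by move=> p v w _ _; rewrite hmet trace_metricC.
- by move=> p v v' w a _ _ _; rewrite hmet trace_metric_linear.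
- move=> p v /tangent_trace_tangent[/hpts[pp _] [vs _]] v0.
  by rewrite hmet trace_metric_gt0.
move=> U phi i j lp; rewrite param_gram; have [oU sphi _ _ _] := lp.
by apply: smooth_gram => //; exact: param_posdef.
Qed.

Definition trace_sectional (A V W : 'M[R]_n) : R :=
  trace_metric A (trace_curvature A V W W) V /
  (trace_metric A V V * trace_metric A W W - trace_metric A V W ^+ 2).

Lemma trace_has_sectional p v w : has_sectional S p v w (trace_sectional p v w).
Proof.
move=> U phi u x y lp Uu <- <- <-; have [oU sphi _ iphi _] := lp.
have pphi := param_posdef lp; have tg := param_totally_geodesic lp.
rewrite param_gram /sectional_coord.
rewrite (riem4E oU sphi pphi iphi tg _ _ _ _ Uu).
by rewrite !(innerE sphi _ _ Uu).
Qed.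

Lemma trace_nonpositive : nonpositive_curvature S.
Proof.
move=> p v w _ /tangent_trace_tangent[/hpts[pp _] [vs _]].
move=> /tangent_trace_tangent[_ [ws _]] _.
exists (trace_sectional p v w); first exact: trace_has_sectional.
apply: mulr_le0_ge0; first exact: sectional_num_le0.
by rewrite invr_ge0 subr_ge0 Cauchy_Schwarz_trace.
Qed.

(** The projection onto the tangent space used to compute Ricci traces:
    symmetrize, then on the slice remove the component along [A]. *)
Let c (A V : 'M[R]_n) : R := if sl then n%:R^-1 * \tr (invmx A *m V) else 0.
Let P (A V : 'M[R]_n) : 'M[R]_n := 2^-1 *: (V + V^T) - c A V *: A.

Lemma linear_correction A : linear (c A : _ -> R^o).
Proof.
move=> a V W; rewrite /c; case: sl; last by rewrite scaler0 addr0.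
by rewrite mulmxDr -scalemxAr mxtraceD mxtraceZ /GRing.scale /=; ring.
Qed.

Lemma projection_id A V : trace_tangent A V -> P A V = V.
Proof.
move=> [Vs V0]; have -> : P A V = 2^-1 *: (V + V^T).
  rewrite /P /c; case: sl V0 => [->//|_]; last by rewrite scale0r subr0.
  by rewrite mulr0 scale0r subr0.
rewrite Vs; apply/matrixP => i j; rewrite scalemxE addmxE; by field.
Qed.

Lemma projection_tangent A V : (0 < n)%N -> posdef A -> trace_tangent A (P A V).
Proof.
move=> n0 pA; have As := posdef_sym pA; split.
  by rewrite /P trmxB !trmxZ As trmxD trmxK [V^T + V]addrC.
move=> slt; rewrite /P /c slt.
rewrite mulmxBr -!scalemxAr mulmxDr mulVmx ?posdef_unit//.
rewrite !(mxtraceD, mxtraceZ, mxtraceN) mxtrace1.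
have -> : \tr (invmx A *m V^T) = \tr (invmx A *m V).
  by rewrite -mxtrace_tr trmx_mul trmxK trmx_inv As mxtrace_mulC.
by field; rewrite pnatr_eq0 -lt0n.
Qed.

Lemma trace_has_ricci (p v w : 'M[R]_n) : (0 < n)%N ->
  has_ricci S p v w (ricci_form p v w).
Proof.
move=> n0 U phi u x y lp Uu <- <- <-; have [oU sphi _ iphi _] := lp.
have pphi := param_posdef lp; have tg := param_totally_geodesic lp.
rewrite param_gram.
apply: (ricci_formE oU sphi pphi iphi tg Uu (linear_correction (phi u))).
  by move=> z; apply: projection_id; exact: (param_tangent z lp Uu).
move=> A; have := projection_tangent A n0 (pphi u Uu).
by move=> /(param_tangent_surj lp Uu)[z zE]; exists z.
Qed.

Lemma trace_has_scalar (p : 'M[R]_n) : (0 < n)%N -> ~~ sl ->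
  has_scalar S p (- 4^-1 * (n%:R * d%:R - n%:R)).
Proof.
move=> n0 nsl U phi u lp Uu _; have [oU sphi _ iphi _] := lp.
have pphi := param_posdef lp; have tg := param_totally_geodesic lp.
have /(param_tangent_surj lp Uu)[al alE] : trace_tangent (phi u) (phi u).
  by split; [exact: posdef_sym (pphi u Uu)|rewrite (negbTE nsl)].
rewrite param_gram.
apply: (scalar_formE oU sphi pphi iphi tg Uu (linear_correction (phi u)) _ _ alE).
  by move=> z; apply: projection_id; exact: (param_tangent z lp Uu).
move=> A; have := projection_tangent A n0 (pphi u Uu).
by move=> /(param_tangent_surj lp Uu)[z zE]; exists z.
Qed.

End TraceManifold.

(** * Global coordinates *)

Section Retraction.
Variables (R : realType) (E : normedModType R) (S : riem E).

(** Differentiating chi (phi u) = u makes the differential of [phi] injective, and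
    preimages under [chi] are the ambient open sets that cut out its image. *)
Lemma local_param_of_retraction (U : set 'rV[R]_(mdim S)) phi (O : set E) chi :
  open U -> smooth_on U phi -> open O -> smooth_on O chi ->
  (forall u, U u -> [/\ pts S (phi u), O (phi u) & chi (phi u) = u]) ->
  (forall p, pts S p -> U (chi p) -> phi (chi p) = p) ->
  local_param (S := S) U phi.
Proof.
move=> oU sphi oO schi Uphi phichi; split=> //.
- move=> u v; rewrite !inE => Uu Uv E0; have [_ _ <-] := Uphi _ Uu.
  by have [_ _ <-] := Uphi _ Uv; rewrite E0.
- move=> u x Uu D0; have [_ Ou _] := Uphi _ Uu.
  have dphi := smooth_diff sphi Uu; have dchi := smooth_diff schi Ou.
  have := derive_comp x dphi dchi; rewrite D0 derive0 => <-.
  refine (etrans (esym (derive_id u x)) (open_eq_derive oU x _ Uu)).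
  by move=> v Uv; have [_ _ ->] := Uphi _ Uv.
move=> U' oU' sU'; exists [set p | O p /\ U' (chi p)].
  rewrite openE => p [Op U'p]; have cp := smooth_continuous schi Op.
  have nO : \forall q \near p, O q by exact: open_nbhs_nbhs.
  have nU : \forall q \near p, U' (chi q) by apply: cp; exact: open_nbhs_nbhs.
  by rewrite /interior /=; near=> q; split; near: q.
apply/seteqP; split=> [p [u U'u <-]|p [Sp [Op U'p]]].
  by have [Sp Op chip] := Uphi _ (sU' _ U'u); split=> //; split=> //; rewrite chip.
by exists (chi p) => //; apply: phichi => //; exact: sU'.
Unshelve. all: by end_near. Qed.

End Retraction.

Section Normalization.
Variables (R : realType) (n : nat).
Hypothesis n0 : (0 < n)%N.
Implicit Types A B : 'M[R]_n.

(** The power - 1 / n of the determinant; multiplying by it makes the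
    determinant one. *)
Definition unimod_factor A : R := expR (- (n%:R^-1 * ln (\det A))).
Definition unimod A : 'M[R]_n := unimod_factor A *: A.

Lemma n_neq0 : n%:R != 0 :> R. Proof. by rewrite pnatr_eq0 -lt0n. Qed.

Lemma unimod_factor_gt0 A : 0 < unimod_factor A. Proof. exact: expR_gt0. Qed.

Lemma unimod_factor_exp A : 0 < \det A -> unimod_factor A ^+ n = (\det A)^-1.
Proof.
move=> dA; rewrite /unimod_factor -expRM_natl mulrN mulrA divff ?n_neq0//.
by rewrite mul1r expRN lnK.
Qed.

Lemma unimod_det A : 0 < \det A -> \det (unimod A) = 1.
Proof. by move=> dA; rewrite detZ unimod_factor_exp// mulVf// gt_eqF. Qed.

Lemma unimod_posdef A : posdef A -> posdef (unimod A).
Proof. by apply: posdef_scale; exact: unimod_factor_gt0. Qed.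

Lemma unimod_id A : \det A = 1 -> unimod A = A.
Proof.
by move=> dA; rewrite /unimod /unimod_factor dA ln1 mulr0 oppr0 expR0 scale1r.
Qed.

Lemma unimod_scale c A : 0 < c -> 0 < \det A -> unimod (c *: A) = unimod A.
Proof.
move=> c0 dA; rewrite /unimod scalerA; congr (_ *: _).
rewrite /unimod_factor detZ lnM ?posrE ?exprn_gt0// lnXn// -[ln c *+ n]mulr_natl mulrDr.
by rewrite mulKf ?n_neq0// opprD expRD expRN lnK// mulrAC mulVf ?mul1r// gt_eqF.
Qed.

Lemma smooth_unimod (V : normedModType R) (U : set V) (f : V -> 'M[R]_n) :
  open U -> smooth_on U f -> (forall x, U x -> 0 < \det (f x)) ->
  smooth_on U (fun x => unimod (f x)).
Proof.
move=> oU sf fd; apply: (smooth_scale oU) => //; apply: (smooth_expR oU).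
apply: (smoothN oU); apply: (smoothM oU); first exact: smooth_cst.
by apply: (smooth_ln oU) => //; exact: smooth_det.
Qed.

End Normalization.

Section SymmetricCoordinates.
Variables (n : nat) (n0 : (0 < n)%N) (sl : bool).
Let i0 : 'I_n := Ordinal n0.

Definition upper_pairs : {set 'I_n * 'I_n} :=
  [set p : 'I_n * 'I_n | (p.1 <= p.2)%N].

(** The upper and lower triangles cover the square and meet in the diagonal. *)
Lemma card_upper_pairs : #|upper_pairs| = (n * n.+1)./2.
Proof.
pose sw (p : 'I_n * 'I_n) := (p.2, p.1).
have sw_inj : injective sw by move=> [a b] [c d] [-> ->].
have cU : upper_pairs :|: (sw @: upper_pairs)%SET = [set: 'I_n * 'I_n]%SET.
  apply/setP => -[a b]; rewrite !inE /=; case: leqP => //= ba.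
  by apply/imsetP; exists (b, a) => //; rewrite inE /= ltnW.
have cI : upper_pairs :&: (sw @: upper_pairs)%SET = [set (i, i) | i : 'I_n].
  apply/setP => -[a b]; rewrite !inE /=; apply/andP/imsetP => /=.
    move=> [ab /imsetP[[c d]]]; rewrite inE /= => cd [ac bd]; exists a => //.
    by congr (_, _); apply/val_inj/anti_leq; rewrite /= ab ac bd cd.
  move=> [i _ [-> ->]]; rewrite leqnn; split=> //.
  by apply/imsetP; exists (i, i) => //; rewrite inE /=.
have := cardsUI upper_pairs (sw @: upper_pairs)%SET.
have cd : #|[set (i, i) | i : 'I_n]| = n.
  by rewrite card_imset => [|a b []//]; rewrite -[RHS]card_ord; exact: eq_card.
have cs : #|(sw @: upper_pairs)%SET| = #|upper_pairs| by rewrite card_imset.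
rewrite cU cI cd cs cardsT card_prod card_ord addnn -mulnSr => ->.
by rewrite doubleK.
Qed.

(** On the slice the first entry is not free: it is fixed by the determinant. *)
Definition free_pairs : {set 'I_n * 'I_n} :=
  if sl then upper_pairs :\ (i0, i0) else upper_pairs.

Lemma card_free_pairs :
  #|free_pairs| = if sl then (n * n.+1)./2.-1 else (n * n.+1)./2.
Proof.
rewrite /free_pairs; case: sl; rewrite -card_upper_pairs//.
by rewrite [in RHS](cardsD1 (i0, i0)) inE leqnn.
Qed.

Variable d : nat.
Hypothesis dE : d = if sl then (n * n.+1)./2.-1 else (n * n.+1)./2.

Definition pair_of (k : 'I_d) : 'I_n * 'I_n :=
  enum_val (cast_ord (etrans dE (esym card_free_pairs)) k).

Definition sort_pair (i j : 'I_n) := if (i <= j)%N then (i, j) else (j, i).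

(** [None] occurs only for the first entry, on the slice. *)
Definition rank_of (i j : 'I_n) : option 'I_d :=
  [pick k | pair_of k == sort_pair i j].

Lemma sort_pairC i j : sort_pair i j = sort_pair j i.
Proof.
rewrite /sort_pair; case: ltngtP => // ij.
by have -> : i = j by exact/val_inj.
Qed.

Lemma sort_pair_upper i j : sort_pair i j \in upper_pairs.
Proof. by rewrite /sort_pair; case: leqP => ij; rewrite inE //= ltnW. Qed.

Lemma pair_of_inj : injective pair_of.
Proof. by move=> k l /enum_val_inj/cast_ord_inj. Qed.

Lemma pair_of_sorted k : sort_pair (pair_of k).1 (pair_of k).2 = pair_of k.
Proof.
have : pair_of k \in upper_pairs.
  have := enum_valP (cast_ord (etrans dE (esym card_free_pairs)) k).
  by rewrite /free_pairs -/(pair_of k); case: sl => //; rewrite !inE => /andP[].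
by rewrite inE /sort_pair => ->; case: (pair_of k).
Qed.

Lemma rank_ofC i j : rank_of i j = rank_of j i.
Proof. by rewrite /rank_of sort_pairC. Qed.

Lemma rank_of_pair k : rank_of (pair_of k).1 (pair_of k).2 = Some k.
Proof.
rewrite /rank_of pair_of_sorted; case: pickP => [l /eqP/pair_of_inj->//|].
by move=> /(_ k); rewrite eqxx.
Qed.

Lemma rank_of_Some i j k : rank_of i j = Some k -> pair_of k = sort_pair i j.
Proof. by rewrite /rank_of; case: pickP => // l /eqP E [<-]. Qed.

Lemma rank_of_None i j : rank_of i j = None -> [/\ sl, i = i0 & j = i0].
Proof.
rewrite /rank_of; case: pickP => // none _.
have : sort_pair i j \notin free_pairs.
  apply/negP => sf; have := none (cast_ord (esym (etrans dE (esym card_free_pairs)))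
    (enum_rank_in sf (sort_pair i j))).
  by rewrite /pair_of cast_ord_comp cast_ord_id enum_rankK_in// eqxx.
rewrite /free_pairs; case: sl; last by rewrite sort_pair_upper.
rewrite in_setD1 sort_pair_upper andbT negbK => /eqP.
by rewrite /sort_pair; case: ifP => _ [-> ->].
Qed.

Lemma rank_of_origin : sl -> rank_of i0 i0 = None.
Proof.
move=> slt; rewrite /rank_of; case: pickP => // k.
have := enum_valP (cast_ord (etrans dE (esym card_free_pairs)) k).
rewrite -/(pair_of k) {1}/free_pairs slt in_setD1 => /andP[/negbTE E _].
by rewrite /sort_pair leqnn E.
Qed.

Variable R : realType.

Definition sym_coord (A : 'M[R]_n) : 'rV[R]_d :=
  \row_k A (pair_of k).1 (pair_of k).2.

(** The value one is used for the first entry, on the slice only. *)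
Definition sym_of_coord (x : 'rV[R]_d) : 'M[R]_n :=
  \matrix_(i, j) if rank_of i j is Some k then x 0 k else 1.

Lemma sym_coord_linear : linear sym_coord.
Proof. by move=> a A B; apply/rowP => k; rewrite !mxE. Qed.

Lemma sym_of_coord_sym x : (sym_of_coord x)^T = sym_of_coord x.
Proof. by apply/matrixP => i j; rewrite !mxE rank_ofC. Qed.

Lemma sym_of_coordK : cancel sym_of_coord sym_coord.
Proof. by move=> x; apply/rowP => k; rewrite !mxE rank_of_pair. Qed.

Lemma sym_coordK A : A^T = A -> (sl -> A i0 i0 = 1) -> sym_of_coord (sym_coord A) = A.
Proof.
move=> As A1; apply/matrixP => i j; rewrite mxE; case Er: (rank_of i j) => [k|].
  rewrite mxE (rank_of_Some Er) /sort_pair; case: ifP => //= _.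
  by rewrite -[in RHS]As mxE.
by have [/A1 E -> ->] := rank_of_None Er.
Qed.

Lemma sym_of_coord_origin x : sl -> sym_of_coord x i0 i0 = 1.
Proof. by move=> slt; rewrite mxE rank_of_origin. Qed.

Lemma smooth_sym_of_coord (U : set 'rV[R]_d) : open U -> smooth_on U sym_of_coord.
Proof.
move=> oU; apply: (smooth_mx oU) => i j.
apply: (@smooth_ext _ _ _ oU _
  (fun x : 'rV[R]_d => if rank_of i j is Some k then x 0 k else 1 : R)).
  by move=> x _; rewrite mxE.
case: (rank_of i j) => [k|]; last exact: smooth_cst.
by apply: (smooth_entry oU); exact: smooth_id.
Qed.

Lemma smooth_sym_coord (V : normedModType R) (U : set V) (f : V -> 'M[R]_n) :
  open U -> smooth_on U f -> smooth_on U (fun x => sym_coord (f x)).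
Proof.
move=> oU sf; apply: (smooth_mx oU) => i k.
apply: (@smooth_ext _ _ _ oU _ (fun x => f x (pair_of k).1 (pair_of k).2)).
  by move=> x _; rewrite mxE.
exact: smooth_entry.
Qed.

(** A symmetric matrix with vanishing free entries has at most its first entry
    nonzero, which the trace condition excludes on the slice. *)
Lemma sym_coord_inj A V : posdef A -> trace_tangent sl A V -> sym_coord V = 0 -> V = 0.
Proof.
move=> pA [Vs V0] cV.
have VE i j : V i j = V i0 i0 *+ (sl && (i == i0) && (j == i0)).
  case Er: (rank_of i j) => [k|]; last first.
    by have [-> -> ->] := rank_of_None Er; rewrite eqxx.
  have /rowP/(_ k) := cV; rewrite !mxE (rank_of_Some Er) => Vij.
  have -> : V i j = 0.
    by move: Vij; rewrite /sort_pair; case: ifP => //= _; rewrite -[in X in _ -> X]Vs mxE.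
  case: andP => // -[/andP[slt /eqP ii] /eqP ji].
  by move: Er; rewrite ii ji rank_of_origin.
apply/matrixP => i j; rewrite VE [RHS]mxE; case: andP => // -[/andP[slt _] _].
have := V0 slt; rewrite /mxtrace.
have ps := posdef_entry_gt0 i0 (posdef_inv pA).
rewrite (bigD1 i0)//= big1 => [|k ki].
  rewrite addr0 mxE (bigD1 i0)//= big1 => [|k ki].
    by rewrite addr0 => /eqP; rewrite mulf_eq0 (gt_eqF ps) /= => /eqP.
  by rewrite VE (negbTE ki) andbF mulr0.
by rewrite mxE big1 // => l _; rewrite VE (negbTE ki) andbF mulr0.
Qed.

End SymmetricCoordinates.

(** * Geodesics *)

Section GeodesicEquation.
Variables (R : realType) (n d : nat).
Variables (U : set 'rV[R]_d) (phi : 'rV[R]_d -> 'M[R]_n).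
Hypothesis oU : open U.
Hypothesis sphi : smooth_on U phi.
Hypothesis pphi : forall u, U u -> posdef (phi u).
Hypothesis iphi : forall u x, U u -> 'D_x phi u = 0 -> x = 0.
Hypothesis tgphi : forall u x y, U u ->
  exists z, cov phi x ('D_y phi) u = 'D_z phi u.
Local Notation e k := (basis_vec R k).

Lemma cov_direction (Z : 'rV[R]_d -> 'M[R]_n) u x : U u -> differentiable Z u ->
  cov phi x Z u = \sum_i x 0 i *: cov phi (e i) Z u.
Proof.
move=> Uu dZ; rewrite /cov (derive_sum_basis x dZ) (tangent_basis sphi x Uu).
rewrite !mulmx_suml mulmx_sumr -big_split /= scaler_sumr -sumrB.
apply: eq_bigr => i _; rewrite scalerBr; congr (_ - _).
by rewrite -!scalemxAl -scalemxAr -scalerDr !scalerA mulrC.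
Qed.

(** In coordinates of a totally geodesic surface, the geodesic equation is the
    equation c'' = c' c^-1 c' of the ambient space. *)
Lemma geodesic_coord (J : set R) (c : R -> 'M[R]_n) (x : R -> 'rV[R]_d) t :
  open J -> smooth_on J x -> (forall s, J s -> U (x s) /\ phi (x s) = c s) -> J t ->
  'D_1 ('D_1 c) t = 'D_1 c t *m invmx (c t) *m 'D_1 c t ->
  forall k, 'D_1 ('D_1 x) t 0 k + \sum_i \sum_j
    christoffel (gram phi) k i j (x t) * 'D_1 x t 0 i * 'D_1 x t 0 j = 0.
Proof.
move=> oJ sx xE Jt cE k; have [Ut phit] := xE t Jt.
have sx' := smooth_derive (1 : R) sx.
have dphix s z : J s -> differentiable (fun s => 'D_z phi (x s)) s.
  move=> Js; apply: (@differentiable_comp _ _ _ _ x ('D_z phi)).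
    exact: smooth_diff sx Js.
  exact: smooth_diff (smooth_derive z sphi) (xE s Js).1.
have c1' s : J s -> 'D_1 c s = 'D_('D_1 x s) phi (x s).
  move=> Js; have [Us _] := xE s Js.
  have E r : J r -> c r = phi (x r) by move=> /xE[].
  refine (etrans (open_eq_derive oJ (1 : R) E Js) _).
  exact: (derive_comp (1 : R) (smooth_diff sx Js) (smooth_diff sphi Us)).
have c1 s : J s -> 'D_1 c s = \sum_i 'D_1 x s 0 i *: 'D_(e i) phi (x s).
  move=> Js; refine (etrans (c1' s Js) _).
  by apply: tangent_basis => //; case: (xE s Js).
have c2 : 'D_1 ('D_1 c) t = \sum_i ('D_1 ('D_1 x) t 0 i *: 'D_(e i) phi (x t)
    + 'D_1 x t 0 i *: 'D_('D_1 x t) ('D_(e i) phi) (x t)).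
  refine (etrans (open_eq_derive oJ (1 : R) c1 Jt) _).
  have dx i := differentiable_entry 0 i (smooth_diff sx' Jt).
  have D i := derive_scalemx (1 : R) (dx i) (dphix t (e i) Jt).
  refine (etrans (derive_sum_fun _ (1 : R) (fun i => (D i).1)) _).
  apply: eq_bigr => i _; refine (etrans (D i).2 _).
  refine (congr2 (fun a A => a *: 'D_(e i) phi (x t) + 'D_1 x t 0 i *: A)
    (esym (derive_entry (1 : R) 0 i (smooth_diff sx' Jt))) _).
  exact: (derive_comp (1 : R) (smooth_diff sx Jt)
    (smooth_diff (smooth_derive (e i) sphi) Ut)).
pose w := \row_k ('D_1 ('D_1 x) t 0 k + \sum_i \sum_j
    christoffel (gram phi) k i j (x t) * 'D_1 x t 0 i * 'D_1 x t 0 j).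
suff /(iphi Ut)/rowP/(_ k) : 'D_w phi (x t) = 0 by rewrite !mxE.
rewrite (tangent_basis sphi w Ut).
have -> : \sum_k w 0 k *: 'D_(e k) phi (x t) =
    \sum_i 'D_1 ('D_1 x) t 0 i *: 'D_(e i) phi (x t) +
    \sum_i 'D_1 x t 0 i *: cov phi ('D_1 x t) ('D_(e i) phi) (x t).
  under eq_bigr do rewrite mxE scalerDl.
  rewrite big_split /=; congr (_ + _).
  transitivity (\sum_i \sum_j ('D_1 x t 0 i * 'D_1 x t 0 j) *:
      \sum_k christoffel (gram phi) k i j (x t) *: 'D_(e k) phi (x t)).
    under eq_bigr do rewrite scaler_suml.
    rewrite exchange_big /=; apply: eq_bigr => i _.
    under eq_bigr do rewrite scaler_suml.
    rewrite exchange_big /=; apply: eq_bigr => j _.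
    rewrite scaler_sumr; apply: eq_bigr => l _; rewrite scalerA -mulrA.
    exact: (congr1 (fun a => a *: 'D_(e l) phi (x t)) (mulrC _ _)).
  transitivity (\sum_i \sum_j ('D_1 x t 0 i * 'D_1 x t 0 j) *:
      cov phi (e i) ('D_(e j) phi) (x t)).
    apply: eq_bigr => i _; apply: eq_bigr => j _; congr (_ *: _).
    exact: (christoffel_cov oU sphi pphi iphi tgphi i j Ut).
  rewrite exchange_big /=; apply: eq_bigr => i _.
  have di := smooth_diff (smooth_derive (e i) sphi) Ut.
  rewrite (cov_direction _ Ut di) scaler_sumr; apply: eq_bigr => j _.
  rewrite scalerA.
  exact: (congr1 (fun a => a *: cov phi (e j) ('D_(e i) phi) (x t)) (mulrC _ _)).
rewrite -[RHS](subrr ('D_1 ('D_1 c) t)) {1}c2 big_split /= -addrA; congr (_ + _).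
move: cE (c1 t Jt) (c1' t Jt); rewrite -phit => cE cE1 cE2.
rewrite /cov -cE2 cE; move: ('D_1 c t) cE1 => c' cE1.
transitivity (\sum_i 'D_1 x t 0 i *: 'D_('D_1 x t) ('D_(e i) phi) (x t) -
    2^-1 *: (c' *m invmx (phi (x t)) *m c' + c' *m invmx (phi (x t)) *m c')).
  rewrite [X in 2^-1 *: (_ *m _ *m X + _)]cE1 [X in 2^-1 *: (_ + X *m _ *m _)]cE1.
  rewrite mulmx_sumr !mulmx_suml -big_split /= scaler_sumr -sumrB.
  apply: eq_bigr => i _; rewrite scalerBr; congr (_ - _).
  by rewrite -scalemxAr -!scalemxAl -scalerDr !scalerA mulrC.
congr (_ - _); move: (c' *m _ *m _) => C.
by apply/matrixP => i j; rewrite scalemxE addmxE; field.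
Qed.

End GeodesicEquation.

Section GeodesicCurve.
Variables (R : realType) (n : nat) (M : 'M[R]_n) (d : 'rV[R]_n).
Hypothesis Mu : M \in unitmx.

(** The geodesic through [M M^T] with velocity [M diag(d) M^T]. *)
Definition trace_geodesic (t : R) : 'M[R]_n :=
  M *m diag_mx (\row_i expR (t * d 0 i)) *m M^T.

Lemma smooth_trace_geodesic : smooth_on setT trace_geodesic.
Proof.
have oT := @openT R.
apply: (smooth_mulmx oT); last exact: smooth_cst.
apply: (smooth_mulmx oT); first exact: smooth_cst.
apply: (smooth_mx oT) => i j.
apply: (@smooth_ext _ _ _ oT _ (fun t : R => expR (t * d 0 i) * (i == j)%:R)).
  by move=> t _; rewrite !mxE mulr_natr.
apply: (smoothM oT); last exact: smooth_cst.
apply: (smooth_expR oT); apply: (smoothM oT); last exact: smooth_cst.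
exact: smooth_id.
Qed.

Lemma posdef_trace_geodesic t : posdef (trace_geodesic t).
Proof.
by apply: posdef_conj => //; apply: posdef_diag => i; rewrite mxE expR_gt0.
Qed.

Lemma trace_geodesic0 : trace_geodesic 0 = M *m M^T.
Proof.
rewrite /trace_geodesic (_ : diag_mx _ = 1%:M) ?mulmx1//.
rewrite -diag_const_mx; congr diag_mx; apply/rowP => i.
by rewrite !mxE mul0r expR0.
Qed.

(** A linear equation c' = K c with constant coefficient K, from which the
    second derivative follows. *)
Lemma derive_trace_geodesic t :
  'D_1 trace_geodesic t = M *m diag_mx d *m invmx M *m trace_geodesic t.
Proof.
pose E (t : R) := diag_mx (\row_i expR (t * d 0 i)).
have dexp (i : 'I_n) : is_derive t 1 (fun t : R => expR (t * d 0 i)) (expR (t * d 0 i) * d 0 i).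
  have dl : differentiable (fun t : R => t * d 0 i) t.
    apply: (@differentiableM _ _ id (cst (d 0 i))); first exact: ex_diff.
    exact: differentiable_cst.
  have [dc Dc] := derive_real_comp dl (is_derive_expR (t * d 0 i)).
  split; first exact: diff_derivable.
  have D1 : 'D_1 (fun t : R => t * d 0 i) t = d 0 i.
    refine (etrans (derive_mul (1 : R) (ex_diff (is_diff_def := is_diff_id t))
      (differentiable_cst (d 0 i) t)) _).
    by rewrite derive_id derive_cst mulr0 addr0 mul1r.
  by refine (etrans (Dc 1) _); rewrite D1 mulrC.
have dE : differentiable E t.
  apply: differentiable_mx => i j.
  have -> : (fun t => E t i j) = (fun t : R => expR (t * d 0 i) * (i == j)%:R).
    by apply/funext => s; rewrite !mxE mulr_natr.
  apply: differentiableM; last exact: differentiable_cst.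
  by apply/derivable1_diffP; case: (dexp i).
have DE : 'D_1 E t = diag_mx d *m E t.
  rewrite mulmx_diag; apply/matrixP => i j; rewrite (derive_entry (1 : R) i j dE).
  have -> : (fun t => E t i j) = (fun t : R => expR (t * d 0 i) * (i == j)%:R).
    by apply/funext => s; rewrite !mxE mulr_natr.
  have de : differentiable (fun t : R => expR (t * d 0 i)) t.
    by apply/derivable1_diffP; case: (dexp i).
  rewrite (derive_mul (1 : R) de (differentiable_cst _ _)) derive_cst mulr0 addr0.
  by case: (dexp i) => _ ->; rewrite !mxE mulr_natr mulrC.
rewrite -[LHS]/('D_1 (fun t => M *m E t *m M^T) t).
rewrite (derive_mulcst M^T (1 : R) (differentiable_cstmul M dE)) (derive_cstmul M (1 : R) dE) DE.
by rewrite /trace_geodesic -/(E t) !mulmxA mulmxKV.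
Qed.

(** If c' = K c then c'' = K c' = (c' c^-1) c'. *)
Lemma trace_geodesic_equation t :
  'D_1 ('D_1 trace_geodesic) t =
  'D_1 trace_geodesic t *m invmx (trace_geodesic t) *m 'D_1 trace_geodesic t.
Proof.
have E : 'D_1 trace_geodesic = fun t => M *m diag_mx d *m invmx M *m trace_geodesic t.
  by apply/funext => s; exact: derive_trace_geodesic.
have dc : differentiable trace_geodesic t := smooth_diff smooth_trace_geodesic I.
refine (etrans (congr1 (fun f : R -> 'M[R]_n => 'D_1 f t) E) _).
rewrite (derive_cstmul _ (1 : R) dc) [in RHS]derive_trace_geodesic.
by rewrite mulmxK ?derive_trace_geodesic//; apply/posdef_unit/posdef_trace_geodesic.
Qed.

End GeodesicCurve.

Lemma open_entry_gt0 (R : realType) m n i j :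
  open [set A : 'M[R]_(m, n) | 0 < A i j].
Proof.
apply: (@open_comp _ _ (fun A : 'M[R]_(m, n) => A i j) [set x | 0 < x]).
  by move=> A _; exact: coord_continuous.
exact: open_gt.
Qed.

Section TraceSpace.
Variables (R : realType) (n : nat) (n0 : (0 < n)%N) (sl : bool) (S : riem 'M[R]_n).
Hypothesis hpts : forall A, pts S A <-> posdef A /\ (sl -> \det A = 1).
Hypothesis hmet : met S = @trace_metric R n.
Hypothesis hdim : mdim S = if sl then (n * n.+1)./2.-1 else (n * n.+1)./2.
Let i0 : 'I_n := Ordinal n0.

Local Notation sigma := (sym_of_coord n0 hdim (R := R)).
Local Notation psi := (sym_coord n0 hdim (R := R)).

Definition to_slice (A : 'M[R]_n) : 'M[R]_n := if sl then unimod A else A.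

Lemma to_slice_pts A : posdef A -> pts S (to_slice A).
Proof.
move=> pA; apply/hpts; rewrite /to_slice; case: sl => //.
by split; [exact: unimod_posdef|move=> _; rewrite unimod_det// posdef_det_gt0].
Qed.

Lemma to_slice_id A : pts S A -> to_slice A = A.
Proof.
by move=> /hpts[_]; rewrite /to_slice; case: sl => // /(_ isT)/unimod_id.
Qed.

Lemma smooth_to_slice (V : normedModType R) (O : set V) (f : V -> 'M[R]_n) :
  open O -> smooth_on O f -> (forall x, O x -> 0 < \det (f x)) ->
  smooth_on O (fun x => to_slice (f x)).
Proof. by rewrite /to_slice; case: sl => // ? ? ?; exact: smooth_unimod. Qed.

(** One chart covers everything. On the slice it is a projective chart: matrices
    with first entry one are rescaled to determinant one, and dividing by the
    first entry undoes this. *)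
Definition chart_dom : set 'rV[R]_(mdim S) := [set x | posdef (sigma x)].
Definition chart (x : 'rV[R]_(mdim S)) : 'M[R]_n := to_slice (sigma x).
Definition cochart (A : 'M[R]_n) : 'rV[R]_(mdim S) :=
  psi (if sl then (A i0 i0)^-1 *: A else A).

Lemma open_chart_dom : open chart_dom.
Proof.
rewrite openE => x px; apply: (posdef_near (f := sigma)) => //.
  exact: smooth_sym_of_coord openT.
exact: sym_of_coord_sym.
Qed.

Lemma smooth_chart : smooth_on chart_dom chart.
Proof.
apply: smooth_to_slice; first exact: open_chart_dom.
  exact: smooth_sym_of_coord open_chart_dom.
by move=> x /posdef_det_gt0.
Qed.

Lemma smooth_cochart (V : normedModType R) (O : set V) (f : V -> 'M[R]_n) :
  open O -> smooth_on O f -> (forall x, O x -> 0 < f x i0 i0) ->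
  smooth_on O (fun x => cochart (f x)).
Proof.
move=> oO sf f0; apply: smooth_sym_coord => //; case: (sl) => //.
apply: (smooth_scale oO) => //; apply: (smoothV oO) => [x /f0/lt0r_neq0//|].
exact: smooth_entry.
Qed.

Lemma chartK x : chart_dom x -> cochart (chart x) = x.
Proof.
move=> px; rewrite /cochart /chart /to_slice.
have [slt|slf] : sl \/ ~~ sl by case: (sl); [left|right].
  rewrite !(ifT _ _ slt) /unimod scalerA scalemxE sym_of_coord_origin// mulr1.
  by rewrite mulVf ?scale1r ?sym_of_coordK// gt_eqF// unimod_factor_gt0.
by rewrite !(ifN _ _ slf) sym_of_coordK.
Qed.

Lemma cochart_sigma A : pts S A ->
  sigma (cochart A) = if sl then (A i0 i0)^-1 *: A else A.
Proof.
move=> /hpts[pA _]; rewrite /cochart; apply: sym_coordK.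
  by case: (sl); rewrite ?trmxZ posdef_sym.
by move=> slt; rewrite (ifT _ _ slt) mxE mulVf// gt_eqF// posdef_entry_gt0.
Qed.

Lemma cochart_dom A : pts S A -> chart_dom (cochart A).
Proof.
move=> SA; rewrite /chart_dom /= cochart_sigma//; have [pA _] := (hpts A).1 SA.
by case: (sl) => //; apply: posdef_scale => //; rewrite invr_gt0 posdef_entry_gt0.
Qed.

Lemma cochartK A : pts S A -> chart (cochart A) = A.
Proof.
move=> SA; rewrite /chart cochart_sigma//; have [pA dA] := (hpts A).1 SA.
rewrite /to_slice; case: sl dA => // /(_ isT) dA.
rewrite unimod_scale ?unimod_id// ?posdef_det_gt0//.
by rewrite invr_gt0 posdef_entry_gt0.
Qed.

Lemma chart_local_param : local_param (S := S) chart_dom chart.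
Proof.
apply: (local_param_of_retraction (O := [set A : 'M[R]_n | 0 < A i0 i0])
  (chi := cochart)).
- exact: open_chart_dom.
- exact: smooth_chart.
- exact: open_entry_gt0.
- apply: (smooth_cochart (f := id)) => //; first exact: open_entry_gt0.
  by apply: smooth_id; exact: open_entry_gt0.
- move=> u Uu; have Sp : pts S (chart u) by exact: to_slice_pts.
  split=> //; last exact: chartK.
  by apply: posdef_entry_gt0; have [] := (hpts _).1 Sp.
- by move=> p Sp _; exact: cochartK.
Qed.

Lemma trace_charts p : pts S p ->
  exists U phi u, [/\ local_param (S := S) U phi, U u & phi u = p].
Proof.
move=> Sp; exists chart_dom, chart, (cochart p).
by split; [exact: chart_local_param|exact: cochart_dom|exact: cochartK].
Qed.

Let lpsi : linear psi := sym_coord_linear n0 hdim (R := R).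

Lemma psi_faithful A V : pts S A -> trace_tangent sl A V -> psi V = 0 -> V = 0.
Proof. by move=> /hpts[pA _]; exact: sym_coord_inj. Qed.

(** Diagonalizing the velocity with respect to the base point gives the geodesic
    explicitly, for all times. On the slice the trace of the velocity vanishes,
    so the exponentials have product one. *)
Lemma trace_complete : complete_manifold S.
Proof.
move=> p v Sp /(tangent_trace_tangent hpts)[_ [vs v0]].
have [pp dp] := (hpts p).1 Sp.
have [M [d [Mu pE vE]]] := posdef_simul_diag pp vs.
have Mtu : M^T \in unitmx by rewrite unitmx_tr.
pose c := trace_geodesic M d.
have cS t : pts S (c t).
  apply/hpts; split; first exact: posdef_trace_geodesic.
  move=> slt; have := v0 slt; rewrite pE vE invmx_mul// !mulmxA mulmxKV//.
  rewrite mxtrace_mulC mulmxA mulmxV// mul1mx mxtrace_diag => d0.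
  have := dp slt; rewrite pE det_mulmx det_tr => dM.
  rewrite /c /trace_geodesic !det_mulmx det_tr mulrAC dM mul1r det_diag.
  under eq_bigr do rewrite mxE.
  by rewrite -expR_sum -mulr_sumr d0 mulr0 expR0.
have sc : smooth_on setT c by exact: smooth_trace_geodesic.
exists c; split; last first.
- rewrite derive1E (derive_trace_geodesic d Mu 0) trace_geodesic0 vE.
  by rewrite !mulmxA mulmxKV.
- by rewrite /c trace_geodesic0 pE.
move=> t0; exists chart_dom, chart, (fun t => cochart (c t)), 1.
have lp := chart_local_param; have [oU sphi _ iphi _] := lp.
have sx (O : set R) : open O -> smooth_on O (fun t => cochart (c t)).
  move=> oO; apply: smooth_cochart => //; first exact: smooth_subset sc.
  by move=> t _; apply: posdef_entry_gt0; have [] := (hpts _).1 (cS t).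
split=> //; first by apply: sx; exact: ball_open.
move=> t _; split=> //.
- exact: cochart_dom.
- exact: cochartK.
move=> k; rewrite (param_gram hmet).
have G := geodesic_coord (J := setT) oU sphi (param_posdef hpts lp) iphi
  (param_totally_geodesic hpts lpsi psi_faithful lp) openT (sx _ openT)
  (fun s _ => conj (cochart_dom (cS s)) (cochartK (cS s))) I
  (trace_geodesic_equation d Mu t) k.
have E1 : derive1 (fun t => cochart (c t)) = 'D_1 (fun t => cochart (c t)).
  by apply/funext => s; rewrite derive1E.
have E2 : derive1n 2 (fun t => cochart (c t)) t =
    'D_1 ('D_1 (fun t => cochart (c t))) t.
  by rewrite -E1 -derive1E.
by rewrite E2 E1.
Qed.

End TraceSpace.

(** * Simple connectedness *)

Section TraceSpaceTopology.
Variables (R : realType) (n : nat) (n0 : (0 < n)%N) (sl : bool) (S : riem 'M[R]_n).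
Hypothesis hpts : forall A, pts S A <-> posdef A /\ (sl -> \det A = 1).

Lemma pts_one : pts S 1%:M.
Proof. by apply/hpts; split; [exact: posdef1|rewrite det1]. Qed.

(** Straight-line homotopies, pushed back to the slice by normalization. *)
Definition slide (z : 'M[R]_n * R) (B : 'M[R]_n) : 'M[R]_n :=
  to_slice sl ((1 - z.2) *: z.1 + z.2 *: B).

Lemma slide_pts A B (s : R) : pts S A -> pts S B -> 0 <= s <= 1 -> pts S (slide (A, s) B).
Proof.
move=> /hpts[pA _] /hpts[pB _] s01; apply: (to_slice_pts n0 hpts) => /=.
exact: posdef_convex.
Qed.

Lemma slide0 A B : pts S A -> slide (A, 0) B = A.
Proof.
move=> SA; rewrite /slide /= subr0 scale1r scale0r addr0.
exact: (to_slice_id hpts).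
Qed.

Lemma slide1 A B : pts S B -> slide (A, 1) B = B.
Proof.
move=> SB; rewrite /slide /= subrr scale0r scale1r add0r.
exact: (to_slice_id hpts).
Qed.

Lemma continuous_slide A B (s : R) : pts S A -> pts S B -> 0 <= s <= 1 ->
  {for (A, s), continuous (slide ^~ B)}.
Proof.
move=> /hpts[pA _] /hpts[pB _] s01.
pose f (z : 'M[R]_n * R) := (1 - z.2) *: z.1 + z.2 *: B.
have oT := @openT ('M[R]_n * R)%type.
have s1 : smooth_on setT (fst : 'M[R]_n * R -> 'M[R]_n).
  apply: (smooth_lin oT); [exact: linear_fst|exact: continuous_fst].
have s2 : smooth_on setT (snd : 'M[R]_n * R -> R).
  apply: (smooth_lin oT); [exact: linear_snd|exact: continuous_snd].
have sf : smooth_on setT f.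
  apply: (smoothD oT); apply: (smooth_scale oT) => //; last exact: smooth_cst.
  by apply: (smoothB oT) => //; exact: smooth_cst.
pose O := [set z | 0 < \det (f z)].
have oO : open O.
  apply: (@open_comp _ _ (fun z => \det (f z)) [set x | 0 < x]); last exact: open_gt.
  by move=> z _; exact: (smooth_continuous (smooth_det oT sf)).
have sfO : smooth_on O f by exact: smooth_subset sf.
apply: (smooth_continuous (smooth_to_slice sl oO sfO _)) => //.
by rewrite /O /= /f /=; apply/posdef_det_gt0/posdef_convex.
Qed.

Lemma trace_simply_connected : simply_connected (pts S).
Proof.
have in01 (t : R) : t \in `[0, 1] -> 0 <= t <= 1 by rewrite in_itv.
split.
  split; first by exists 1%:M; exact: pts_one.
  move=> p q Sp Sq; exists (fun t => slide (p, t) q); split.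
  - split; last by move=> t /in01; exact: slide_pts.
    apply: continuous_in_subspaceT => t; rewrite inE /= => /in01 t01.
    have ct := continuous_slide Sp Sq t01.
    exact: (continuous_comp (@continuous_pairl R 'M[R]_n R p t) ct).
  - exact: slide0.
  - exact: slide1.
move=> c [cc cS] c01; have S0 : pts S (c 0) by apply: cS; rewrite in_itv /= lexx ler01.
exists (fun z => slide (c z.1, z.2) (c 0)); split.
- apply/subspace_continuousP => -[t s] [/= t01 s01].
  have ct := continuous_slide (cS t t01) S0 (in01 s s01).
  apply: (@cvg_comp _ _ _ (fun z : R * R => (c z.1, z.2)) (slide ^~ (c 0)) _
    (nbhs (c t, s)) _ _ ct).
  have FF : Filter (within (unit_square (R := R)) (nbhs ((t, s) : R * R))).
    exact: within_filter.
  apply: (@cvg_pair_nbhs R 'M[R]_n R _ _ (fun z => c z.1) snd (c t) s FF); last first.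
    move=> X wX; have sX := @continuous_snd R R R (t, s) X wX.
    exact: (@filterS _ (nbhs ((t, s) : R * R)) _ _ _ (fun z Xz _ => Xz) sX).
  have /subspace_continuousP/(_ t t01) cct := cc.
  apply: (@cvg_comp _ _ _ (fst : R * R -> R) c _ (within `[0, 1] (nbhs t))) => //.
  move=> X wX; have fX := @continuous_fst R R R (t, s) [set a | `[0, 1]%classic a -> X a] wX.
  have sub : [set z : R * R | `[0, 1]%classic z.1 -> X z.1] `<=`
      [set z | unit_square z -> X z.1] by move=> z Xz [z1 _]; exact: Xz.
  exact: (@filterS _ (nbhs ((t, s) : R * R)) _ _ _ sub fX).
- by move=> [t s] [/= t01 /in01 s01]; apply: slide_pts => //; exact: cS.
- by move=> t t01; rewrite slide0//; exact: cS.
- by move=> t t01; rewrite slide1//.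
move=> s /in01 s01; rewrite -c01 /slide /= -scalerDl subrK scale1r.
by rewrite (to_slice_id hpts).
Qed.

End TraceSpaceTopology.

(** * Congruences and geodesic symmetries *)

Section TraceSpaceIsometries.
Variables (R : realType) (n : nat) (sl : bool) (S : riem 'M[R]_n).
Hypothesis hpts : forall A, pts S A <-> posdef A /\ (sl -> \det A = 1).
Hypothesis hmet : met S = @trace_metric R n.

Lemma congruence_smooth_map (L : 'M[R]_n) : L \in unitmx -> (sl -> \det L ^+ 2 = 1) ->
  smooth_map S S (fun A => L *m A *m L^T).
Proof.
move=> Lu dL; split=> [p /hpts[pp dp]|U phi [oU sphi _ _ _]].
  apply/hpts; split; first exact: posdef_conj.
  by move=> slt; rewrite !det_mulmx det_tr mulrAC -expr2 dL// dp// mulr1.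
apply: (smooth_mulmx oU); last exact: smooth_cst.
by apply: (smooth_mulmx oU) => //; exact: smooth_cst.
Qed.

(** A congruence is linear, hence its own differential, and the trace metric is
    invariant under congruence of the point and of both vectors. *)
Lemma congruence_isometry (L : 'M[R]_n) : L \in unitmx -> (sl -> \det L ^+ 2 = 1) ->
  Defs.isometry S S (fun A => L *m A *m L^T).
Proof.
move=> Lu dL; split; first exact: congruence_smooth_map.
  move=> U phi u x y lp Uu; have [oU sphi _ _ _] := lp.
  have df := smooth_diff sphi Uu.
  have D z : 'D_z ((fun A => L *m A *m L^T) \o phi) u = L *m 'D_z phi u *m L^T.
    refine (etrans (derive_mulcst L^T z (differentiable_cstmul L df)) _).
    by rewrite (derive_cstmul L z df).
  rewrite !D hmet; apply: trace_metric_conj => //.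
  by apply: posdef_unit; exact: param_posdef lp _ Uu.
exists (fun A => invmx L *m A *m (invmx L)^T); split.
- apply: congruence_smooth_map; first by rewrite unitmx_inv.
  by move=> slt; rewrite det_inv exprVn dL// invr1.
- move=> p _; rewrite !mulmxA mulVmx// mul1mx -mulmxA -trmx_mul mulVmx//.
  by rewrite trmx1 mulmx1.
- move=> p _; rewrite !mulmxA mulmxV// mul1mx -mulmxA -trmx_mul mulmxV//.
  by rewrite trmx1 mulmx1.
Qed.

(** Square roots of the two points, as congruences from the identity. *)
Lemma trace_homogeneous : homogeneous S.
Proof.
move=> p q /hpts[/posdef_sqrt[M Mu pE] dp] /hpts[/posdef_sqrt[N Nu qE] dq].
exists (fun A => (N *m invmx M) *m A *m (N *m invmx M)^T).
  apply: congruence_isometry; first by rewrite unitmx_mul Nu unitmx_inv.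
  move=> slt; rewrite det_mulmx det_inv exprMn exprVn.
  have := dp slt; have := dq slt; rewrite pE qE !det_mulmx !det_tr -!expr2.
  by move=> -> ->; rewrite invr1 mulr1.
rewrite pE qE trmx_mul !mulmxA mulmxKV// -[_ *m M^T *m _]mulmxA -trmx_mul.
by rewrite mulVmx// trmx1 mulmx1.
Qed.

Lemma phi_sym_smooth_map Q : pts S Q -> smooth_map S S (phi_sym Q).
Proof.
move=> /hpts[pQ dQ]; have Qu := posdef_unit pQ; split=> [p /hpts[pp dp]|U phi lp].
  apply/hpts; split.
    by rewrite /phi_sym -{2}(posdef_sym pQ); apply: posdef_conj => //; exact: posdef_inv.
  by move=> slt; rewrite /phi_sym !det_mulmx det_inv dQ// dp// invr1 !mulr1.
have [oU sphi _ _ _] := lp.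
apply: (smooth_mulmx oU); last exact: smooth_cst.
apply: (smooth_mulmx oU); first exact: smooth_cst.
apply: (smooth_invmx oU) => // u Uu.
by apply: posdef_unit; exact: param_posdef lp _ Uu.
Qed.

Lemma derive_phi_sym Q U phi u x : local_param (S := S) U phi -> U u ->
  'D_x (phi_sym Q \o phi) u =
  - (Q *m invmx (phi u) *m 'D_x phi u *m invmx (phi u) *m Q).
Proof.
move=> lp Uu; have [oU sphi _ _ _] := lp.
have fu v : U v -> phi v \in unitmx.
  by move=> Uv; apply: posdef_unit; exact: param_posdef lp _ Uv.
have di := smooth_diff (smooth_invmx oU fu sphi) Uu.
refine (etrans (derive_mulcst Q x (differentiable_cstmul Q di)) _).
rewrite (derive_cstmul Q x di) (derive_invmx x oU fu sphi Uu).
by rewrite mulmxN mulNmx !mulmxA.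
Qed.

Lemma phi_symK (Q X : 'M[R]_n) : Q \in unitmx -> X \in unitmx -> phi_sym Q (phi_sym Q X) = X.
Proof.
move=> Qu Xu; rewrite /phi_sym !invmx_mul ?unitmx_mul ?unitmx_inv ?Qu ?Xu//.
by rewrite invmxK !mulmxA mulmxV// mul1mx mulmxKV.
Qed.

(** With K the inverse of [A], the congruence by [K] takes (A, V, W) to
    (K, K V K, K W K), and the congruence by [Q] then takes K to [phi_sym Q A]. *)
Lemma phi_sym_metric (Q A V W : 'M[R]_n) : posdef Q -> posdef A ->
  trace_metric (phi_sym Q A) (- (Q *m invmx A *m V *m invmx A *m Q))
    (- (Q *m invmx A *m W *m invmx A *m Q)) = trace_metric A V W.
Proof.
move=> pQ pA; have Au := posdef_unit pA; have Qu := posdef_unit pQ.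
have Qs := posdef_sym pQ.
have Ks : (invmx A)^T = invmx A by rewrite trmx_inv posdef_sym.
have Ku : invmx A \in unitmx by rewrite unitmx_inv.
have NE X Y : trace_metric (phi_sym Q A) (- X) (- Y) = trace_metric (phi_sym Q A) X Y.
  by rewrite /trace_metric !(mulmxN, mulNmx) opprK.
rewrite NE -(trace_metric_conj V W Ku Au) Ks mulVmx// mul1mx.
by rewrite -(trace_metric_conj _ _ Qu Ku) Qs !mulmxA.
Qed.

Lemma phi_sym_symmetry Q : pts S Q -> symmetry_at S Q (phi_sym Q).
Proof.
move=> SQ; have /hpts[pQ dQ] := SQ; have Qu := posdef_unit pQ.
have Qs := posdef_sym pQ.
have phiK p : pts S p -> phi_sym Q (phi_sym Q p) = p.
  by move=> /hpts[pp _]; apply: phi_symK => //; exact: posdef_unit.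
split.
- split; [exact: phi_sym_smooth_map| |].
    move=> U phi u x y lp Uu; rewrite hmet.
    refine (etrans (congr2 (trace_metric _) (derive_phi_sym Q x lp Uu)
      (derive_phi_sym Q y lp Uu)) _).
    exact: phi_sym_metric pQ (param_posdef hpts lp Uu).
  by exists (phi_sym Q); split=> //; exact: phi_sym_smooth_map.
- by rewrite /phi_sym mulmxV// mul1mx.
move=> U phi u x lp Uu E; rewrite (derive_phi_sym Q x lp Uu) E.
by rewrite mulmxV// mul1mx mulmxKV.
Qed.

Lemma trace_symmetric : symmetric_manifold S.
Proof. by move=> Q SQ; exists (phi_sym Q); exact: phi_sym_symmetry. Qed.

End TraceSpaceIsometries.

(** Reduce to [Q = 1] by a congruence: a positive definite [Y] with [Y^2 = 1]
    satisfies [(Y + 1)(Y - 1) = 0] with an invertible first factor. *)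
Lemma phi_sym_fixed (R : realType) n (Q X : 'M[R]_n) : posdef Q -> posdef X ->
  phi_sym Q X = X <-> X = Q.
Proof.
move=> pQ pX; split=> [|->]; last first.
  by rewrite /phi_sym mulmxV ?mul1mx// posdef_unit.
have [M Mu ->] := posdef_sqrt pQ; have Mtu : M^T \in unitmx by rewrite unitmx_tr.
have [Y Ys XE] := sym_congr_factor Mu (posdef_sym pX).
have pY : posdef Y.
  have : posdef (invmx M *m X *m (invmx M)^T).
    by apply: posdef_conj => //; rewrite unitmx_inv.
  by rewrite XE !mulmxA mulVmx// mul1mx -mulmxA -trmx_mul mulVmx// trmx1 mulmx1.
have Yu := posdef_unit pY.
have iE : invmx (M *m Y *m M^T) = invmx M^T *m invmx Y *m invmx M.
  by rewrite invmx_mul ?unitmx_mul ?Mu// invmx_mul// mulmxA.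
rewrite XE /phi_sym iE !mulmxA mulmxK// mulmxKV// => E.
have YY : Y *m Y = 1%:M.
  move: E => /(congr1 (fun A => invmx M *m A *m invmx M^T)).
  rewrite -2![M *m _ *m M^T]mulmxA !mulKmx// !mulmxK// => YV.
  by rewrite -{1}YV mulVmx.
have p2 : posdef ((1 - 2^-1) *: Y + 2^-1 *: 1%:M).
  by apply: posdef_convex pY (posdef1 R n); lra.
have YN : (Y + 1%:M) *m (Y - 1%:M) = 0.
  by rewrite mulmxDl !mulmxBr YY mul1mx !mulmx1 addrC subrKA subrr.
have Y1u : Y + 1%:M \in unitmx.
  have -> : Y + 1%:M = 2 *: ((1 - 2^-1) *: Y + 2^-1 *: 1%:M).
    apply/matrixP => i j; rewrite !(addmxE, scalemxE); by field.
  by apply: posdef_unit; apply: posdef_scale => //; rewrite ltr0n.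
have : Y - 1%:M = 0 by rewrite -[LHS](mulKmx Y1u) YN mulmx0.
by move=> /eqP; rewrite subr_eq0 => /eqP ->; rewrite mulmx1.
Qed.

(** * Splitting off the determinant *)

Section LogDet.
Variables (R : realType) (n : nat) (n0 : (0 < n)%N).
Variables (V : normedModType R) (O : set V) (f : V -> 'M[R]_n).
Hypothesis oO : open O.
Hypothesis sf : smooth_on O f.
Hypothesis pf : forall u, O u -> posdef (f u).

Lemma smooth_ln_det : smooth_on O (fun u => ln (\det (f u))).
Proof.
apply: (smooth_ln oO); last exact: smooth_det.
by move=> u /pf/posdef_det_gt0.
Qed.

Lemma derive_ln_det u x : O u ->
  'D_x (fun u => ln (\det (f u))) u = \tr (invmx (f u) *m 'D_x f u).
Proof.
move=> Ou; have [dd Dd] := derive_det x (smooth_diff sf Ou).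
have pd := posdef_det_gt0 (pf Ou).
have [_ D] := derive_real_comp dd (is_derive1_ln pd).
refine (etrans (D x) _); rewrite Dd /invmx posdef_unit; last exact: pf.
by rewrite -scalemxAl mxtraceZ mulrC.
Qed.

(** Normalization projects tangent vectors orthogonally to the ray and scales. *)
Lemma derive_unimod u x : O u ->
  'D_x (fun u => unimod (f u)) u = unimod_factor (f u) *:
    ('D_x f u - (n%:R^-1 * \tr (invmx (f u) *m 'D_x f u)) *: f u).
Proof.
move=> Ou; have df := smooth_diff sf Ou; have dl := smooth_diff smooth_ln_det Ou.
pose l (u : V) : R := (- n%:R^-1) * ln (\det (f u)).
have dL : differentiable l u.
  by apply: differentiableM => //; exact: differentiable_cst.
have DL : 'D_x l u = - n%:R^-1 * \tr (invmx (f u) *m 'D_x f u).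
  refine (etrans (derive_mul x (differentiable_cst _ _) dl) _).
  by rewrite derive_cst mul0r add0r (derive_ln_det x Ou).
have [de De] := derive_real_comp dL (is_derive_expR (l u)).
have lE : (fun u => expR (l u)) = (fun u => unimod_factor (f u)).
  by apply/funext => v; rewrite /unimod_factor /l mulNr.
rewrite lE in de De.
have [_ E] := derive_scalemx x de df.
refine (etrans E _); rewrite De DL -(congr1 (fun g => g u) lE).
move: ('D_x f u) (\tr (_ *m 'D_x f u)) (expR (l u)) => D b a.
by apply/matrixP => i j; rewrite !(addmxE, scalemxE, oppmxE); ring.
Qed.

End LogDet.

Section TraceMetricSplit.
Variables (R : realType) (n : nat) (n0 : (0 < n)%N).
Implicit Types A V W : 'M[R]_n.

Lemma trace_metric_scale s A V W : s != 0 -> A \in unitmx ->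
  trace_metric (s *: A) (s *: V) (s *: W) = trace_metric A V W.
Proof.
move=> s0 Au; have sAu : s *: A \in unitmx by rewrite unitmxZ ?unitfE.
rewrite /trace_metric invmxZ//.
rewrite -!(scalemxAl, scalemxAr) !scalerA mxtraceZ !mulrA.
by rewrite mulVf// mul1r mulVf// mul1r.
Qed.

(** Orthogonal splitting of the trace metric along the ray through [A]. *)
Lemma trace_metric_split A V W : A \in unitmx ->
  trace_metric A (V - (n%:R^-1 * \tr (invmx A *m V)) *: A)
    (W - (n%:R^-1 * \tr (invmx A *m W)) *: A)
  + (\tr (invmx A *m V) / Num.sqrt n%:R) * (\tr (invmx A *m W) / Num.sqrt n%:R)
  = trace_metric A V W.
Proof.
move=> Au; set v := \tr _; set w := \tr _.
have nn := n_neq0 R n0.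
have sn : Num.sqrt n%:R ^+ 2 = n%:R :> R by rewrite sqr_sqrtr// ler0n.
have s0 : Num.sqrt n%:R != 0 :> R by rewrite sqrtr_eq0 -ltNge ltr0n.
have L a X Y Z : trace_metric A (X - a *: Y) Z =
    trace_metric A X Z - a * trace_metric A Y Z.
  by rewrite -scaleNr addrC trace_metric_linear addrC mulNr.
have E X : trace_metric A A X = \tr (invmx A *m X).
  by rewrite /trace_metric mulVmx// mul1mx.
rewrite L !(trace_metricC A _ (W - _)) !L !(trace_metricC A _ A) !E.
rewrite mulVmx// mxtrace1 (trace_metricC A W V) -/v -/w.
have -> : v / Num.sqrt n%:R * (w / Num.sqrt n%:R) = v * w / n%:R.
  by move: (Num.sqrt n%:R) sn s0 => q <- q0; field.
by field.
Qed.

End TraceMetricSplit.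

Section ProductIsometry.
Variables (R : realType) (n : nat) (n0 : (0 < n)%N).
Let r : R := Num.sqrt n%:R.

Let r_neq0 : r != 0. Proof. by rewrite sqrtr_eq0 -ltNge ltr0n. Qed.
Let sqr_r : r ^+ 2 = n%:R. Proof. by rewrite sqr_sqrtr// ler0n. Qed.

Definition split_map (A : 'M[R]_n) : 'M[R]_n * R := (unimod A, ln (\det A) / r).
Definition unsplit_map (z : 'M[R]_n * R) : 'M[R]_n := expR (z.2 / r) *: z.1.

Lemma split_pts (A : 'M[R]_n) : posdef A -> pts (SLPD R n) (unimod A).
Proof.
by move=> pA; split; [exact: unimod_posdef|rewrite unimod_det// posdef_det_gt0].
Qed.

Lemma unimod_exp t (B : 'M[R]_n) : posdef B -> \det B = 1 ->
  unimod (expR t *: B) = B.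
Proof.
move=> pB dB; rewrite unimod_scale ?expR_gt0 ?dB ?ltr01//.
exact: unimod_id.
Qed.

Lemma ln_det_exp t (B : 'M[R]_n) : \det B = 1 ->
  ln (\det (expR (t / r) *: B)) / r = t.
Proof.
move=> dB; rewrite detZ dB mulr1 lnXn ?expR_gt0// expRK -mulr_natr -sqr_r.
by field; exact: r_neq0.
Qed.

Lemma exp_unimod (A : 'M[R]_n) : posdef A -> expR (ln (\det A) / r / r) *: unimod A = A.
Proof.
move=> pA; rewrite /unimod scalerA /unimod_factor.
rewrite -expRD (_ : _ + _ = 0) ?expR0 ?scale1r//.
move: (ln _) => a; have -> : a / r / r = a / r ^+ 2 by field; exact: r_neq0.
by rewrite sqr_r; field; exact: n_neq0.
Qed.

Lemma derive_split_ln (V : normedModType R) (O : set V) (f : V -> 'M[R]_n) u x :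
  open O -> smooth_on O f -> (forall u, O u -> posdef (f u)) -> O u ->
  'D_x (fun u => ln (\det (f u)) / r) u = \tr (invmx (f u) *m 'D_x f u) / r.
Proof.
move=> oO sf pf Ou; have dl := smooth_diff (smooth_ln_det oO sf pf) Ou.
refine (etrans (derive_mul x dl (differentiable_cst _ _)) _).
by rewrite derive_cst mulr0 addr0 (derive_ln_det sf pf x Ou).
Qed.

(** The normalized matrix accounts for the component of a vector orthogonal to the
    ray, and ln det / sqrt n for its radial component. An arbitrary smooth family
    [f] is allowed, so that a further isometry can follow on the first factor. *)
Lemma product_metric (V : normedModType R) (O : set V) (f : V -> 'M[R]_n) u x y :
  open O -> smooth_on O f -> (forall u, O u -> posdef (f u)) -> O u ->
  trace_metric (unimod (f u)) ('D_x (fun u => unimod (f u)) u)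
    ('D_y (fun u => unimod (f u)) u)
  + 'D_x (fun u => ln (\det (f u)) / r) u * 'D_y (fun u => ln (\det (f u)) / r) u
  = trace_metric (f u) ('D_x f u) ('D_y f u).
Proof.
move=> oO sf pf Ou; have fu := posdef_unit (pf u Ou).
have s0 : unimod_factor (f u) != 0 by rewrite gt_eqF// unimod_factor_gt0.
pose t z := n%:R^-1 * \tr (invmx (f u) *m 'D_z f u).
have E1 : trace_metric (unimod (f u)) ('D_x (fun u => unimod (f u)) u)
    ('D_y (fun u => unimod (f u)) u) =
    trace_metric (f u) ('D_x f u - t x *: f u) ('D_y f u - t y *: f u).
  refine (etrans (congr2 (trace_metric (unimod (f u))) (derive_unimod oO sf pf x Ou)
    (derive_unimod oO sf pf y Ou)) _).
  exact: trace_metric_scale.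
have E2 := congr2 (fun a b : R => a * b) (derive_split_ln x oO sf pf Ou)
  (derive_split_ln y oO sf pf Ou).
refine (etrans (congr2 (fun a b : R => a + b) E1 E2) _).
exact: trace_metric_split.
Qed.

Lemma split_isometry :
  Defs.isometry (PD R n) (riem_prod (SLPD R n) (euclidean_line R)) split_map.
Proof.
have PDpts U phi : local_param (S := PD R n) U phi -> forall u, U u -> posdef (phi u).
  by apply: (@param_posdef _ _ false) => A; split=> [|[]].
split.
- split=> [A pA|U phi lp]; first by split=> //; exact: split_pts.
  have [oU sphi _ _ _] := lp; have pphi := PDpts _ _ lp.
  apply: smooth_pair => //; first apply: smooth_unimod => //.
    by move=> u /pphi/posdef_det_gt0.
  apply: (smoothM oU); last exact: smooth_cst.
  exact: smooth_ln_det.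
- move=> U phi u x y lp Uu; have [oU sphi _ _ _] := lp; have pphi := PDpts _ _ lp.
  have s1 : smooth_on U (fun u => unimod (phi u)).
    by apply: smooth_unimod => // v /pphi/posdef_det_gt0.
  have s2 : smooth_on U (fun u => ln (\det (phi u)) / r).
    by apply: (smoothM oU); [exact: smooth_ln_det|exact: smooth_cst].
  have D z := derive_pair z (smooth_diff s1 Uu) (smooth_diff s2 Uu).
  refine (etrans (congr2 (met (riem_prod (SLPD R n) (euclidean_line R))
    (split_map (phi u))) (D x) (D y)) _).
  exact: (product_metric x y oU sphi pphi Uu).
exists unsplit_map; split.
- split=> [[B t] [/= [pB dB] _]|U phi [oU sphi _ _ _]].
    by apply: posdef_scale => //; exact: expR_gt0.
  apply: (smooth_scale oU).
    apply: (smooth_expR oU); apply: (smoothM oU); last exact: smooth_cst.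
    by apply: (smooth_lin_comp oU (@linear_snd R 'M[R]_n R)) => //; exact: continuous_snd.
  by apply: (smooth_lin_comp oU (@linear_fst R 'M[R]_n R)) => //; exact: continuous_fst.
- by move=> A pA; rewrite /unsplit_map /split_map /= exp_unimod.
move=> [B t] [/= [pB dB] _]; rewrite /unsplit_map /split_map /=.
by rewrite unimod_exp// ln_det_exp.
Qed.

End ProductIsometry.

(** * The upper half-plane and matrices of order two *)

Section LocalMetric.
Variables (R : realType) (d : nat) (U : set 'rV[R]_d).
Hypothesis oU : open U.
Variables G G' : 'rV[R]_d -> 'M[R]_d.
Hypothesis GG' : forall u, U u -> G u = G' u.

Lemma christoffel_local k i j u : U u -> christoffel G k i j u = christoffel G' k i j u.
Proof.
have P a b c v : U v -> pder (fun v => G v a b) c v = pder (fun v => G' v a b) c v.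
  by move=> Uv; apply: (open_eq_derive oU _ _ Uv) => w Uw; rewrite GG'.
move=> Uu; rewrite /christoffel GG'//; congr (_ * _); apply: eq_bigr => l _.
by rewrite !P.
Qed.

(** The coordinate curvature at a point depends only on the metric near it; two
    expressions of a metric agree on the chart domain and nowhere else. *)
Lemma sectional_coord_local u x y : U u ->
  sectional_coord G u x y = sectional_coord G' u x y.
Proof.
move=> Uu.
have C l j k := christoffel_local l j k.
have D i l j k : pder (christoffel G l j k) i u = pder (christoffel G' l j k) i u.
  exact: (open_eq_derive oU (basis_vec R i) (C l j k) Uu).
have K l i j k : riem_coef G l i j k u = riem_coef G' l i j k u.
  refine (congr2 (fun a b : R => a + b)
    (congr2 (fun a b : R => a - b) (D i l j k) (D j l i k)) _).
  by apply: eq_bigr => m _; rewrite !(C _ _ _ u Uu).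
have I x' y' : inner G u x' y' = inner G' u x' y' by rewrite /inner (GG' Uu).
have Q : riem4 G u x y y x = riem4 G' u x y y x.
  rewrite /riem4 (GG' Uu); do 5!(apply: eq_bigr => ? _).
  by rewrite K.
by rewrite /sectional_coord Q !I.
Qed.

End LocalMetric.

Section HalfPlane.
Variable R : realType.
Local Notation H := (hyperbolic_plane (2^-1 : R)).
Local Notation SL2 := (SLPD R 2).
Implicit Types (A V W : 'M[R]_2).

Lemma sum2 (F : 'I_2 -> R) : \sum_i F i = F 0 + F 1.
Proof. by rewrite big_ord_recl big_ord1; congr (_ + F _); apply/val_inj. Qed.

Lemma mul2E m (A : 'M[R]_(m, 2)) (B : 'M[R]_2) i j : (A *m B) i j = A i 0 * B 0 j + A i 1 * B 1 j.
Proof. by rewrite mxE sum2. Qed.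

Lemma tr2E A : \tr A = A 0 0 + A 1 1.
Proof. exact: sum2. Qed.

Lemma det2E A : \det A = A 0 0 * A 1 1 - A 0 1 * A 1 0.
Proof.
rewrite (expand_det_row _ 0) sum2 /cofactor !det_mx11 !mxE /= expr0 expr1.
have -> : lift 0 0 = 1 :> 'I_2 by exact/val_inj.
have -> : lift 1 0 = 0 :> 'I_2 by exact/val_inj.
by rewrite mul1r mulN1r mulrN.
Qed.

Lemma sym2E A : A^T = A -> A 1 0 = A 0 1.
Proof. by move=> As; rewrite -[in LHS]As mxE. Qed.

Lemma mx2P (A B : 'M[R]_2) : A 0 0 = B 0 0 -> A 0 1 = B 0 1 -> A 1 0 = B 1 0 ->
  A 1 1 = B 1 1 -> A = B.
Proof.
move=> e00 e01 e10 e11; apply/matrixP => i j.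
have P (k : 'I_2) : (k = 0) \/ (k = 1).
  by case: k => [[|[|//]] ?]; [left|right]; exact/val_inj.
by case: (P i) => ->; case: (P j) => ->.
Qed.

(** The matrix with rows (a, b) and (b, c) and determinant one is sent to the
    root (b + i) / c of c z^2 - 2 b z + a in the upper half-plane; [form_of]
    recovers the quadratic polynomial from its root. *)
Definition half_plane_of (A : 'M[R]_2) : R * R := (A 0 1 / A 1 1, (A 1 1)^-1).

Definition form_of (z : R * R) : 'M[R]_2 :=
  \matrix_(i, j) (z.2^-1 *
    (if (i == 0) && (j == 0) then z.1 ^+ 2 + z.2 ^+ 2
     else if (i == 0) || (j == 0) then z.1 else 1)).

Lemma form_ofE z : [/\ form_of z 0 0 = z.2^-1 * (z.1 ^+ 2 + z.2 ^+ 2),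
  form_of z 0 1 = z.2^-1 * z.1, form_of z 1 0 = z.2^-1 * z.1 & form_of z 1 1 = z.2^-1].
Proof. by rewrite !mxE /= mulr1. Qed.

Lemma form_of_pts z : 0 < z.2 -> pts SL2 (form_of z).
Proof.
move=> z2; have [e00 e01 e10 e11] := form_ofE z.
have z0 : z.2 != 0 by rewrite gt_eqF.
split; last by rewrite det2E e00 e01 e10 e11; field.
split; first by apply: mx2P; rewrite mxE ?e01 ?e10.
move=> x x0; rewrite mxE sum2 !mxE !sum2 e00 e01 e10 e11.
have -> : (x 0 0 * (z.2^-1 * (z.1 ^+ 2 + z.2 ^+ 2)) + x 0 1 * (z.2^-1 * z.1)) * x 0 0
   + (x 0 0 * (z.2^-1 * z.1) + x 0 1 * z.2^-1) * x 0 1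
   = z.2^-1 * ((x 0 0 * z.1 + x 0 1) ^+ 2 + (x 0 0 * z.2) ^+ 2) by field.
rewrite mulr_gt0 ?invr_gt0// lt_def addr_ge0 ?sqr_ge0// andbT.
apply: contra x0; rewrite paddr_eq0 ?sqr_ge0// !sqrf_eq0.
move=> /andP[+ p0z].
have /eqP p0 : x 0 0 == 0 by move: p0z; rewrite mulf_eq0 (negbTE z0) orbF.
rewrite p0 mul0r add0r => /eqP q0.
by apply/eqP/rowP => i; rewrite mxE; case: i => [[|[|//]] ?];
  [rewrite -p0|rewrite -q0]; congr (x _ _); exact/val_inj.
Qed.

Lemma half_plane_ofK z : 0 < z.2 -> half_plane_of (form_of z) = z.
Proof.
move=> z2; have [_ e01 _ e11] := form_ofE z; have z0 : z.2 != 0 by rewrite gt_eqF.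
by rewrite /half_plane_of e01 e11 [RHS]surjective_pairing; congr (_, _); field.
Qed.

Lemma half_plane_of_pts A : pts SL2 A -> 0 < (half_plane_of A).2.
Proof. by move=> [pA _]; rewrite invr_gt0 posdef_entry_gt0. Qed.

Lemma form_ofK A : pts SL2 A -> form_of (half_plane_of A) = A.
Proof.
move=> [pA dA]; have A1 : A 1 1 != 0 by rewrite gt_eqF// posdef_entry_gt0.
have [e00 e01 e10 e11] := form_ofE (half_plane_of A).
have s := sym2E (posdef_sym pA).
have a : A 0 0 = (1 + A 0 1 ^+ 2) / A 1 1.
  by rewrite -dA det2E s; field.
by apply: mx2P; rewrite ?e00 ?e01 ?e10 ?e11 /half_plane_of /= ?s ?a; field.
Qed.

Section Smooth.
Variables (V : normedModType R) (O : set V).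
Hypothesis oO : open O.

Lemma smooth_half_plane_of (f : V -> 'M[R]_2) : smooth_on O f ->
  (forall u, O u -> f u 1 1 != 0) -> smooth_on O (fun u => half_plane_of (f u)).
Proof.
move=> sf f1; have se i j := smooth_entry oO i j sf.
by apply: smooth_pair => //; first apply: (smoothM oO) => //; exact: smoothV.
Qed.

Lemma smooth_form_of (f : V -> R * R) : smooth_on O f ->
  (forall u, O u -> (f u).2 != 0) -> smooth_on O (fun u => form_of (f u)).
Proof.
move=> sf f2.
have s1 : smooth_on O (fun u => (f u).1).
  by apply: (smooth_lin_comp oO (@linear_fst R R R)) => //; exact: continuous_fst.
have s2 : smooth_on O (fun u => (f u).2).
  by apply: (smooth_lin_comp oO (@linear_snd R R R)) => //; exact: continuous_snd.
apply: smooth_mx => // i j; pose c := (i == 0) && (j == 0); pose c' := (i == 0) || (j == 0).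
apply: (@smooth_ext _ _ _ oO _ (fun u => (f u).2^-1 *
   (if c then (f u).1 ^+ 2 + (f u).2 ^+ 2 else if c' then (f u).1 else 1))).
  by move=> u _; rewrite mxE.
apply: (smoothM oO); first exact: smoothV.
case: c; last by case: c' => //; exact: smooth_cst.
by apply: (smoothD oO); exact: smoothX.
Qed.

Lemma derive_half_plane_of (f : V -> 'M[R]_2) u x : smooth_on O f ->
  (forall u, O u -> f u 1 1 != 0) -> O u ->
  'D_x (fun u => half_plane_of (f u)) u =
   (('D_x f u 0 1 * f u 1 1 - f u 0 1 * 'D_x f u 1 1) / f u 1 1 ^+ 2,
    - 'D_x f u 1 1 / f u 1 1 ^+ 2).
Proof.
move=> sf f1 Ou; have df := smooth_diff sf Ou.
have d01 := differentiable_entry 0 1 df; have d11 := differentiable_entry 1 1 df.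
have [di Di] := derive_real_comp d11 (@is_deriveV R id (f u 1 1) 1 1 (f1 u Ou) (is_derive_id _ _)).
have E01 := derive_entry x 0 1 df; have E11 := derive_entry x 1 1 df.
have dm : differentiable (fun u => f u 0 1 * (f u 1 1)^-1) u by exact: differentiableM.
refine (etrans (derive_pair x dm di) _).
refine (congr2 (fun a b : R => (a, b)) (etrans (derive_mul x d01 di) _) (etrans (Di x) _)).
  rewrite Di -E01 -E11 /GRing.scale /=; field; exact: f1.
rewrite -E11 /GRing.scale /=; field; exact: f1.
Qed.

(** The half-plane metric pulls back to the trace metric; the determinant and
    trace constraints eliminate the first entry of the matrix and of its
    tangent vectors. *)
Lemma half_plane_metric (f : V -> 'M[R]_2) u x y : smooth_on O f ->
  (forall u, O u -> pts SL2 (f u)) -> O u ->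
  met H (half_plane_of (f u)) ('D_x (fun u => half_plane_of (f u)) u)
    ('D_y (fun u => half_plane_of (f u)) u) =
  trace_metric (f u) ('D_x f u) ('D_y f u).
Proof.
move=> sf fS Ou.
have f1 v : O v -> f v 1 1 != 0.
  by move=> /fS[pf _]; rewrite gt_eqF// posdef_entry_gt0.
have tg z : trace_tangent true (f u) ('D_z f u).
  apply: (@det_tangent R 2 true SL2 _ V O f u z oO sf Ou fS).
  by move=> A; split=> [[pA dA]|[pA /(_ isT)]].
have E z := derive_half_plane_of z sf f1 Ou.
refine (etrans (congr2 (met H (half_plane_of (f u))) (E x) (E y)) _).
have [pf df] := fS u Ou; have c0 := f1 u Ou.
have [Xs /(_ isT) X0] := tg x; have [Ys /(_ isT) Y0] := tg y.
move: ('D_x f u) ('D_y f u) (f u) pf df c0 Xs X0 Ys Y0.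
move=> X Y A pA dA c0 Xs X0 Ys Y0; clear - pA dA c0 Xs X0 Ys Y0.
have sA := sym2E (posdef_sym pA); have sX := sym2E Xs; have sY := sym2E Ys.
have iE : invmx A = \matrix_(i, j) (if i == j then A (1 - i) (1 - i) else - A 0 1).
  have Au := posdef_unit pA; apply: (can_inj (mulKmx Au)); rewrite mulmxV//.
  have d := dA; rewrite det2E sA in d.
  by apply: mx2P; rewrite mul2E !mxE /= ?subrr ?subr0 ?sA -?d; ring.
have i00 : invmx A 0 0 = A 1 1 by rewrite iE mxE /= subr0.
have i11 : invmx A 1 1 = A 0 0 by rewrite iE mxE /= subrr.
have i01 : invmx A 0 1 = - A 0 1 by rewrite iE mxE.
have i10 : invmx A 1 0 = - A 0 1 by rewrite iE mxE.
have a : A 0 0 = (1 + A 0 1 ^+ 2) / A 1 1 by rewrite -dA det2E sA; field.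
have t (Z : 'M[R]_2) : Z 1 0 = Z 0 1 -> \tr (invmx A *m Z) = 0 ->
    Z 0 0 = (2 * A 0 1 * Z 0 1 - (1 + A 0 1 ^+ 2) / A 1 1 * Z 1 1) / A 1 1.
  move=> sZ; rewrite tr2E !mul2E i00 i01 i10 i11 sZ a => E0.
  apply: (mulfI c0); rewrite mulrCA divff// mulr1.
  apply/eqP; rewrite -subr_eq0 -[X in _ == X]E0; apply/eqP; by field.
rewrite /trace_metric tr2E !mul2E i00 i01 i10 i11 sX sY (t X sX X0) (t Y sY Y0) a /=.
by field.
Qed.

End Smooth.

End HalfPlane.

Section HyperbolicPlane.
Variable R : realType.
Local Notation H := (hyperbolic_plane (2^-1 : R)).
Local Notation SL2 := (SLPD R 2).

Lemma SLPD_pts n (A : 'M[R]_n) :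
  pts (SLPD R n) A <-> posdef A /\ (true -> \det A = 1).
Proof. by split=> [[pA dA]|[pA /(_ isT)]]. Qed.

Lemma PD_pts n (A : 'M[R]_n) :
  pts (PD R n) A <-> posdef A /\ (false -> \det A = 1).
Proof. by split=> [|[]]. Qed.

Definition plane_chart (u : 'rV[R]_2) : R * R := (u 0 0, u 0 1).
Definition plane_cochart (z : R * R) : 'rV[R]_2 :=
  \row_i if i == 0 then z.1 else z.2.

Lemma plane_chartK u : plane_cochart (plane_chart u) = u.
Proof.
apply/rowP => i; rewrite mxE; case: i => [[|[|//]] ?] /=;
  congr (u _ _); exact/val_inj.
Qed.

Lemma plane_cochartK z : plane_chart (plane_cochart z) = z.
Proof. by rewrite /plane_chart !mxE /= -surjective_pairing. Qed.

Lemma smooth_plane_chart (U : set 'rV[R]_2) : open U -> smooth_on U plane_chart.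
Proof.
by move=> oU; apply: smooth_pair => //; apply: (smooth_entry oU); exact: smooth_id.
Qed.

Lemma plane_local_param :
  local_param (S := H) [set u : 'rV[R]_2 | 0 < u 0 1] plane_chart.
Proof.
have oU : open [set u : 'rV[R]_2 | 0 < u 0 1] by exact: open_entry_gt0.
have oT := @openT (R * R)%type.
apply: (@local_param_of_retraction R (R * R)%type H [set u : 'rV[R]_2 | 0 < u 0 1]
  plane_chart setT plane_cochart) => //.
- exact: smooth_plane_chart.
- apply: (smooth_mx oT) => i j; apply: (@smooth_ext _ _ _ oT _
    (fun z : R * R => if j == 0 then z.1 else z.2)).
    by move=> z _; rewrite mxE.
  case: (j == 0).
    by apply: (smooth_lin oT (@linear_fst R R R)); exact: continuous_fst.
  by apply: (smooth_lin oT (@linear_snd R R R)); exact: continuous_snd.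
- by move=> u u1; split=> //; exact: plane_chartK.
- by move=> p _ _; exact: plane_cochartK.
Qed.

Lemma half_plane_param_pts U phi (u : 'rV[R]_2) :
  local_param (S := H) U phi -> U u -> 0 < (phi u).2.
Proof. exact: param_pts. Qed.

Lemma hyperbolic_riemannian : riemannian_manifold H.
Proof.
split.
- move=> p p2; exists [set u : 'rV[R]_2 | 0 < u 0 1], plane_chart, (plane_cochart p).
  split; [exact: plane_local_param|by rewrite /= mxE|exact: plane_cochartK].
- by move=> p v w _ _ /=; congr (_ / _); rewrite mulrC [X in _ + X]mulrC.
- by move=> p v v' w a _ _ _ /=; rewrite /GRing.scale /=; ring.
- move=> p v [U [phi [u [x [lp Uu <- _]]]]] v0 /=.
  have p2 := half_plane_param_pts lp Uu.
  rewrite divr_gt0 ?mulr_gt0 ?invr_gt0 ?ltr0n ?exprn_gt0//.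
  rewrite -!expr2 lt_def addr_ge0 ?sqr_ge0// andbT.
  apply: contra v0; rewrite paddr_eq0 ?sqr_ge0// !sqrf_eq0 => /andP[/eqP a /eqP b].
  by rewrite [v]surjective_pairing a b.
move=> U phi i j lp; have [oU sphi _ _ _] := lp.
have s1 (f : 'rV[R]_2 -> R * R) : smooth_on U f -> smooth_on U (fun u => (f u).1).
  by move=> sf; apply: (smooth_lin_comp oU (@linear_fst R R R)) => //; exact: continuous_fst.
have s2 (f : 'rV[R]_2 -> R * R) : smooth_on U f -> smooth_on U (fun u => (f u).2).
  by move=> sf; apply: (smooth_lin_comp oU (@linear_snd R R R)) => //; exact: continuous_snd.
have si := smooth_derive (basis_vec R i) sphi.
have sj := smooth_derive (basis_vec R j) sphi.
apply: (@smooth_ext _ _ _ oU _ (fun u =>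
  (('D_(basis_vec R i) phi u).1 * ('D_(basis_vec R j) phi u).1 +
   ('D_(basis_vec R i) phi u).2 * ('D_(basis_vec R j) phi u).2) *
  (2^-1 * (phi u).2 ^+ 2)^-1)).
  by move=> u _; rewrite [RHS]mxE.
apply: (smoothM oU).
  apply: (smoothD oU); apply: (smoothM oU); 
    [exact: (s1 _ si)|exact: (s1 _ sj)|exact: (s2 _ si)|exact: (s2 _ sj)].
apply: (smoothV oU) => [u Uu|].
  have p2 := half_plane_param_pts lp Uu.
  by rewrite mulf_neq0 ?invr_eq0 ?pnatr_eq0// expf_neq0// gt_eqF.
apply: (smoothM oU); first exact: smooth_cst.
by apply: (smoothX oU); exact: (s2 _ sphi).
Qed.

Lemma smooth_param_form U phi : local_param (S := H) U phi ->
  smooth_on U (fun u => form_of (phi u)).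
Proof.
move=> lp; have [oU sphi _ _ _] := lp; apply: smooth_form_of => // u Uu.
by rewrite gt_eqF// (half_plane_param_pts lp).
Qed.

(** The map to the half-plane is smooth on an open set of all matrices, so the
    immersion and openness conditions pass from [phi] to the matrices. *)
Lemma form_local_param U (phi : 'rV[R]_2 -> R * R) : local_param (S := H) U phi ->
  local_param (S := SL2) U (fun u => form_of (phi u)).
Proof.
move=> lp; have sF := smooth_param_form lp; have [oU sphi jphi iphi ophi] := lp.
have FS u : U u -> pts SL2 (form_of (phi u)).
  by move=> Uu; apply: form_of_pts; exact: half_plane_param_pts lp Uu.
have FK u : U u -> half_plane_of (form_of (phi u)) = phi u.
  by move=> Uu; apply: half_plane_ofK; exact: half_plane_param_pts lp Uu.
pose O := [set A : 'M[R]_2 | 0 < A 1 1].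
have oO : open O by exact: open_entry_gt0.
have OS A : pts SL2 A -> O A by move=> [pA _]; exact: posdef_entry_gt0.
have sh : smooth_on O (@half_plane_of R).
  apply: (smooth_half_plane_of oO (f := id) (smooth_id oO)).
  by move=> A /lt0r_neq0.
split=> //.
- move=> u v Uu Uv E; apply: jphi => //; rewrite !inE in Uu Uv.
  exact: etrans (esym (FK u Uu)) (etrans (congr1 (@half_plane_of R) E) (FK v Uv)).
- move=> u x Uu D0; apply: (iphi u) => //.
  refine (etrans (esym (open_eq_derive oU x FK Uu)) _).
  have dh := smooth_diff sh (OS _ (FS _ Uu)).
  refine (etrans (derive_comp x (smooth_diff sF Uu) dh) _).
  by rewrite D0 derive0.
move=> U' oU' sU'; have [W oW WE] := ophi U' oU' sU'.
exists [set A | O A /\ W (half_plane_of A)].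
  rewrite openE => A [OA WA]; have ch := smooth_continuous sh OA.
  have nO : \forall B \near A, O B by exact: open_nbhs_nbhs.
  have nW : \forall B \near A, W (half_plane_of B) by apply: ch; exact: open_nbhs_nbhs.
  by rewrite /interior /=; near=> B; split; near: B.
apply/seteqP; split=> [A [u U'u <-]|A [SA [_ WA]]].
  have Uu := sU' _ U'u; have SA := FS _ Uu; split=> //; split; first exact: OS.
  rewrite FK//; have : (phi @` U') (phi u) by exists u.
  by rewrite WE => -[].
have : (pts H `&` W) (half_plane_of A) by split=> //; exact: half_plane_of_pts.
by rewrite -WE => -[u U'u E]; exists u => //; rewrite E form_ofK.
Unshelve. all: by end_near. Qed.

Lemma form_param_metric U (phi : 'rV[R]_2 -> R * R) : local_param (S := H) U phi ->
  forall u, U u -> param_metric (S := H) phi u =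
    param_metric (S := SL2) (fun u => form_of (phi u)) u.
Proof.
move=> lp u Uu; have sF := smooth_param_form lp; have [oU sphi _ _ _] := lp.
have FS v : U v -> pts SL2 (form_of (phi v)).
  by move=> Uv; apply: form_of_pts; exact: half_plane_param_pts lp Uv.
have FK v : U v -> half_plane_of (form_of (phi v)) = phi v.
  by move=> Uv; apply: half_plane_ofK; exact: half_plane_param_pts lp Uv.
apply/matrixP => i j; rewrite [LHS]mxE [RHS]mxE.
have D (k : 'I_2) := open_eq_derive oU (basis_vec R k) FK Uu.
refine (etrans _ (half_plane_metric oU (basis_vec R i) (basis_vec R j) sF FS Uu)).
refine (etrans (esym (congr2 (met H (phi u)) (D i) (D j))) _).
exact: (esym (congr1 (fun z => met H z _ _) (FK u Uu))).
Qed.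

(** For symmetric traceless matrices of order two, the squared norm of the
    commutator is twice the Gram determinant. *)
Lemma SL2_sectional (A V W : 'M[R]_2) : pts SL2 A -> trace_tangent true A V ->
  trace_tangent true A W -> independent2 V W -> trace_sectional A V W = - 2^-1.
Proof.
move=> [pA dA] [Vs /(_ isT) V0] [Ws /(_ isT) W0] ind.
have := Cauchy_Schwarz_trace_strict pA Vs Ws ind; rewrite /trace_sectional.
move=> /lt0r_neq0 D0; apply: (canLR (mulfK D0)).
move: D0 Vs Ws V0 W0 => _ Vs Ws.
have [M Mu ->] := posdef_sqrt pA; have Mtu : M^T \in unitmx by rewrite unitmx_tr.
have [a As ->] := sym_congr_factor Mu Vs; have [b Bs ->] := sym_congr_factor Mu Ws.
rewrite trace_curvature_num// !trace_metric_sqr//.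
have T c : \tr (invmx (M *m M^T) *m (M *m c *m M^T)) = \tr c.
  rewrite invmx_mul// !mulmxA mulmxKV// mxtrace_mulC !mulmxA mulmxV//.
  by rewrite mul1mx.
rewrite !T !tr2E => a0 b0.
have a1 : a 1 1 = - a 0 0 by rewrite -[LHS](addKr (a 0 0)) a0 addr0.
have b1 : b 1 1 = - b 0 0 by rewrite -[LHS](addKr (b 0 0)) b0 addr0.
have sa := sym2E As; have sb := sym2E Bs.
rewrite mul2E [(_^T) 0 0]mxE [(_^T) 1 0]mxE mul2E [(_^T) 0 1]mxE [(_^T) 1 1]mxE.
rewrite !(addmxE, oppmxE) !mul2E sa sb a1 b1; by field.
Qed.

(** The curvature is read off from the matrices: a chart of the half-plane is
    also a chart of the slice, with the same metric coefficients. *)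
Lemma hyperbolic_curvature : constant_curvature H (- 2^-1).
Proof.
move=> p v w _ _ _ ind U phi u x y lp Uu up Dx Dy.
have flp := form_local_param lp; have [oU sphi _ iphi _] := lp.
rewrite (sectional_coord_local oU (form_param_metric lp) x y Uu).
have FS := param_pts flp Uu.
have dphi := smooth_diff sphi Uu; have [_ sF _ iF _] := flp.
have dF := smooth_diff sF Uu.
have hS := SLPD_pts (n := 2).
have hd : mdim SL2 = if true then (2 * 3)./2.-1 else (2 * 3)./2 by [].
have n0 : (0 < 2)%N by [].
refine (etrans (@trace_has_sectional R 2 true SL2 hS (erefl _) _
  (@sym_coord_linear 2 n0 true (mdim SL2) hd R)
  (@psi_faithful R 2 n0 true SL2 hS hd) _ _ _ U (fun u => form_of (phi u)) u x y
  flp Uu (erefl _) (erefl _) (erefl _)) _).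
apply: SL2_sectional => //; try exact: (param_tangent hS _ flp Uu).
move=> a b E; apply: ind.
have E0 := iF u _ Uu (etrans (derive_comb dF a b x y) E).
refine (etrans (congr2 (fun X Y => a *: X + b *: Y) (esym Dx) (esym Dy)) _).
refine (etrans (esym (derive_comb dphi a b x y)) _).
exact: (etrans (congr1 (fun z => 'D_z phi u) E0) (derive0 phi u)).
Qed.

Lemma half_plane_isometry : Defs.isometry SL2 H (@half_plane_of R).
Proof.
have nz U phi : local_param (S := SL2) U phi -> forall u, U u -> phi u 1 1 != 0.
  move=> lp u Uu; have [pA _] := param_pts lp Uu.
  by rewrite gt_eqF// posdef_entry_gt0.
split.
- split=> [A|U phi lp]; first exact: half_plane_of_pts.
  by have [oU sphi _ _ _] := lp; apply: smooth_half_plane_of => //; exact: nz lp.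
- move=> U phi u x y lp Uu; have [oU sphi _ _ _] := lp.
  by apply: (half_plane_metric oU x y sphi _ Uu) => v; exact: param_pts.
exists (@form_of R); split.
- split=> [z|U phi lp]; first exact: form_of_pts.
  exact: smooth_param_form.
- exact: form_ofK.
- exact: half_plane_ofK.
Qed.

Let r : R := Num.sqrt 2%:R.

(** The composite of [split_map] with the half-plane coordinate of the normalized
    matrix; [product_metric] covers both factors. *)
Lemma half_plane_product :
  isometric (PD R 2) (riem_prod H (euclidean_line R)).
Proof.
have n0 : (0 < 2)%N by [].
exists (fun A => (half_plane_of (unimod A), ln (\det A) / r)).
have pphi U phi : local_param (S := PD R 2) U phi -> forall u, U u -> posdef (phi u).
  by move=> lp u Uu; exact: (param_pts lp Uu).
have sU U phi : local_param (S := PD R 2) U phi -> smooth_on U (fun u => unimod (phi u)).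
  move=> lp; have [oU sphi _ _ _] := lp; apply: smooth_unimod => //.
  by move=> u /(pphi _ _ lp)/posdef_det_gt0.
have US U phi : local_param (S := PD R 2) U phi ->
    forall u, U u -> pts SL2 (unimod (phi u)).
  by move=> lp u Uu; apply: split_pts => //; exact: pphi lp u Uu.
have sh U phi : local_param (S := PD R 2) U phi ->
    smooth_on U (fun u => half_plane_of (unimod (phi u))).
  move=> lp; have [oU _ _ _ _] := lp.
  apply: smooth_half_plane_of => //; first exact: sU.
  by move=> u Uu; have [pA _] := US _ _ lp u Uu; rewrite gt_eqF// posdef_entry_gt0.
have sl U phi : local_param (S := PD R 2) U phi ->
    smooth_on U (fun u => ln (\det (phi u)) / r).
  move=> lp; have [oU sphi _ _ _] := lp; apply: (smoothM oU); last exact: smooth_cst.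
  by apply: smooth_ln_det => //; exact: pphi lp.
split.
- split=> [A pA|U phi lp].
    by split=> //; apply: half_plane_of_pts; exact: split_pts.
  by have [oU _ _ _ _] := lp; apply: smooth_pair => //; [exact: sh|exact: sl].
- move=> U phi u x y lp Uu; have [oU sphi _ _ _] := lp.
  have D z := derive_pair z (smooth_diff (sh _ _ lp) Uu) (smooth_diff (sl _ _ lp) Uu).
  refine (etrans (congr2 (met (riem_prod H (euclidean_line R))
    (half_plane_of (unimod (phi u)), ln (\det (phi u)) / r)) (D x) (D y)) _).
  refine (etrans (congr1 (fun a : R => a +
     'D_x (fun u => ln (\det (phi u)) / r) u * 'D_y (fun u => ln (\det (phi u)) / r) u)
    (half_plane_metric oU x y (sU _ _ lp) (US _ _ lp) Uu)) _).
  exact: (product_metric n0 x y oU sphi (pphi _ _ lp) Uu).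
exists (fun z => expR (z.2 / r) *: form_of z.1); split.
- split=> [[z t] [/= z2 _]|U phi lp].
    have [pB _] := form_of_pts z2.
    by apply: posdef_scale => //; exact: expR_gt0.
  have [oU sphi _ _ _] := lp.
  have p2 u : U u -> 0 < (phi u).1.2 by move=> Uu; have [] := param_pts lp Uu.
  apply: (smooth_scale oU).
    apply: (smooth_expR oU); apply: (smoothM oU); last exact: smooth_cst.
    apply: (smooth_lin_comp oU (@linear_snd R (R * R)%type R)) => //.
    exact: continuous_snd.
  apply: smooth_form_of => //; last by move=> u /p2/lt0r_neq0.
  apply: (smooth_lin_comp oU (@linear_fst R (R * R)%type R)) => //.
  exact: continuous_fst.
- move=> A pA /=; rewrite form_ofK; first exact: exp_unimod.
  exact: split_pts.
move=> [z t] [/= z2 _]; have [pB dB] := form_of_pts z2.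
by rewrite unimod_exp// half_plane_ofK// ln_det_exp.
Qed.

End HyperbolicPlane.

(** * The radial direction is the kernel of the Ricci curvature *)

Section RicciPD.
Variables (R : realType) (n : nat) (n0 : (0 < n)%N).
Implicit Types Q X : 'M[R]_n.

Lemma trace_metric_ray Q X : Q \in unitmx ->
  trace_metric Q X Q = \tr (invmx Q *m X) /\ trace_metric Q Q Q = n%:R.
Proof.
move=> Qu; rewrite trace_metricC /trace_metric mulVmx// !mul1mx.
by rewrite mulVmx// mxtrace1.
Qed.

(** Cauchy-Schwarz against the radial direction [Q], whose squared norm is n. *)
Lemma ricci_form_le0 Q X : posdef Q -> X^T = X -> ricci_form Q X X <= 0.
Proof.
move=> pQ Xs; have [E1 E2] := trace_metric_ray X (posdef_unit pQ).
have := Cauchy_Schwarz_trace pQ Xs (posdef_sym pQ); rewrite E1 E2 /ricci_form.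
by move=> CS; rewrite mulNr oppr_le0 mulr_ge0// subr_ge0 mulrC -expr2 mulrC.
Qed.

Lemma ricci_form_eq0 Q X : posdef Q -> X^T = X ->
  ricci_form Q X X = 0 <-> exists lambda : R, X = lambda *: Q.
Proof.
move=> pQ Xs; have Qu := posdef_unit pQ; have [E1 E2] := trace_metric_ray X Qu.
have nn := n_neq0 R n0; split=> [r0|[l ->]]; last first.
  rewrite /ricci_form -scalemxAr mulVmx// mxtraceZ mxtrace1.
  rewrite (linZ (trace_metric_linl _ _)) trace_metricC.
  rewrite (linZ (trace_metric_linl _ _)) (trace_metric_ray Q Qu).2 /GRing.scale /=.
  by ring.
have ps : (trace_metric Q Q Q *: X - trace_metric Q X Q *: Q)^T =
    trace_metric Q Q Q *: X - trace_metric Q X Q *: Q.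
  by rewrite trmxB !trmxZ Xs posdef_sym.
have := gram_defect Q X Q; have -> : trace_metric Q X X * trace_metric Q Q Q
    - trace_metric Q X Q ^+ 2 = - 4 * ricci_form Q X X.
  by rewrite E1 E2 /ricci_form; field.
rewrite r0 !mulr0 => /(trace_metric_eq0 pQ ps)/eqP; rewrite subr_eq0 E1 E2 => /eqP E.
exists (n%:R^-1 * \tr (invmx Q *m X)).
by rewrite -scalerA -E scalerA mulVf// scale1r.
Qed.

Lemma triangular_natr : ((n * n.+1)./2)%:R = n%:R * (n%:R + 1) / 2 :> R.
Proof.
have E : (n * n.+1)./2.*2 = (n * n.+1)%N.
  by rewrite even_halfK// oddM /= andbN.
have : ((n * n.+1)./2.*2)%:R = (n * n.+1)%:R :> R by rewrite E.
rewrite -muln2 !natrM -[n.+1]addn1 natrD => <-.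
by field.
Qed.

End RicciPD.

Theorem proposition3p1 (R : realType) (n : nat) (hn : (2 <= n)%N) :
  (* (a) *)
  ([/\ riemannian_manifold (PD R n), complete_manifold (PD R n),
       simply_connected (pts (PD R n)), homogeneous (PD R n)
     & nonpositive_curvature (PD R n)] /\
   [/\ riemannian_manifold (SLPD R n), complete_manifold (SLPD R n),
       simply_connected (pts (SLPD R n)), homogeneous (SLPD R n)
     & nonpositive_curvature (SLPD R n)] /\
   einstein (SLPD R n) /\
   isometric (PD R n) (riem_prod (SLPD R n) (euclidean_line R))) /\
  (* (b) *)
  ((forall Q X, pts (PD R n) Q -> tangent (PD R n) Q X ->
      exists r : R, [/\ has_ricci (PD R n) Q X X r, r <= 0
        & r = 0 <-> exists lambda : R, X = lambda *: Q]) /\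
   (forall Q, pts (PD R n) Q ->
      has_scalar (PD R n) Q (- ((n%:R - 1) * n%:R * (n%:R + 2) / 8)))) /\
  (* (c) *)
  ((symmetric_manifold (PD R n) /\
    forall Q, pts (PD R n) Q ->
      symmetry_at (PD R n) Q (phi_sym Q) /\
      forall X, pts (PD R n) X -> (phi_sym Q X = X <-> X = Q)) /\
   (symmetric_manifold (SLPD R n) /\
    forall Q, pts (SLPD R n) Q ->
      symmetry_at (SLPD R n) Q (phi_sym Q) /\
      forall X, pts (SLPD R n) X -> (phi_sym Q X = X <-> X = Q))) /\
  (* (d) *)
  ([/\ riemannian_manifold (hyperbolic_plane (2^-1 : R)),
       constant_curvature (hyperbolic_plane (2^-1 : R)) (- 2^-1),
       isometric (SLPD R 2) (hyperbolic_plane (2^-1 : R))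
     & isometric (PD R 2)
         (riem_prod (hyperbolic_plane (2^-1 : R)) (euclidean_line R))]).
Proof.
have n0 : (0 < n)%N by exact: leq_trans hn.
pose P := PD_pts (R := R) (n := n); pose S := SLPD_pts (R := R) (n := n).
have dP : mdim (PD R n) = if false then (n * n.+1)./2.-1 else (n * n.+1)./2 by [].
have dS : mdim (SLPD R n) = if true then (n * n.+1)./2.-1 else (n * n.+1)./2 by [].
have lP := @sym_coord_linear n n0 false _ dP R.
have lS := @sym_coord_linear n n0 true _ dS R.
have fP := @psi_faithful R n n0 false (PD R n) P dP.
have fS := @psi_faithful R n n0 true (SLPD R n) S dS.
split; [split; [|split; [|split]]|split; [split|split; [split|]]].
- split.
  + exact: (trace_riemannian P (erefl _) (@trace_charts R n n0 false _ P dP)).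
  + exact: (@trace_complete R n n0 false _ P (erefl _) dP).
  + exact: (trace_simply_connected n0 P).
  + exact: (trace_homogeneous P (erefl _)).
  + exact: (trace_nonpositive P (erefl _) lP fP).
- split.
  + exact: (trace_riemannian S (erefl _) (@trace_charts R n n0 true _ S dS)).
  + exact: (@trace_complete R n n0 true _ S (erefl _) dS).
  + exact: (trace_simply_connected n0 S).
  + exact: (trace_homogeneous S (erefl _)).
  + exact: (trace_nonpositive S (erefl _) lS fS).
- exists (- 4^-1 * n%:R) => p v w Sp /(tangent_trace_tangent S)[_ [_ /(_ isT) v0]] _.
  have -> : - 4^-1 * n%:R * met (SLPD R n) p v w = ricci_form p v w.
    by rewrite /ricci_form v0 mul0r subr0 mulrA.
  exact: (trace_has_ricci S (erefl _) lS fS).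
- by exists (@split_map R n); exact: split_isometry.
- move=> Q X pQ /(tangent_trace_tangent P)[_ [Xs _]]; exists (ricci_form Q X X).
  split; [exact: (trace_has_ricci P (erefl _) lP fP)|exact: ricci_form_le0|].
  exact: ricci_form_eq0.
- move=> Q pQ; have := trace_has_scalar (p := Q) P (erefl _) lP fP n0 isT.
  rewrite (_ : - 4^-1 * _ = - ((n%:R - 1) * n%:R * (n%:R + 2) / 8))//.
  by rewrite -[mdim _]/((n * n.+1)./2) triangular_natr; field.
- split; first exact: (trace_symmetric P (erefl _)).
  move=> Q SQ; split; first exact: (phi_sym_symmetry P (erefl _)).
  by move=> X SX; exact: phi_sym_fixed.
- split; first exact: (trace_symmetric S (erefl _)).
  move=> Q SQ; split; first exact: (phi_sym_symmetry S (erefl _)).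
  by move: SQ => [pQ _] X [pX _]; exact: phi_sym_fixed.
split.
- exact: hyperbolic_riemannian.
- exact: hyperbolic_curvature.
- by exists (@half_plane_of R); exact: half_plane_isometry.
exact: half_plane_product.
Qed.
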